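(* Let $f:[0,\infty)\to\mathbb{R}$ be locally integrable (integrable on $[0,a]$ for every $a>0$), and let $H=\begin{pmatrix} h_{11} & 0\\ 0& h_{22}\end{pmatrix}$, with $h_{11}(t)=\exp\left(2\int_0^t f(s)\,ds\right)$ and $h_{22}=1/h_{11}$, be the Hamiltonian of the real Dirac system on $\mathbb{R}_+$ with potential $f$. For $T>0$ let $H^T=\begin{pmatrix} h_{11}^T & 0\\ 0& h_{22}^T\end{pmatrix}$ be the step-function Hamiltonian defined, for every integer $n\geqslant 0$, by $$h_{11}^T(t)=\frac1T\int_{nT}^{(n+1)T}h_{11}(s)\,ds,\qquad h_{22}^T(t)=\frac{1}{h_{11}^T(t)},\qquad t\in[nT,(n+1)T).$$ Let $\mu$ be the spectral measure of the real Dirac system (equivalently, of the canonical system with Hamiltonian $H$), and let $\mu_T$ be the spectral measure of the canonical system with Hamiltonian $H^T$. Then for every $a>0$ and every $\phi\in PW_a$, $$\|\phi\|_{L^2(\mu_T)}\to\|\phi\|_{L^2(\mu)}\quad\text{as } T\to 0.$$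
   Context: Canonical systems. For a Hamiltonian $H:(0,\infty)\to\mathbb{R}^{2\times2}$ (locally integrable on $[0,\infty)$, $H\geqslant0$ a.e., here $\det H=1$ a.e.), the canonical system on $\mathbb{R}_+$ is $\Omega\dot X(t)=zH(t)X(t)$, $t\in(0,\infty)$, where $\Omega=\begin{pmatrix}0&1\\ -1&0\end{pmatrix}$ and $z\in\mathbb{C}$. Let $X(t,z)=\begin{pmatrix} u(t,z) \\ v(t,z) \end{pmatrix}$ be the solution with Neumann initial condition $X(0,z)=\begin{pmatrix}1\\ 0\end{pmatrix}$ and put $E_t(z)=E(t,z)=u(t,z)-iv(t,z)$. For each $t>0$, $E_t$ is a Hermite-Biehler function, i.e. entire with $|E_t(z)|>|E_t(\overline z)|$ for $z\in\mathbb{C}_+$. De Branges spaces. For a Hermite-Biehler function $E$, $B(E)$ is the Hilbert space of entire functions $F$ such that $F/E$ and $F^\#/E$ belong to the Hardy space $H^2(\mathbb{C}_+)$, where $F^\#(z)=\overline{F(\overline z)}$, with inner product $[F,G]=\int_{\mathbb{R}}F(x)\overline{G(x)}\frac{dx}{|E(x)|^2}$. Spectral measure. The spectral measure of the system (with the Neumann condition at $0$) is the positive measure $\mu$ on $\mathbb{R}$ such that every $B(E_t)$, $t\in(0,\infty)$, is isometrically embedded in $L^2(\mu)$; when the Hamiltonian $H:(0,\infty)\to\mathbb{R}^{2\times2}$ is locally integrable on $[0,\infty)$ with $H\geqslant0$ a.e. and $\det H=1$ a.e., this measure exists and is unique. Real Dirac systems. The real Dirac system on $\mathbb{R}_+$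 with potential $f$ is $\Omega\dot X(t)=zX(t)-Q(t)X(t)$, $t\in(0,\infty)$, with $Q(t)=\begin{pmatrix} 0 & f(t) \\ f(t) & 0 \end{pmatrix}$. Its spectral measure is defined in the same way, through $E=u-iv$ for the solution with Neumann initial condition. Substituting $X=M_0Y$, where $M_0(t)=\mathrm{diag}\left(e^{\int_0^tf},e^{-\int_0^tf}\right)$ is the matrix solution at $z=0$, rewrites it as the canonical system with Hamiltonian $H=M_0^TM_0$ and the same spectral measure. Paley-Wiener space. $PW_a$ is the space of entire functions of exponential type at most $a$ whose restriction to $\mathbb{R}$ lies in $L^2(\mathbb{R})$. *)

(* Defs.v *)
From HB Require Import structures.
From mathcomp Require Import all_boot all_order all_algebra.
From mathcomp Require Import complex.
From mathcomp Require Import all_classical all_reals all_analysis.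

Set Implicit Arguments.
Unset Strict Implicit.
Unset Printing Implicit Defensive.

Import Order.TTheory GRing.Theory Num.Theory.
Import numFieldNormedType.Exports.

Local Open Scope classical_set_scope.
Local Open Scope ring_scope.
Local Open Scope complex_scope.

Notation borel_measure R := (
  {measure set (measurableTypeR R) -> \bar R}).

Section ComplexFunctions.
Context {R : realType}.
Implicit Types (F G E : R[i] -> R[i]) (g : R -> R[i]) (D : set R).

Local Notation leb := (@lebesgue_measure R).

(* The modulus with values in [R]; the norm [`|z|] of the library has values in
   [R[i]]. *)
Local Notation cmod z := (ComplexField.Normc.normc z).

Definition Cintegrable D g : Prop :=
  leb.-integrable D (EFin \o (fun s => complex.Re (g s))) /\
  leb.-integrable D (EFin \o (fun s => complex.Im (g s))).

Definition Cintegral D g : R[i] :=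
  Rintegral leb D (fun s => complex.Re (g s)) +i* Rintegral leb D (fun s => complex.Im (g s)).

Definition L2norm (mu : borel_measure R) g : \bar R :=
  Lnorm mu 2%:E (fun x => (cmod (g x))%:E).

Definition in_L2 (mu : borel_measure R) g : Prop :=
  [/\ measurable_fun setT (fun x : measurableTypeR R => complex.Re (g x)),
      measurable_fun setT (fun x : measurableTypeR R => complex.Im (g x)) &
      (L2norm mu g < +oo)%E].

Definition restr_real F : R -> R[i] := fun x => F x%:C.

Definition Cderivable F (z : R[i]) : Prop :=
  derivable (F : R[i]^o -> R[i]^o) z 1.

Definition entire F : Prop := forall z, Cderivable F z.

Definition hardy2 G : Prop :=
  (forall z, 0 < complex.Im z -> Cderivable G z) /\
  exists M : R, forall y, 0 < y ->
    (L2norm leb (fun x => G (x +i* y)%C) <= M%:E)%E.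

Definition sharp F : R[i] -> R[i] := fun z => (F z^*)^*.

(* On E = E_t, which has no zeros in the closed upper half-plane, the quotients
   below are genuine; they are not affected by the convention 0^-1 = 0. *)
Definition deBranges E F : Prop :=
  [/\ entire F, hardy2 (fun z => F z / E z) & hardy2 (fun z => sharp F z / E z)].

(* The norm induced by [F, G] = \int F(x) (G(x))^* |E(x)|^-2 dx. *)
Definition deBranges_norm E F : \bar R :=
  L2norm leb (restr_real (fun z => F z / E z)).

Definition exp_type_le (a : R) F : Prop :=
  forall e : R, 0 < e ->
    exists K : R, forall z, cmod (F z) <= K * expR ((a + e) * cmod z).

Definition paley_wiener (a : R) F : Prop :=
  [/\ entire F, exp_type_le a F & in_L2 leb (restr_real F)].

End ComplexFunctions.

Section Systems.
Context {R : realType}.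
Implicit Types (H : R -> 'M[R]_2) (f : R -> R) (z : R[i]).

Local Notation leb := (@lebesgue_measure R).

Definition mx2 {K : Type} (a b c d : K) : 'M[K]_2 :=
  \matrix_(i, j) if i == 0 then (if j == 0 then a else b)
                 else (if j == 0 then c else d).

Definition Omega : 'M[R[i]]_2 := mx2 0 1 (-1) 0.

(* X is a (Caratheodory) solution of Omega X' = A X on [0, +oo): the
   coefficients are only locally integrable, so the equation is read in
   integrated form, i.e. X is locally absolutely continuous and satisfies the
   differential equation almost everywhere. *)
Definition is_solution (A : R -> 'M[R[i]]_2) (X : R -> 'cV[R[i]]_2) : Prop :=
  forall t, 0 <= t -> forall i,
    Cintegrable `[0, t] (fun s => (A s *m X s) i 0) /\
    (Omega *m (X t - X 0)) i 0 = Cintegral `[0, t] (fun s => (A s *m X s) i 0).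

Definition is_neumann_solution A X : Prop :=
  is_solution A X /\ X 0 = \col_i (if i == 0 then 1 else 0).

Definition hermite_biehler (X : R[i] -> R -> 'cV[R[i]]_2) (t : R) : R[i] -> R[i] :=
  fun z => X z t 0 0 - (0 +i* 1) * X z t 1 0.

Definition isometrically_embedded E (mu : borel_measure R) : Prop :=
  forall F, deBranges E F ->
    in_L2 mu (restr_real F) /\ L2norm mu (restr_real F) = deBranges_norm E F.

(* The system Omega X' = A_z X is given by the function z |-> A_z.  The isometric
   embedding of B(E_t) into L^2(mu) is restriction to the real line; it is
   linear, so preserving norms amounts to preserving inner products. *)
Definition is_spectral_measure (A : R[i] -> R -> 'M[R[i]]_2)
    (mu : borel_measure R) : Prop :=
  exists2 X : R[i] -> R -> 'cV[R[i]]_2,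
    (forall z, is_neumann_solution (A z) (X z)) &
    (forall t, 0 < t -> isometrically_embedded (hermite_biehler X t) mu).

Definition canonical_system H : R[i] -> R -> 'M[R[i]]_2 :=
  fun z t => z *: map_mx (fun x : R => x%:C) (H t).

Definition dirac_system f : R[i] -> R -> 'M[R[i]]_2 :=
  fun z t => z%:M - map_mx (fun x : R => x%:C) (mx2 0 (f t) (f t) 0).

Definition dirac_h11 f (t : R) : R := expR (2 * Rintegral leb `[0, t] f).

(* For t >= 0 and T > 0, n = Num.truncn (t / T) is the natural number such that
   n T <= t < (n + 1) T. *)
Definition step_average (T : R) (h : R -> R) (t : R) : R :=
  let n := Num.truncn (t / T) in
  T^-1 * Rintegral leb `[n%:R * T, n.+1%:R * T] h.

Definition diag_hamiltonian (h : R -> R) : R -> 'M[R]_2 :=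
  fun t => mx2 (h t) 0 0 (h t)^-1.

Definition step_hamiltonian f (T : R) : R -> 'M[R]_2 :=
  diag_hamiltonian (step_average T (dirac_h11 f)).

End Systems.

(* Main.v *)
Require Import Defs.
From HB Require Import structures.
From mathcomp Require Import all_boot all_order all_algebra.
From mathcomp Require Import complex ring lra.
From mathcomp Require Import all_classical all_reals all_analysis measurable_realfun.

(** For [t] large compared to [a], every [phi] in [PW_a] belongs to [B(E_t)] for
    the Dirac system and for all the step Hamiltonians with [T <= 1]: along both
    kinds of systems the energy grows so fast that
    [|E_t(x + i y)| >= k e^(t y)] with [k > 0] independent of [T], while
    Plancherel-Polya bounds [phi] on horizontal lines.  Hence the norms of [phi]
    in [L^2(mu)] and [L^2(mu_T)] are integrals of [|phi|^2 / |E_t|^2] over the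
    real line.  As [T -> 0], the solution of the step system converges to that
    of the canonical system with Hamiltonian [M_0^T M_0], which is a diagonal
    dilation of the Dirac solution; dominated convergence applies, with [|phi|^2]
    as dominating function up to a constant.  The dilation does not change the
    integral, because [1/|E|^2 - 1/|G|^2] is a multiple of [Re (1 / (E G))] and
    [phi phi^# / (E G)] has integral 0. *)

Set Implicit Arguments.
Unset Strict Implicit.
Unset Printing Implicit Defensive.

Import Order.TTheory GRing.Theory Num.Theory.
Import numFieldNormedType.Exports.

Local Open Scope classical_set_scope.
Local Open Scope ring_scope.
Local Open Scope complex_scope.

(** The difficulty is a lower bound for E_t that does not degrade as T -> 0, although f is merely
    integrable and the number of jumps of H^T on [0, t] tends to infinity. On one block the
    Hamiltonian is diag(c^2, c^-2) with c constant; in the variables (c u, v / c) the system is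
    free, and the modulus of E_c = c u - i v / c gains the factor e^(y s) over a length s. Changing
    c costs at most the factor by which c changes, provided |F_c| <= |E_c| for F_c = c u + i v / c,
    and |E_c|^2 - |F_c|^2 is independent of c. If the energy is measured at block ends with c =
    e^(int f), a block costs twice the integral of |f| over it, and these costs add up to a bound
    free of T.

    The time t = 3 A, where |phi(z)| <= K e^(A |z|), comes from a Plancherel-Polya estimate with the
    rate 3 A for the norm on the line of height y; the contour shift behind the dilation step leads
    to the same threshold.

    The limit of the step solutions is (u / c, c v) with c = e^(int_0^t f), which is why a
    comparison of two different functions E over the same phi is unavoidable. *)

Local Notation cmod z := (ComplexField.Normc.normc z).
Local Notation Re := complex.Re.
Local Notation Im := complex.Im.

(** * Arithmetic of the real-valued modulus *)

Section Modulus.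
Context {R : realType}.
Implicit Types z w : R[i].

Lemma cmod_ge0 z : 0 <= cmod z.
Proof. by case: z => a b; rewrite sqrtr_ge0. Qed.

Lemma cmodM z w : cmod (z * w) = cmod z * cmod w.
Proof. exact: ComplexField.Normc.normcM. Qed.

Lemma cmodV z : cmod z^-1 = (cmod z)^-1.
Proof. exact: ComplexField.Normc.normcV. Qed.

Lemma cmodN z : cmod (- z) = cmod z.
Proof. exact: (@normcN R z). Qed.

Lemma cmodBC z w : cmod (z - w) = cmod (w - z).
Proof. by rewrite -cmodN opprB. Qed.

Lemma le_cmodD z w : cmod (z + w) <= cmod z + cmod w.
Proof. exact: le_normcD. Qed.

Lemma cmod0 : cmod (0 : R[i]) = 0.
Proof. exact: ComplexField.Normc.normc0. Qed.

Lemma cmod1 : cmod (1 : R[i]) = 1.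
Proof. exact: ComplexField.Normc.normc1. Qed.

Lemma cmod_eq0 z : (cmod z == 0) = (z == 0).
Proof.
apply/eqP/eqP => [/ComplexField.Normc.eq0_normc //|->]; exact: cmod0.
Qed.

Lemma cmod_gt0 z : (0 < cmod z) = (z != 0).
Proof. by rewrite lt_def cmod_eq0 cmod_ge0 andbT. Qed.

Lemma sqr_cmod z : cmod z ^+ 2 = Re z ^+ 2 + Im z ^+ 2.
Proof. by case: z => a b; rewrite sqr_sqrtr// addr_ge0// sqr_ge0. Qed.

Lemma cmodE z : cmod z = Num.sqrt (Re z ^+ 2 + Im z ^+ 2).
Proof. by case: z. Qed.

Lemma normcC z : `|z| = (cmod z)%:C.
Proof. by rewrite normc_def cmodE. Qed.

Lemma cmodC z : cmod z^* = cmod z.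
Proof. by case: z => a b /=; rewrite sqrrN. Qed.

Lemma cmod_real (x : R) : cmod x%:C = `|x|.
Proof. by rewrite /= expr0n /= addr0 sqrtr_sqr. Qed.

Lemma le_Re_cmod z : `|Re z| <= cmod z.
Proof. by rewrite cmodE -sqrtr_sqr ler_wsqrtr// lerDl sqr_ge0. Qed.

Lemma le_Im_cmod z : `|Im z| <= cmod z.
Proof. by rewrite cmodE -sqrtr_sqr ler_wsqrtr// lerDr sqr_ge0. Qed.

Lemma cmod_le_ReIm z : cmod z <= `|Re z| + `|Im z|.
Proof.
rewrite -(ler_pXn2r (_ : 0 < 2)%N) ?nnegrE ?cmod_ge0 ?addr_ge0//.
rewrite sqr_cmod -(real_normK (num_real (Re z))) -(real_normK (num_real (Im z))).
have := normr_ge0 (Re z); have := normr_ge0 (Im z); nra.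
Qed.

Lemma ReM z w : Re (z * w) = Re z * Re w - Im z * Im w.
Proof. by case: z w => [a b] [c d]. Qed.

Lemma ImM z w : Im (z * w) = Re z * Im w + Im z * Re w.
Proof. by case: z w => [a b] [c d]. Qed.

Lemma ReD z w : Re (z + w) = Re z + Re w.
Proof. by case: z w => [a b] [c d]. Qed.

Lemma ImD z w : Im (z + w) = Im z + Im w.
Proof. by case: z w => [a b] [c d]. Qed.

Lemma ReN z : Re (- z) = - Re z.
Proof. by case: z. Qed.

Lemma ImN z : Im (- z) = - Im z.
Proof. by case: z. Qed.

Lemma complexP z w : Re z = Re w -> Im z = Im w -> z = w.
Proof. by case: z w => [a b] [c d] /= -> ->. Qed.

End Modulus.

(** * Complex derivatives as first-order expansions *)

Section Holomorphy.
Context {R : realType}.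
Implicit Types (F G : R[i] -> R[i]) (z l : R[i]).

Lemma Cgt0_real (e : R[i]) : 0 < e -> e = (Re e)%:C.
Proof. by case: e => a b; rewrite ltcE/= => /andP[/eqP ->]. Qed.

(** Balls of [R[i]^o] have radii in [R[i]], and a positive complex number is real; so real radii and
    [cmod] suffice to describe neighbourhoods. *)
Lemma near0_cmod (P : R[i] -> Prop) :
  (\forall h \near (0 : R[i]^o)^', P h) <->
  exists2 d : R, 0 < d & forall h, h != 0 -> cmod h < d -> P h.
Proof.
split.
  rewrite /dnbhs /within /= => /nbhs_ballP[e e0 He].
  have er := Cgt0_real e0; exists (Re e); first by move: e0; rewrite /= er ltcR.
  move=> h h0 hd; apply: He => //; rewrite /ball /= sub0r normrN normcC er ltcR.
  by [].
move=> [d d0 H]; rewrite /dnbhs /within /=; apply/nbhs_ballP.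
exists d%:C; first by rewrite /= ltcR.
move=> h; rewrite /ball /= sub0r normrN normcC ltcR => hd h0; exact: H.
Qed.

(** The form without division: it is trivial at h = 0, so increments need not be kept away from 0
    when derivatives are composed or estimated. *)
Lemma CderivableP F z : Cderivable F z <->
  exists l, forall e : R, 0 < e -> exists2 d : R, 0 < d &
    forall h, cmod h < d -> cmod (F (z + h) - F z - l * h) <= e * cmod h.
Proof.
split.
  move=> /cvg_ex[l] /cvgrPdist_lt Hl; exists l => e e0.
  have /near0_cmod[d d0 Hd] : \forall h \near (0 : R[i]^o)^',
      `|l - h^-1 *: ((F \o shift z) h%:A - F z)| < e%:C.
    by apply: Hl; rewrite ltcR.
  exists d => // h hd; have [->|h0] := eqVneq h 0.
    by rewrite addr0 subrr mulr0 subr0 cmod0 mulr0.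
  have /= := Hd h h0 hd; rewrite normcC ltcR /shift /= /GRing.scale /= mulr1 => H.
  have -> : F (z + h) - F z - l * h = - (l - h^-1 * (F (h + z) - F z)) * h.
    by rewrite (addrC z h) opprB mulrBl mulrAC mulVf// mul1r.
  by rewrite cmodM cmodN ler_wpM2r ?cmod_ge0// ltW.
move=> [l Hl]; apply/cvg_ex; exists l; apply/cvgrPdist_le => e e0.
have er := Cgt0_real e0.
have e0' : 0 < Re e by move: e0; rewrite er ltcR.
have [d d0 Hd] := Hl _ e0'.
apply/near0_cmod; exists d => // h h0 hd.
have := Hd h hd.
have -> : F (z + h) - F z - l * h = - (l - h^-1 * (F (h + z) - F z)) * h.
  by rewrite (addrC z h) opprB mulrBl mulrAC mulVf// mul1r.
rewrite cmodM cmodN ler_pM2r ?cmod_gt0// => H.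
by rewrite er normcC lecR /= /shift /= /GRing.scale /= mulr1.
Qed.

Lemma Cderivable_cst (c : R[i]) z : Cderivable (fun=> c) z.
Proof. exact: (@derivable_cst _ R[i]^o R[i]^o). Qed.

Lemma Cderivable_id z : Cderivable (fun w => w) z.
Proof. exact: (@derivable_id _ R[i]^o). Qed.

Lemma CderivableD F G z : Cderivable F z -> Cderivable G z ->
  Cderivable (fun w => F w + G w) z.
Proof. exact: (@derivableD _ R[i]^o R[i]^o). Qed.

Lemma CderivableN F z : Cderivable F z -> Cderivable (fun w => - F w) z.
Proof. exact: (@derivableN _ R[i]^o R[i]^o). Qed.

Lemma CderivableB F G z : Cderivable F z -> Cderivable G z ->
  Cderivable (fun w => F w - G w) z.
Proof. exact: (@derivableB _ R[i]^o R[i]^o). Qed.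

Lemma CderivableM F G z : Cderivable F z -> Cderivable G z ->
  Cderivable (fun w => F w * G w) z.
Proof. exact: (@derivableM _ R[i]^o). Qed.

Lemma CderivableV F z : F z != 0 -> Cderivable F z ->
  Cderivable (fun w => (F w)^-1) z.
Proof. exact: (@derivableV _ R[i]^o). Qed.

Lemma Cderivable_comp F G z : Cderivable F z -> Cderivable G (F z) ->
  Cderivable (fun w => G (F w)) z.
Proof.
move=> /CderivableP[l Hl] /CderivableP[m Hm]; apply/CderivableP; exists (m * l).
move=> e e0; have l0 := cmod_ge0 l; have m0 := cmod_ge0 m.
have e1 : 0 < e / (2 * (1 + cmod l)) by rewrite divr_gt0// mulr_gt0//; lra.
(* The bound 1 keeps the increment of [F] below (1 + |l|) |h|; the other bound makes the error of
   [F], once multiplied by [m], cost at most e / 2 |h|. *)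
have e2 : 0 < Num.min 1 (e / (2 * (1 + cmod m))).
  by rewrite lt_min ltr01 divr_gt0// mulr_gt0//; lra.
have [d d0 Hd] := Hm _ e1; have [d' d'0 Hd'] := Hl _ e2.
exists (Num.min d' (d / (1 + cmod l))); first by rewrite lt_min d'0 divr_gt0//; lra.
move=> h; rewrite lt_min => /andP[hd'].
rewrite ltr_pdivlMr; last lra.
move=> hd; pose k := F (z + h) - F z.
have kh : cmod (k - l * h) <= Num.min 1 (e / (2 * (1 + cmod m))) * cmod h by exact: Hd'.
have h0 := cmod_ge0 h.
have kh1 : cmod (k - l * h) <= cmod h.
  apply: le_trans kh _; rewrite -[leRHS]mul1r ler_wpM2r//.
  by rewrite ge_min lexx.
have kh2 : cmod (k - l * h) <= e / (2 * (1 + cmod m)) * cmod h.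
  by apply: le_trans kh _; rewrite ler_wpM2r// ge_min lexx orbT.
have kl : cmod k <= cmod h * (1 + cmod l).
  rewrite -[k](subrK (l * h)); apply: le_trans (le_cmodD _ _) _.
  by rewrite cmodM; lra.
have := Hd k (le_lt_trans kl hd).
have -> : F z + k = F (z + h) by rewrite /k addrC subrK.
move=> H.
have -> : G (F (z + h)) - G (F z) - m * l * h =
  (G (F (z + h)) - G (F z) - m * k) + m * (k - l * h) by ring.
apply: le_trans (le_cmodD _ _) _; rewrite cmodM.
have H1 : e / (2 * (1 + cmod l)) * cmod k <= e / 2 * cmod h.
  apply: le_trans (ler_wpM2l (ltW e1) kl) _.
  rewrite le_eqVlt; apply/orP; left; apply/eqP; field; lra.
have H2 : cmod m * cmod (k - l * h) <= e / 2 * cmod h.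
  apply: le_trans (ler_wpM2l m0 kh2) _; rewrite mulrA ler_wpM2r//.
  rewrite mulrA ler_pdivrMr; last lra.
  have -> : e / 2 * (2 * (1 + cmod m)) = e + e * cmod m by field.
  by rewrite mulrC; lra.
lra.
Qed.

Lemma Cderivable_sharp F z : Cderivable F z^* -> Cderivable (sharp F) z.
Proof.
move=> /CderivableP[l Hl]; apply/CderivableP; exists l^* => e /Hl[d d0 Hd].
exists d => // h hd; rewrite -cmodC -(cmodC h).
have := Hd h^*; rewrite (cmodC h) => /(_ hd); rewrite /sharp.
by rewrite !rmorphB !rmorphM !rmorphD /= !conjcK.
Qed.

Lemma Cderivable_continuous F z : Cderivable F z -> forall e : R, 0 < e ->
  exists2 d : R, 0 < d & forall w, cmod (w - z) < d -> cmod (F w - F z) < e.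
Proof.
move=> /CderivableP[l Hl] e e0; have [d d0 Hd] := Hl 1 ltr01.
have c0 : 0 < 2 + cmod l by have := cmod_ge0 l; lra.
exists (Num.min d (e / (2 + cmod l))); first by rewrite lt_min d0 divr_gt0.
move=> w; rewrite lt_min => /andP[wd we].
have := Hd _ wd; rewrite (addrC z) subrK mul1r => H.
have -> : F w - F z = (F w - F z - l * (w - z)) + l * (w - z) by rewrite subrK.
apply: le_lt_trans (le_cmodD _ _) _; rewrite cmodM.
move: we; rewrite ltr_pdivlMr// => we.
have := cmod_ge0 (w - z); lra.
Qed.

End Holomorphy.

(** * Lebesgue integrals of real functions over segments *)

Section SegmentIntegrals.
Context {R : realType}.
Local Notation leb := (@lebesgue_measure R).
Implicit Types (F G : R -> R).

Definition rint (a b : R) F : R := Rintegral leb `[a, b] F.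

Definition intble (a b : R) F : Prop := leb.-integrable `[a, b] (EFin \o F).

Lemma intble_sub a b a' b' F : a <= a' -> b' <= b -> intble a b F -> intble a' b' F.
Proof.
move=> aa bb; apply: integrableS => //; apply: subset_itv; rewrite bnd_simp//.
Qed.

Lemma rint_split a m b F : a <= m -> m <= b -> intble a b F ->
  rint a b F = rint a m F + rint m b F.
Proof.
move=> am mb iF; apply/eqP; rewrite addrC -subr_eq; apply/eqP.
rewrite /rint Rintegral_itvB ?bnd_simp//.
rewrite Rintegral_itv_obnd_cbnd//; apply: (integrableS _ _ _ iF) => //.
by apply: subset_itv; rewrite bnd_simp.
Qed.

Lemma rint_same a F : rint a a F = 0.
Proof. by rewrite /rint set_itv1 Rintegral_set1. Qed.

Lemma intble_cst a b (k : R) : intble a b (fun=> k).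
Proof.
apply: continuous_compact_integrable; first exact: segment_compact.
by apply: continuous_subspaceT => x; exact: cvg_cst.
Qed.

Lemma rint_cst a b (k : R) : a <= b -> rint a b (fun=> k) = k * (b - a).
Proof.
move=> ab; rewrite /rint Rintegral_cst //=. rewrite lebesgue_measure_itv /= lte_fin.
case: ltP => [|ba]; first by [].
by have -> : b = a; [apply/eqP; rewrite eq_le ab ba|rewrite subrr].
Qed.

Lemma intbleD a b F G : intble a b F -> intble a b G -> intble a b (fun x => F x + G x).
Proof. by move=> iF iG; exact: (integrableD _ iF iG). Qed.

Lemma intbleB a b F G : intble a b F -> intble a b G -> intble a b (fun x => F x - G x).
Proof. by move=> iF iG; exact: (integrableB _ iF iG). Qed.

Lemma intbleZ a b F (k : R) : intble a b F -> intble a b (fun x => k * F x).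
Proof. by move=> iF; exact: (integrableZl _ _ iF). Qed.

Lemma intble_norm a b F : intble a b F -> intble a b (fun x => `|F x|).
Proof. by move=> iF; exact: (integrable_norm iF). Qed.

Lemma rintD a b F G : intble a b F -> intble a b G ->
  rint a b (fun x => F x + G x) = rint a b F + rint a b G.
Proof. by move=> iF iG; rewrite /rint RintegralD. Qed.

Lemma rintB a b F G : intble a b F -> intble a b G ->
  rint a b (fun x => F x - G x) = rint a b F - rint a b G.
Proof. by move=> iF iG; rewrite /rint RintegralB. Qed.

Lemma rintZ a b F k : intble a b F -> rint a b (fun x => k * F x) = k * rint a b F.
Proof. by move=> iF; rewrite /rint RintegralZl. Qed.

Lemma le_rint a b F G : intble a b F -> intble a b G ->
  (forall x, a <= x -> x <= b -> F x <= G x) -> rint a b F <= rint a b G.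
Proof.
by move=> iF iG FG; apply: le_Rintegral => //= x; rewrite in_itv /= => /andP[ax xb]; exact: FG.
Qed.

Lemma eq_rint a b F G :
  (forall x, a <= x -> x <= b -> F x = G x) -> rint a b F = rint a b G.
Proof.
move=> FG; apply: eq_Rintegral => x; rewrite inE /= in_itv /= => /andP[ax xb].
exact: FG.
Qed.

Lemma rint_ge0 a b F : (forall x, a <= x -> x <= b -> 0 <= F x) -> 0 <= rint a b F.
Proof.
by move=> F0; apply: Rintegral_ge0 => x; rewrite /= in_itv /= => /andP[]; exact: F0.
Qed.

Lemma le_normr_rint a b F : intble a b F -> `|rint a b F| <= rint a b (fun x => `|F x|).
Proof. by move=> iF; exact: le_normr_Rintegral. Qed.

Lemma rint_near a b F k M : a <= b -> intble a b F ->
  (forall x, a <= x -> x <= b -> `|F x - k| <= M) ->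
  `|rint a b F - k * (b - a)| <= M * (b - a).
Proof.
move=> ab iF FM; have ik := intble_cst a b k.
rewrite -(rint_cst _ ab) -rintB//; apply: le_trans (le_normr_rint (intbleB iF ik)) _.
rewrite -(rint_cst _ ab); apply: le_rint => //; last exact: intble_cst.
exact: intble_norm (intbleB iF ik).
Qed.

Lemma continuous_intble a b F :
  (forall x, a <= x -> x <= b -> {for x, continuous F}) -> intble a b F.
Proof.
move=> cF; apply: continuous_compact_integrable; first exact: segment_compact.
apply: continuous_in_subspaceT => x; rewrite inE /= in_itv /= => /andP[ax xb].
exact: cF.
Qed.

End SegmentIntegrals.

(** * Goursat's theorem on rectangles *)

Section Goursat.
Context {R : realType}.
Local Notation leb := (@lebesgue_measure R).
Implicit Types (g : R[i] -> R[i]).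

Lemma continuous_path g (p : R -> R[i]) (s : R) :
    (forall r, cmod (p r - p s) <= `|r - s|) -> Cderivable g (p s) ->
  {for s, continuous (fun r => Re (g (p r)))} /\
  {for s, continuous (fun r => Im (g (p r)))}.
Proof.
move=> hp dg; split; apply/cvgrPdist_lt => e e0;
  have [d d0 Hd] := Cderivable_continuous dg e0;
  apply/nbhs_ballP; exists d => // r; rewrite /ball /= => rs;
  (have /Hd H : cmod (p r - p s) < d by apply: le_lt_trans (hp r) _; rewrite distrC);
  apply: le_lt_trans H; rewrite cmodBC.
- by rewrite -ReN -ReD; exact: le_Re_cmod.
- by rewrite -ImN -ImD; exact: le_Im_cmod.
Qed.

Lemma horizontal_lip (y r s : R) : cmod ((r +i* y) - (s +i* y)) <= `|r - s|.
Proof. by rewrite /= subrr expr0n /= addr0 sqrtr_sqr. Qed.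

Lemma vertical_lip (x r s : R) : cmod ((x +i* r) - (x +i* s)) <= `|r - s|.
Proof. by rewrite /= subrr expr0n /= add0r sqrtr_sqr. Qed.

Definition rect_derivable g (a b c d : R) : Prop :=
  forall x y, a <= x -> x <= b -> c <= y -> y <= d -> Cderivable g (x +i* y).

(* The real part of the contour integral of g over the boundary of
   [a, b] x [c, d]; the imaginary part is that of -i g. *)
Definition rect_bdry g (a b c d : R) : R :=
  rint a b (fun x => Re (g (x +i* c)) - Re (g (x +i* d))) -
  rint c d (fun y => Im (g (b +i* y)) - Im (g (a +i* y))).

Lemma intble_bottom g a b c d y : rect_derivable g a b c d -> c <= y -> y <= d ->
  intble a b (fun x => Re (g (x +i* y))).
Proof.
move=> dg cy yd; apply: continuous_intble => x ax xb.
have [] := @continuous_path g (fun x => x +i* y) x; last by [].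
- by move=> r; exact: horizontal_lip.
- exact: dg.
Qed.

Lemma intble_side g a b c d x : rect_derivable g a b c d -> a <= x -> x <= b ->
  intble c d (fun y => Im (g (x +i* y))).
Proof.
move=> dg ax xb; apply: continuous_intble => y cy yd.
have [] := @continuous_path g (fun y => x +i* y) y; last by [].
- by move=> r; exact: vertical_lip.
- exact: dg.
Qed.

Lemma rect_derivable_sub g a b c d a' b' c' d' : rect_derivable g a b c d ->
  a <= a' -> b' <= b -> c <= c' -> d' <= d -> rect_derivable g a' b' c' d'.
Proof.
move=> dg aa bb cc dd x y ax xb cy yd.
by apply: dg; [exact: le_trans aa _|exact: le_trans bb|exact: le_trans cc _|exact: le_trans dd].
Qed.

Lemma rect_bdry_split_x g a m b c d : a <= m -> m <= b -> c <= d ->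
  rect_derivable g a b c d ->
  rect_bdry g a b c d = rect_bdry g a m c d + rect_bdry g m b c d.
Proof.
move=> am mb cd dg; rewrite /rect_bdry (@rint_split _ a m b)//; last first.
  by apply: intbleB; apply: (intble_bottom dg).
have ab := le_trans am mb.
have I x : a <= x -> x <= b -> intble c d (fun y => Im (g (x +i* y))).
  by move=> ax xb; exact: (intble_side dg).
by rewrite !(@rintB _ c d); [ring|by apply: I; lra..].
Qed.

Lemma rect_bdry_split_y g a b c m d : c <= m -> m <= d -> a <= b ->
  rect_derivable g a b c d ->
  rect_bdry g a b c d = rect_bdry g a b c m + rect_bdry g a b m d.
Proof.
move=> cm md ab dg; rewrite /rect_bdry (@rint_split _ c m d)//; last first.
  by apply: intbleB; apply: (intble_side dg).
have cd := le_trans cm md.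
have I y : c <= y -> y <= d -> intble a b (fun x => Re (g (x +i* y))).
  by move=> cy yd; exact: (intble_bottom dg).
by rewrite !(@rintB _ a b); [ring|by apply: I; lra..].
Qed.

(** Inner sides cancel when the boundary integrals of the four quarters are added, so some quarter
    carries at least a fourth of the total. *)
Lemma rect_bdry_quarter g a c w h : 0 <= w -> 0 <= h ->
  rect_derivable g a (a + w) c (c + h) ->
  exists s : R * R, [/\ a <= s.1, s.1 + w / 2 <= a + w, c <= s.2, s.2 + h / 2 <= c + h &
    `|rect_bdry g a (a + w) c (c + h)| <=
    4 * `|rect_bdry g s.1 (s.1 + w / 2) s.2 (s.2 + h / 2)|].
Proof.
move=> w0 h0 dg.
have e1 : rect_bdry g a (a + w) c (c + h) =
  rect_bdry g a (a + w / 2) c (c + h / 2) +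
  rect_bdry g a (a + w / 2) (c + h / 2) (c + h / 2 + h / 2) +
  (rect_bdry g (a + w / 2) (a + w / 2 + w / 2) c (c + h / 2) +
  rect_bdry g (a + w / 2) (a + w / 2 + w / 2) (c + h / 2) (c + h / 2 + h / 2)).
  have ew : a + w / 2 + w / 2 = a + w by field.
  have eh : c + h / 2 + h / 2 = c + h by field.
  rewrite ew eh (@rect_bdry_split_x g a (a + w / 2))//; [|lra..].
  congr (_ + _); apply: rect_bdry_split_y; try lra;
    apply: (rect_derivable_sub dg); lra.
set q1 := rect_bdry _ _ _ _ _ in e1 *.
move: e1; set p1 := rect_bdry _ _ _ _ _; set p2 := rect_bdry _ _ _ _ _.
set p3 := rect_bdry _ _ _ _ _; set p4 := rect_bdry _ _ _ _ _ => e1.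
have [H1|H1] := lerP `|q1| (4 * `|p1|).
  by exists (a, c); split => //=; lra.
have [H2|H2] := lerP `|q1| (4 * `|p2|).
  by exists (a, c + h / 2); split => //=; lra.
have [H3|H3] := lerP `|q1| (4 * `|p3|).
  by exists (a + w / 2, c); split => //=; lra.
have [H4|H4] := lerP `|q1| (4 * `|p4|).
  by exists (a + w / 2, c + h / 2); split => //=; lra.
have := ler_normD (p1 + p2) (p3 + p4); rewrite -e1.
have := ler_normD p1 p2; have := ler_normD p3 p4; lra.
Qed.

(** The supremum of the left ends works, since every right end bounds all left ends from above. *)
Lemma nested_point (a w : nat -> R) : (forall n, 0 <= w n) ->
  (forall n, a n <= a n.+1) -> (forall n, a n.+1 + w n.+1 <= a n + w n) ->
  exists x, forall n, a n <= x <= a n + w n.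
Proof.
move=> w0 a_nd b_ni.
have a_mono m n : (m <= n)%N -> a m <= a n.
  by move=> /subnK <-; elim: (n - m)%N => [//|k IH]; rewrite addSn; apply: le_trans IH _.
have b_mono m n : (m <= n)%N -> a n + w n <= a m + w m.
  move=> /subnK <-; elim: (n - m)%N => [//|k IH]; rewrite addSn.
  exact: le_trans (b_ni _) IH.
have ub n : ubound (range a) (a n + w n).
  move=> _ [m _ <-]; have [mn|/ltnW nm] := leqP m n.
    by apply: le_trans (a_mono _ _ mn) _; rewrite lerDl.
  by apply: le_trans (b_mono _ _ nm); rewrite lerDl.
exists (sup (range a)) => n; apply/andP; split.
  by apply: ub_le_sup; [exists (a 0 + w 0); exact: ub|exists n].
by apply: ge_sup; [exists (a 0), 0|exact: ub].
Qed.

(** The affine part g(z) + l (. - z) has boundary integral 0. The remainder is at most e (w + h),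
    since each boundary point is within w + h of z, and the boundary has length 2 (w + h). *)
Lemma local_bdry g (x y w h e : R) : 0 <= w -> 0 <= h -> 0 < e ->
  Cderivable g (x +i* y) -> exists2 s, 0 < s &
  forall a c w h, 0 <= w -> 0 <= h -> w + h < s ->
    rect_derivable g a (a + w) c (c + h) ->
    a <= x <= a + w -> c <= y <= c + h ->
    `|rect_bdry g a (a + w) c (c + h)| <= 2 * e * (w + h) ^+ 2.
Proof.
move=> {w h} _ _ e0 /CderivableP[l /(_ e e0)[d d0 Hd]]; exists d => // a c w h w0 h0 whd dg.
move=> /andP[ax xa] /andP[cy yc]; pose z := x +i* y.
have near p q : a <= p -> p <= a + w -> c <= q -> q <= c + h ->
   cmod (g (p +i* q) - g z - l * ((p +i* q) - z)) <= e * (w + h).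
  move=> ap pa cq qc.
  have H : cmod ((p +i* q) - z) <= w + h.
    apply: le_trans (cmod_le_ReIm _) _ => /=.
    by apply: lerD; rewrite ler_norml; lra.
  have := Hd ((p +i* q) - z) (le_lt_trans H whd).
  rewrite -/z (addrC z) subrK => /le_trans; apply.
  by rewrite ler_pM2l.
(* Between bottom and top the real part of the affine part changes by h Im l, and between the two
   sides its imaginary part changes by w Im l; after integration both give w h Im l and cancel. *)
have H1 : `|rint a (a + w) (fun p => Re (g (p +i* c)) - Re (g (p +i* (c + h)))) -
    (Im l * h) * (a + w - a)| <= (2 * (e * (w + h))) * (a + w - a).
  apply: rint_near; first lra.
    by apply: intbleB; apply: (intble_bottom dg); lra.
  move=> p ap pa.
  have A := near p c ap pa (lexx c) (_ : c <= c + h).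
  have B := near p (c + h) ap pa _ (lexx (c + h)).
  have {}A := le_trans (le_Re_cmod _) (A ltac:(lra)).
  have {}B := le_trans (le_Re_cmod _) (B ltac:(lra)).
  have -> : Re (g (p +i* c)) - Re (g (p +i* (c + h))) - Im l * h =
     Re (g (p +i* c) - g z - l * ((p +i* c) - z)) -
     Re (g (p +i* (c + h)) - g z - l * ((p +i* (c + h)) - z)).
    by rewrite !(ReD, ReN, ReM) /=; ring.
  by apply: le_trans (ler_normB _ _) _; lra.
have H2 : `|rint c (c + h) (fun q => Im (g ((a + w) +i* q)) - Im (g (a +i* q))) -
    (Im l * w) * (c + h - c)| <= (2 * (e * (w + h))) * (c + h - c).
  apply: rint_near; first lra.
    by apply: intbleB; apply: (intble_side dg); lra.
  move=> q cq qc.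
  have A := near a q (lexx a) _ cq qc.
  have B := near (a + w) q _ (lexx (a + w)) cq qc.
  have {}A := le_trans (le_Im_cmod _) (A ltac:(lra)).
  have {}B := le_trans (le_Im_cmod _) (B ltac:(lra)).
  have -> : Im (g ((a + w) +i* q)) - Im (g (a +i* q)) - Im l * w =
     Im (g ((a + w) +i* q) - g z - l * (((a + w) +i* q) - z)) -
     Im (g (a +i* q) - g z - l * ((a +i* q) - z)).
    by rewrite !(ImD, ImN, ImM) /=; ring.
  by apply: le_trans (ler_normB _ _) _; lra.
move: H1 H2; rewrite (addrC a w) (addrC c h) !addrK (addrC w a) (addrC h c) => H1 H2.
rewrite /rect_bdry.
set I := rint a _ _ in H1 *; set J := rint c _ _ in H2 *.
have -> : I - J = (I - Im l * h * w) - (J - Im l * w * h) by ring.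
apply: le_trans (ler_normB _ _) _.
have -> : 2 * e * (w + h) ^+ 2 = 2 * (e * (w + h)) * w + 2 * (e * (w + h)) * h by ring.
exact: lerD.
Qed.

(** Each quartering may lose a factor 4 in the boundary integral, but the estimate around the common
    point of the rectangles is quadratic in their size and gains the same factor; e being arbitrary,
    the integral is 0. *)
Theorem goursat g a b c d : a <= b -> c <= d -> rect_derivable g a b c d ->
  rect_bdry g a b c d = 0.
Proof.
move=> ab cd; pose w := b - a; pose h := d - c.
have -> : b = a + w by rewrite /w addrC subrK.
have -> : d = c + h by rewrite /h addrC subrK.
have w0 : 0 <= w by rewrite subr_ge0.
have h0 : 0 <= h by rewrite subr_ge0.
move: w h w0 h0 => {ab cd b d} w h w0 h0 dg.
pose wn n : R := w / 2 ^+ n; pose hn n : R := h / 2 ^+ n.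
have wn0 n : 0 <= wn n by rewrite divr_ge0// exprn_ge0.
have hn0 n : 0 <= hn n by rewrite divr_ge0// exprn_ge0.
have wnS n : wn n.+1 = wn n / 2 by rewrite /wn exprSr invfM mulrA.
have hnS n : hn n.+1 = hn n / 2 by rewrite /hn exprSr invfM mulrA.
pose Q (p : R * R) n := rect_bdry g p.1 (p.1 + wn n) p.2 (p.2 + hn n).
pose D (p : R * R) n := rect_derivable g p.1 (p.1 + wn n) p.2 (p.2 + hn n).
(* A total choice function, with an arbitrary value where [D] fails: the sequence [sq] can then be
   defined before its rectangles are known to lie in the domain. *)
have /choice[nxt Hn] : forall q : R * R * nat, exists s : R * R, D q.1 q.2 ->
    [/\ q.1.1 <= s.1, s.1 + wn q.2.+1 <= q.1.1 + wn q.2, q.1.2 <= s.2,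
        s.2 + hn q.2.+1 <= q.1.2 + hn q.2 & `|Q q.1 q.2| <= 4 * `|Q s q.2.+1|].
  move=> [p n] /=; have [Dp|] := pselect (D p n); last by exists p.
  have [s] := rect_bdry_quarter (wn0 n) (hn0 n) Dp.
  by exists s; rewrite /Q !wnS !hnS.
pose fix sq n := if n is m.+1 then nxt (sq m, m) else (a, c).
have sqD n : D (sq n) n.
  elim: n => [|n IH]; first by rewrite /D /= /wn /hn expr0 !divr1.
  by have [? ? ? ? _] := Hn (sq n, n) IH; exact: (rect_derivable_sub IH).
have sqn n := Hn (sq n, n) (sqD n).
have [x Hx] : exists x, forall n, (sq n).1 <= x <= (sq n).1 + wn n.
  by apply: nested_point => // n; have [] := sqn n.
have [y Hy] : exists y, forall n, (sq n).2 <= y <= (sq n).2 + hn n.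
  by apply: nested_point => // n; have [] := sqn n.
have big n : `|Q (a, c) 0| <= 4 ^+ n * `|Q (sq n) n|.
  elim: n => [|n IH]; first by rewrite expr0 mul1r.
  apply: le_trans IH _; rewrite exprSr -mulrA ler_wpM2l ?exprn_ge0//.
  by have [] := sqn n.
have dxy : Cderivable g (x +i* y).
  have /andP[? ?] := Hx 0; have /andP[? ?] := Hy 0; exact: (sqD 0).
suff H0 : forall e, 0 < e -> `|Q (a, c) 0| <= 2 * e * (w + h) ^+ 2.
  have Qe : rect_bdry g a (a + w) c (c + h) = Q (a, c) 0.
    by rewrite /Q /wn /hn expr0 !divr1.
  rewrite Qe; apply/eqP; rewrite -normr_le0 leNgt; apply/negP => Q0.
  have k0 : 0 < 1 + 2 * (w + h) ^+ 2 by rewrite ltr_wpDr// mulr_ge0// sqr_ge0.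
  have := H0 (`|Q (a, c) 0| / (1 + 2 * (w + h) ^+ 2)) (divr_gt0 Q0 k0).
  rewrite mulrAC mulrA ler_pdivlMr//.
  by rewrite mulrC; apply/negP; rewrite -ltNge ltr_pM2r// ltrDr.
move=> e e0; have [s s0 Hs] := local_bdry w0 h0 e0 dxy.
have [n Hn'] : exists n, (w + h) / 2 ^+ n < s.
  exists (Num.bound ((w + h) / s)); rewrite ltr_pdivrMr ?exprn_gt0//.
  have := archi_boundP (divr_ge0 (addr_ge0 w0 h0) (ltW s0)).
  rewrite ltr_pdivrMr// mulrC => /lt_le_trans; apply.
  by rewrite ler_wpM2l ?(ltW s0)// -natrX ler_nat ltnW// ltn_expl.
have := Hs (sq n).1 (sq n).2 (wn n) (hn n) (wn0 n) (hn0 n).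
rewrite /wn /hn -mulrDl => /(_ Hn' (sqD n) (Hx n) (Hy n)) H.
apply: le_trans (big n) _; apply: le_trans (ler_wpM2l _ H) _; first exact: exprn_ge0.
rewrite expr_div_n -exprM mulnC exprM.
have -> : (2 : R) ^+ 2 = 4 by ring.
rewrite le_eqVlt; apply/orP; left; apply/eqP; field.
by rewrite expf_neq0.
Qed.
End Goursat.

(** * Dominated convergence for real-valued integrals *)

Section DominatedConvergence.
Context d (T : measurableType d) (R : realType) (mu : {measure set T -> \bar R}).

Lemma Rdominated_convergence (D : set T) (F_ : nat -> T -> R) (F h : T -> R) :
  measurable D -> (forall n, measurable_fun D (F_ n)) ->
  (forall x, D x -> F_ n x @[n --> \oo] --> F x) ->
  mu.-integrable D (EFin \o h) ->
  (forall n x, D x -> `|F_ n x| <= h x) ->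
  mu.-integrable D (EFin \o F) /\
  Rintegral mu D (F_ n) @[n --> \oo] --> Rintegral mu D F.
Proof.
move=> mD mF cF ih Fh.
have mF' : measurable_fun D F by apply: measurable_fun_cvg mF cF.
have [||iF _ cI] := @dominated_convergence _ _ _ mu D mD (fun n => EFin \o F_ n) (EFin \o F)
  (EFin \o h) (fun n => (measurable_EFinP _ _).2 (mF n)) ((measurable_EFinP _ _).2 mF') _ ih.
- by apply: aeW => x Dx; apply: cvg_EFin; [near=> n|exact: cF].
- by apply: aeW => x n Dx; rewrite /= lee_fin; exact: Fh.
split => //; apply: fine_cvg.
rewrite fineK //; exact: integrable_fin_num.
Unshelve. all: by end_near.
Qed.


End DominatedConvergence.

(** * Shifting the line of integration inside a strip *)

Section StripShift.
Context {R : realType}.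
Local Notation leb := (@lebesgue_measure R).
Implicit Types (g : R[i] -> R[i]) (F : R -> R).

Lemma integrable_oneDsqrV : leb.-integrable setT (EFin \o (fun x : R => (1 + x ^+ 2)^-1)).
Proof.
have c : continuous (fun x : R => (1 + x ^+ 2)^-1) by exact: continuous_oneDsqrV.
have p x : 0 <= (1 + x ^+ 2)^-1 :> R by rewrite invr_ge0 addr_ge0// sqr_ge0.
apply/integrableP; split.
  by apply/measurable_EFinP; exact: continuous_measurable_fun.
under eq_integral do rewrite /= ger0_norm//.
rewrite ge0_symfun_integralT//; last by move=> x /=; rewrite sqrrN.
have -> : [set x : R | 0 <= x] = `[0, +oo[%classic.
  by apply/seteqP; split=> x /=; rewrite in_itv/= andbT.
by rewrite integral0y_oneDsqr -EFinM ltry.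
Qed.

Lemma cvg_rint F : leb.-integrable setT (EFin \o F) ->
  rint (- n%:R) n%:R F @[n --> \oo] --> Rintegral leb setT F.
Proof.
move=> iF; have mF : measurable_fun setT F by apply/measurable_EFinP; exact: measurable_int iF.
have := @Rdominated_convergence _ _ _ leb setT (fun n => F \_ `[- n%:R, n%:R]) F (fun x => `|F x|).
move=> [//| | | | |_].
- move=> n; apply/(measurable_restrictT _ _).1 => //; exact: measurable_funS mF.
- move=> x _; apply: cvg_near_cst; near=> n.
  rewrite patchE mem_set //= in_itv /= -ler_norml.
  near: n; exact: nbhs_infty_ger.
- exact: integrable_norm iF.
- by move=> n x _; rewrite patchE; case: ifPn => // _; rewrite normr0.
by under eq_fun do rewrite -Rintegral_mkcond.
Unshelve. all: by end_near.
Qed.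

Lemma cvg_inv_sqr (C : R) : C / (1 + n%:R ^+ 2) @[n --> \oo] --> (0 : R).
Proof.
rewrite -[X in _ --> X](mulr0 C); apply: cvgMr.
apply: (squeeze_cvgr _ (cvg_cst 0) (@cvg_harmonic R)).
near=> n; have n0 : 0 <= n%:R :> R := ler0n _ _.
have p : 0 < 1 + n%:R ^+ 2 :> R by rewrite ltr_pwDl// sqr_ge0.
rewrite invr_ge0 (ltW p) /= lef_pV2 ?posrE// -natr1 addrC lerD2l expr2 -natrM ler_nat.
by have [->//|k0] := posnP n; rewrite leq_pmulr.
Unshelve. all: by end_near.
Qed.

(** Goursat on [-n, n] x [0, y]: the vertical sides contribute at most 2 C y / (1 + n^2), and the
    horizontal ones converge to the two line integrals. *)
Lemma strip_shift g (Y C : R) : 0 <= Y ->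
  (forall x y, 0 <= y -> y <= Y -> Cderivable g (x +i* y)) ->
  (forall x y, 0 <= y -> y <= Y -> cmod (g (x +i* y)) <= C / (1 + x ^+ 2)) ->
  forall y, 0 <= y <= Y -> leb.-integrable setT (EFin \o (fun x => Re (g (x +i* y)))) /\
  Rintegral leb setT (fun x => Re (g (x +i* 0))) = Rintegral leb setT (fun x => Re (g (x +i* y))).
Proof.
move=> Y0 dg bg.
have iC : leb.-integrable setT (EFin \o (fun x : R => C / (1 + x ^+ 2))).
  exact: integrableZl integrable_oneDsqrV.
have ig y : 0 <= y -> y <= Y -> leb.-integrable setT (EFin \o (fun x => Re (g (x +i* y)))).
  move=> y0 yY; apply: le_integrable iC => //.
    apply/measurable_EFinP; apply: continuous_measurable_fun => x.
    by have [] := @continuous_path _ g (fun x => x +i* y) x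
      (fun r => horizontal_lip y r x) (dg x y y0 yY).
  move=> x _; rewrite /= lee_fin; apply: le_trans (le_Re_cmod _) _.
  by apply: le_trans (bg x y y0 yY) (ler_norm _).
move=> y /andP[y0 yY]; split; first exact: ig.
apply/eqP; rewrite -subr_eq0; apply/eqP; rewrite -RintegralB//; try exact: ig.
have i2 : leb.-integrable setT (EFin \o (fun x => Re (g (x +i* 0)) - Re (g (x +i* y)))).
  by apply: (integrableB _ (ig 0 _ _) (ig y _ _)).
apply: (cvg_unique _ (cvg_rint i2)); first exact: norm_hausdorff.
have C0 : 0 <= C.
  have := le_trans (cmod_ge0 _) (bg 0 0 (lexx _) Y0).
  by rewrite expr0n /= addr0 divr1.
apply/norm_cvg0P; apply: (squeeze_cvgr _ (cvg_cst 0) (cvg_inv_sqr (2 * C * y))).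
near=> n; rewrite normr_ge0 /=.
have rd : rect_derivable g (- n%:R) n%:R 0 y.
  by move=> p q _ _ q0 qy; apply: dg => //; exact: le_trans qy _.
have nn : - n%:R <= n%:R :> R by have := ler0n R n; lra.
have := goursat nn y0 rd; rewrite /rect_bdry => /eqP; rewrite subr_eq0 => /eqP ->.
have := @rint_near _ 0 y (fun q => Im (g (n%:R +i* q)) - Im (g ((- n%:R) +i* q))) 0
   (2 * C / (1 + n%:R ^+ 2)) y0.
rewrite mul0r !subr0 => H; rewrite [leRHS]mulrAC; apply: H.
  by apply: intbleB; apply: (intble_side rd).
move=> q q0 qy; rewrite subr0; apply: le_trans (ler_normB _ _) _.
have qY := le_trans qy yY.
have := le_trans (le_Im_cmod _) (bg n%:R q q0 qY).
have := le_trans (le_Im_cmod _) (bg (- n%:R) q q0 qY).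
rewrite sqrrN -mulrA => ? ?; lra.
Unshelve. all: by end_near.
Qed.

End StripShift.

(** * The complex exponential and the complex Gaussian *)

Section ComplexExponential.
Context {R : realType}.
Implicit Types (z w : R[i]).

Definition cexp z : R[i] := (expR (Re z) * cos (Im z)) +i* (expR (Re z) * sin (Im z)).

Lemma cmod_cexp z : cmod (cexp z) = expR (Re z).
Proof.
by rewrite /= !exprMn -mulrDr cos2Dsin2 mulr1 sqrtr_sqr ger0_norm// expR_ge0.
Qed.

Lemma cexpD z w : cexp (z + w) = cexp z * cexp w.
Proof.
case: z w => [a b] [c d]; apply: complexP; rewrite /cexp /= expRD.
- by rewrite cosD; ring.
- by rewrite sinD; ring.
Qed.

Lemma first_order (f : R -> R) (x k : R) : is_derive x 1 f k -> forall e, 0 < e ->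
  exists2 d, 0 < d & forall h, `|h| < d -> `|f (x + h) - f x - k * h| <= e * `|h|.
Proof.
move=> [df vf] e e0.
have : h^-1 *: ((f \o shift x) (h *: (1 : R)) - f x) @[h --> 0^'] --> k.
  by rewrite -vf; exact: df.
move=> /cvgrPdist_le /(_ e e0); rewrite /dnbhs /within /= => /nbhs_ballP[d d0 Hd].
exists d => // h hd; have [->|h0] := eqVneq h 0.
  by rewrite addr0 subrr mulr0 subr0 normr0 mulr0.
have := Hd h; rewrite /ball /= sub0r normrN => /(_ hd h0).
rewrite /shift /= /GRing.scale /= mulr1 => H.
have -> : f (x + h) - f x - k * h = - (k - h^-1 * (f (h + x) - f x)) * h.
  by rewrite (addrC x h); field.
by rewrite normrM normrN ler_wpM2r.
Qed.

(** With h = a + i b, e^a cos b - 1 - a = e^a (cos b - 1) + (e^a - 1 - a) and e^a sin b - b = e^a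
    (sin b - b) + (e^a - 1) b, which leaves only real expansions at 0. *)
Lemma cexp_first_order e : 0 < e -> exists2 d, 0 < d &
  forall h, cmod h < d -> cmod (cexp h - 1 - h) <= e * cmod h.
Proof.
(* The errors will add up to 6 q |h|, which 8 covers; q <= 1 also gives e^a <= 2. *)
move=> e0; have e8 : 0 < Num.min 1 (e / 8) by rewrite lt_min ltr01 divr_gt0.
set q := Num.min 1 (e / 8) in e8.
have q1 : q <= 1 by rewrite ge_min lexx.
have qe : q <= e / 8 by rewrite ge_min lexx orbT.
have [d1 d10 H1] := first_order (is_derive_expR (0 : R)) e8.
have [d2 d20 H2] := first_order (is_derive_cos (0 : R)) e8.
have [d3 d30 H3] := first_order (is_derive_sin (0 : R)) e8.
exists (Num.min (Num.min d1 (q / 2)) (Num.min d2 d3)).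
  by rewrite !lt_min d10 d20 d30 divr_gt0.
case=> a b; rewrite !lt_min => /andP[/andP[hd1 hdq] /andP[hd2 hd3]].
have ha := le_Re_cmod (a +i* b); have hb := le_Im_cmod (a +i* b).
rewrite [Re _]/= in ha; rewrite [Im _]/= in hb.
have {H1} := H1 a (le_lt_trans ha hd1); rewrite add0r expR0 mul1r.
have {H2} := H2 b (le_lt_trans hb hd2); rewrite add0r cos0 sin0 oppr0 mul0r subr0.
have {H3} := H3 b (le_lt_trans hb hd3); rewrite add0r cos0 sin0 subr0 mul1r.
set m := cmod (a +i* b) in ha hb hd1 hd2 hd3 hdq *.
set A := expR a - 1 - a; set C := cos b - 1; set S := sin b - b => HS HC HA.
have m0 : 0 <= m by rewrite cmod_ge0.
have a1 : `|a| <= q / 2 by lra.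
have HA1 : `|A| <= q * m by apply: le_trans HA _; rewrite ler_wpM2l// ltW.
have HC1 : `|C| <= q * m by apply: le_trans HC _; rewrite ler_wpM2l// ltW.
have HS1 : `|S| <= q * m by apply: le_trans HS _; rewrite ler_wpM2l// ltW.
have HA2 : `|A| <= q / 2 by apply: le_trans HA _; rewrite -[leRHS]mul1r; apply: ler_pM => //; rewrite ?ltW.
have E2 : `|expR a - 1| <= q.
  have -> : expR a - 1 = A + a by rewrite /A; ring.
  by apply: le_trans (ler_normD _ _) _; lra.
have E3 : `|expR a| <= 2.
  by rewrite -[expR a](subrK 1); apply: le_trans (ler_normD _ _) _; rewrite normr1; lra.
apply: le_trans (cmod_le_ReIm _) _; rewrite /=.
have -> : expR a * cos b - 1 - a = expR a * C + A by rewrite /C /A; ring.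
have -> : expR a * sin b - 0 - b = expR a * S + (expR a - 1) * b by rewrite /S; ring.
have B1 : `|expR a * C| <= 2 * (q * m) by rewrite normrM; apply: ler_pM.
have B2 : `|expR a * S| <= 2 * (q * m) by rewrite normrM; apply: ler_pM.
have B3 : `|(expR a - 1) * b| <= q * m by rewrite normrM; apply: ler_pM.
have B4 : q * m <= e / 8 * m by rewrite ler_wpM2r.
have := ler_normD (expR a * C) A; have := ler_normD (expR a * S) ((expR a - 1) * b).
by nra.
Qed.

Lemma Cderivable_cexp z : Cderivable cexp z.
Proof.
apply/CderivableP; exists (cexp z) => e e0.
have k0 : 0 < 1 + cmod (cexp z) by rewrite ltr_pwDl// cmod_ge0.
have [d d0 Hd] := cexp_first_order (divr_gt0 e0 k0); exists d => // h /Hd H.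
have -> : cexp (z + h) - cexp z - cexp z * h = cexp z * (cexp h - 1 - h).
  by rewrite cexpD; ring.
rewrite cmodM; apply: le_trans (ler_wpM2l (cmod_ge0 _) H) _.
rewrite mulrA ler_wpM2r ?cmod_ge0// mulrA ler_pdivrMr// mulrC ler_wpM2l ?ltW//.
by rewrite ltrDr ltr01.
Qed.

(** This factor makes functions of exponential growth integrable on horizontal lines, at the price
    of e^(e y^2) at height y, and it tends to 1 as e -> 0. *)
Definition cgauss (e : R) z : R[i] := cexp (- (e%:C * (z * z))).

Lemma cmod_cgauss e (x y : R) :
  cmod (cgauss e (x +i* y)) = expR (- (e * x ^+ 2) + e * y ^+ 2).
Proof. by rewrite cmod_cexp; congr expR => /=; ring. Qed.

Lemma cgauss_real e (x : R) : cgauss e (x +i* 0) = (expR (- (e * x ^+ 2)))%:C.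
Proof.
rewrite /cgauss /cexp; apply: complexP => /=; rewrite !(mulr0, mul0r, subr0, addr0, oppr0).
  by rewrite cos0 mulr1 expr2.
by rewrite sin0 mulr0.
Qed.

Lemma Cderivable_cgauss e z : Cderivable (cgauss e) z.
Proof.
apply: (@Cderivable_comp _ (fun z => - (e%:C * (z * z))) cexp); last exact: Cderivable_cexp.
apply: CderivableN; apply: CderivableM; first exact: Cderivable_cst.
by apply: CderivableM; exact: Cderivable_id.
Qed.

End ComplexExponential.

(** * Vanishing of line integrals for functions that decay upwards *)

Section HalfPlane.
Context {R : realType}.
Local Notation leb := (@lebesgue_measure R).
Implicit Types (g phi : R[i] -> R[i]) (F G : R -> R).

Definition Rint F : R := Rintegral leb setT F.
Definition Rintble F : Prop := leb.-integrable setT (EFin \o F).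

Lemma Rint_le F G : Rintble F -> Rintble G -> (forall x, F x <= G x) -> Rint F <= Rint G.
Proof. by move=> iF iG FG; apply: le_Rintegral. Qed.

Lemma Rintble_cont F G : continuous F -> Rintble G -> (forall x, `|F x| <= G x) -> Rintble F.
Proof.
move=> cF iG FG; apply: le_integrable iG => //.
  by apply/measurable_EFinP; exact: continuous_measurable_fun.
by move=> x _; rewrite /= lee_fin (le_trans (FG x))// ler_norm.
Qed.

Lemma RintbleZ F (k : R) : Rintble F -> Rintble (fun x => k * F x).
Proof. by move=> iF; exact: (integrableZl _ _ iF). Qed.

Lemma RintbleD F G : Rintble F -> Rintble G -> Rintble (fun x => F x + G x).
Proof. by move=> iF iG; exact: (integrableD _ iF iG). Qed.

Lemma RintZ F k : Rintble F -> Rint (fun x => k * F x) = k * Rint F.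
Proof. by move=> iF; rewrite /Rint RintegralZl. Qed.

Lemma RintD F G : Rintble F -> Rintble G -> Rint (fun x => F x + G x) = Rint F + Rint G.
Proof. by move=> iF iG; rewrite /Rint RintegralD. Qed.

Definition cauchy_weight (x : R) : R := (1 + x ^+ 2)^-1.

Lemma cauchy_weight_ge0 x : 0 <= cauchy_weight x.
Proof. by rewrite invr_ge0 addr_ge0// sqr_ge0. Qed.

(** Completing the square leaves e^(- e x^2 / 2), which 1 + s <= e^s turns into a Cauchy weight; e
    <= 2 keeps (e / 2) (1 + x^2) below 1 + e x^2 / 2. *)
Lemma gauss_le (B e x : R) : 0 < e -> e <= 2 ->
  expR (B * `|x| - e * x ^+ 2) <= expR (B ^+ 2 / (2 * e)) * (2 / e) * cauchy_weight x.
Proof.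
move=> e0 e2.
have x2 : `|x| ^+ 2 = x ^+ 2 by rewrite real_normK// num_real.
have H : B * `|x| - e * x ^+ 2 <= B ^+ 2 / (2 * e) - e * x ^+ 2 / 2.
  have -> : B ^+ 2 / (2 * e) - e * x ^+ 2 / 2 =
     B * `|x| - e * x ^+ 2 + (B - e * `|x|) ^+ 2 / (2 * e).
    by rewrite -x2; field; rewrite gt_eqF.
  by rewrite lerDl divr_ge0 ?sqr_ge0// mulr_ge0// ltW.
apply: (@le_trans _ _ (expR (B ^+ 2 / (2 * e) - e * x ^+ 2 / 2))); first by rewrite ler_expR.
rewrite expRD -[leRHS]mulrA; apply: ler_wpM2l; rewrite ?expR_ge0// expRN.
have p1 : 0 < 1 + e * x ^+ 2 / 2.
  by rewrite ltr_pwDl// divr_ge0// mulr_ge0 ?sqr_ge0// ltW.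
apply: (@le_trans _ _ (1 + e * x ^+ 2 / 2)^-1).
  by rewrite lef_pV2 ?posrE ?expR_gt0// expR_ge1Dx.
have -> : 2 / e * cauchy_weight x = (e / 2 * (1 + x ^+ 2))^-1.
  by rewrite /cauchy_weight invfM invf_div.
rewrite lef_pV2 ?posrE//; last by rewrite mulr_gt0 ?divr_gt0// ltr_pwDl// sqr_ge0.
by have := sqr_ge0 x; nra.
Qed.

Lemma cmod_growth phi K A : (forall z, cmod (phi z) <= K * expR (A * cmod z)) ->
  0 <= A -> forall x y, 0 <= y -> cmod (phi (x +i* y)) <= K * expR (A * (`|x| + y)).
Proof.
move=> hphi A0 x y y0.
have K0 : 0 <= K.
  by have := le_trans (cmod_ge0 _) (hphi 0); rewrite cmod0 mulr0 expR0 mulr1.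
apply: le_trans (hphi _) _; apply: ler_wpM2l => //; rewrite ler_expR; apply: ler_wpM2l => //.
by apply: le_trans (cmod_le_ReIm _) _; rewrite /= [`|y|]ger0_norm.
Qed.

Lemma continuous_Re_line g y : (forall x, Cderivable g (x +i* y)) ->
  continuous (fun x => Re (g (x +i* y))).
Proof.
by move=> dg x; have [] := @continuous_path _ g (fun x => x +i* y) x
  (fun r => horizontal_lip y r x) (dg x).
Qed.

Lemma continuous_Im_line g y : (forall x, Cderivable g (x +i* y)) ->
  continuous (fun x => Im (g (x +i* y))).
Proof.
by move=> dg x; have [] := @continuous_path _ g (fun x => x +i* y) x
  (fun r => horizontal_lip y r x) (dg x).
Qed.

Lemma continuous_sqr_cmod_line g y : (forall x, Cderivable g (x +i* y)) ->
  continuous (fun x => cmod (g (x +i* y)) ^+ 2).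
Proof.
move=> dg x; under eq_fun do rewrite sqr_cmod !expr2.
by apply: cvgD; apply: cvgM; (exact: continuous_Re_line || exact: continuous_Im_line).
Qed.

Lemma continuous_gauss (e : R) : continuous (fun x : R => expR (- (e * x ^+ 2))).
Proof.
move=> x; apply: (@continuous_comp _ _ _ (fun x : R => - (e * x ^+ 2)) expR); last exact: continuous_expR.
apply: cvgN; apply: cvgM; first exact: cvg_cst.
exact: exprn_continuous.
Qed.

Lemma cvg_gauss (u : nat -> R) (x : R) : u n @[n --> \oo] --> 0 ->
  expR (- (u n * x ^+ 2)) @[n --> \oo] --> (1 : R).
Proof.
move=> cu; rewrite -[X in _ --> X]expR0; apply: continuous_cvg; first exact: continuous_expR.
by rewrite -oppr0 -(mul0r (x ^+ 2)); apply: cvgN; apply: cvgMl.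
Qed.

Lemma gauss_le1 (e x : R) : 0 <= e -> expR (- (e * x ^+ 2)) <= 1.
Proof. by move=> e0; rewrite -expR0 ler_expR oppr_le0 mulr_ge0// sqr_ge0. Qed.

Lemma mul_expRN_le (c x : R) : 0 < c -> 0 < x -> x * expR (- (c * x)) <= 4 / (c ^+ 2 * x).
Proof.
move=> c0 x0; rewrite expRN ler_pdivrMr ?expR_gt0//.
have cx : 0 < c * x / 2 by rewrite divr_gt0// mulr_gt0.
have H : (c * x / 2) ^+ 2 <= expR (c * x).
  rewrite [X in expR X](_ : _ = c * x / 2 + c * x / 2); last by field.
  rewrite expRD -expr2 ler_pXn2r ?nnegrE ?expR_ge0// ?ltW//.
  by apply: (lt_le_trans _ (expR_ge1Dx _)); lra.
apply: le_trans (ler_wpM2l _ H); last by rewrite divr_ge0// mulr_ge0 ?sqr_ge0// ltW.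
by rewrite le_eqVlt; apply/orP; left; apply/eqP; field; rewrite !gt_eqF.
Qed.

Definition cauchy_mass : R := Rint cauchy_weight.

Lemma Rintble_cauchy : Rintble cauchy_weight.
Proof. exact: integrable_oneDsqrV. Qed.

Lemma cauchy_mass_ge0 : 0 <= cauchy_mass.
Proof. by apply: Rintegral_ge0 => x _; exact: cauchy_weight_ge0. Qed.

Lemma Rint_norm_le F (C : R) : Rintble F -> (forall x, `|F x| <= C * cauchy_weight x) ->
  `|Rint F| <= C * cauchy_mass.
Proof.
move=> iF FC; apply: le_trans (le_normr_Rintegral _ iF) _ => //.
rewrite -RintZ; last exact: Rintble_cauchy.
apply: Rint_le => //; last exact: RintbleZ Rintble_cauchy.
exact: (integrable_norm iF).
Qed.

(** Once [g] is damped by a Gaussian, the line of integration can be moved up to a height of order 1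
    / e, where the vertical decay beats both the growth in x and the cost of the damping; then e ->
    0. *)
Lemma Rint_half_plane g (K A D : R) : 0 < A -> 2 * A <= D ->
  (forall x y, 0 <= y -> Cderivable g (x +i* y)) ->
  (forall x y, 0 <= y -> cmod (g (x +i* y)) <= K * expR (A * `|x| - D * y)) ->
  Rintble (fun x => cmod (g (x +i* 0))) ->
  Rint (fun x => Re (g (x +i* 0))) = 0.
Proof.
move=> A0 AD dg bg ig.
have D0 : 0 < D by lra.
have K0 : 0 <= K.
  by have := le_trans (cmod_ge0 _) (bg 0 0 (lexx _)); rewrite normr0 !mulr0 subr0 expR0 mulr1.
pose e n : R := n.+1%:R^-1.
have e0 n : 0 < e n by rewrite invr_gt0.
have e1 n : e n <= 1 by rewrite invf_le1// ler1n.
have e2 n : e n <= 2 by apply: le_trans (e1 n) _; lra.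
have cvge : e n @[n --> \oo] --> 0 by exact: cvg_harmonic.
pose ge n z := g z * cgauss (e n) z.
have dge n x y : 0 <= y -> Cderivable (ge n) (x +i* y).
  by move=> y0; apply: CderivableM; [exact: dg|exact: Cderivable_cgauss].
have lim1 : Rint (fun x => Re (ge n (x +i* 0))) @[n --> \oo] --> Rint (fun x => Re (g (x +i* 0))).
  have E n x : Re (ge n (x +i* 0)) = Re (g (x +i* 0)) * expR (- (e n * x ^+ 2)).
    by rewrite /ge cgauss_real ReM /= mulr0 subr0.
  have [] // := @Rdominated_convergence _ _ _ leb setT (fun n x => Re (ge n (x +i* 0)))
    (fun x => Re (g (x +i* 0))) (fun x => cmod (g (x +i* 0))) measurableT.
  - by move=> n; apply: continuous_measurable_fun; apply: continuous_Re_line => x; exact: dge.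
  - move=> x _; under eq_fun do rewrite E.
    have := cvgMl_tmp (a := Re (g (x +i* 0))) (cvg_gauss x cvge); rewrite mulr1; exact.
  - move=> n x _; rewrite E normrM -[leRHS]mulr1; apply: ler_pM => //; first exact: le_Re_cmod.
    by rewrite ger0_norm ?expR_ge0// gauss_le1// ltW.
(* The height that minimises - D y + e y^2; the minimum is - D^2 / (4 e). *)
pose Y n := D / (2 * e n).
have Y0 n : 0 <= Y n by rewrite divr_ge0 ?(ltW D0)// mulr_ge0// ltW.
have bge n x y : 0 <= y -> y <= Y n -> cmod (ge n (x +i* y)) <=
    K * expR (- (D * y) + e n * y ^+ 2) * (expR (A ^+ 2 / (2 * e n)) * (2 / e n) * cauchy_weight x).
  move=> y0 yY; rewrite cmodM cmod_cgauss.
  apply: le_trans (ler_wpM2r (expR_ge0 _) (bg x y y0)) _.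
  have -> : K * expR (A * `|x| - D * y) * expR (- (e n * x ^+ 2) + e n * y ^+ 2) =
     K * expR (- (D * y) + e n * y ^+ 2) * expR (A * `|x| - e n * x ^+ 2).
    by rewrite -!mulrA -!expRD; congr (_ * expR _); ring.
  apply: ler_wpM2l; first by rewrite mulr_ge0// expR_ge0.
  exact: gauss_le.
have shift n : Rint (fun x => Re (ge n (x +i* 0))) = Rint (fun x => Re (ge n (x +i* Y n))) /\
    Rintble (fun x => Re (ge n (x +i* Y n))).
  have [|||? ?] := @strip_shift _ (ge n) (Y n) (K * (expR (A ^+ 2 / (2 * e n)) * (2 / e n))) (Y0 n)
    _ _ (Y n); [| |by rewrite Y0 lexx|by split].
  - by move=> x y y0 _; exact: dge.
  - move=> x y y0 yY; apply: le_trans (bge n x y y0 yY) _.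
    rewrite mulrA; apply: ler_wpM2r; first exact: cauchy_weight_ge0.
    apply: ler_wpM2r; first by rewrite mulr_ge0 ?expR_ge0// divr_ge0// ltW.
    rewrite -[leRHS]mulr1; apply: ler_wpM2l => //; rewrite -expR0 ler_expR.
    have : e n * y <= D / 2.
      by move: yY; rewrite /Y ler_pdivlMr ?mulr_gt0// => ?; lra.
    by nra.
suff lim0 : Rint (fun x => Re (ge n (x +i* 0))) @[n --> \oo] --> (0 : R).
  exact: (cvg_unique _ lim1 lim0).
(* The total exponent is (2 A^2 - D^2) / (4 e) <= - A^2 / (2 e), because D >= 2 A. The factor 2 / e
   left by [gauss_le] is absorbed through [mul_expRN_le]. *)
pose c := A ^+ 2 / 2.
have c0 : 0 < c by rewrite divr_gt0// exprn_gt0.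
apply/norm_cvg0P; apply: (@squeeze_cvgr _ _ _ _ (fun=> 0)
  (fun n => (K * 2 * (4 / c ^+ 2) * cauchy_mass) * n.+1%:R^-1)); last 2 first.
- exact: cvg_cst.
- rewrite -[X in _ --> X](mulr0 (K * 2 * (4 / c ^+ 2) * cauchy_mass)).
  by apply: cvgMr; exact: cvg_harmonic.
near=> n; rewrite normr_ge0 /=; have [-> iY] := shift n.
apply: le_trans (Rint_norm_le (C := K * (2 * (n.+1%:R * expR (- (c * n.+1%:R))))) iY _) _.
  move=> x; apply: le_trans (le_Re_cmod _) _; apply: le_trans (bge n x (Y n) (Y0 n) (lexx _)) _.
  rewrite mulrA; apply: ler_wpM2r; first exact: cauchy_weight_ge0.
  rewrite -mulrA; apply: ler_wpM2l => //.
  rewrite mulrA -expRD /e invrK.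
  have -> : 2 * (n.+1%:R * expR (- (c * n.+1%:R))) = expR (- (c * n.+1%:R)) * (2 * n.+1%:R) by ring.
  apply: ler_wpM2r; first by rewrite mulr_ge0.
  rewrite ler_expR /Y /e /c.
  have -> : - (D * (D / (2 * n.+1%:R^-1))) + n.+1%:R^-1 * (D / (2 * n.+1%:R^-1)) ^+ 2 +
     A ^+ 2 / (2 * n.+1%:R^-1) = (2 * A ^+ 2 - D ^+ 2) / 4 * n.+1%:R.
    by field.
  rewrite -[leRHS]mulNr; apply: ler_wpM2r => //; nra.
have H := mul_expRN_le c0 (ltr0Sn R n).
have -> : K * 2 * (4 / c ^+ 2) * cauchy_mass * n.+1%:R^-1 =
   K * (2 * (4 / (c ^+ 2 * n.+1%:R))) * cauchy_mass.
  by field; rewrite (gt_eqF c0) nat1r pnatr_eq0.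
by apply: ler_wpM2r; [exact: cauchy_mass_ge0|apply: ler_wpM2l => //; apply: ler_wpM2l].
Unshelve. all: by end_near.
Qed.

End HalfPlane.

(** * A Plancherel-Polya estimate on horizontal lines *)

Section PlancherelPolya.
Context {R : realType}.
Local Notation leb := (@lebesgue_measure R).
Variables (phi : R[i] -> R[i]) (K A : R).
Hypotheses (ephi : entire phi) (A0 : 0 < A)
  (gphi : forall z, cmod (phi z) <= K * expR (A * cmod z))
  (iphi : Rintble (fun x => cmod (phi (x +i* 0)) ^+ 2)).

(** The Gaussian makes the integral over each line finite before anything is known about phi off the
    real line. *)
Let damped (e y : R) : R -> R := fun x => cmod (phi (x +i* y)) ^+ 2 * expR (- (e * x ^+ 2)).
Let I e y := Rint (damped e y).

Let damped_ge0 e y x : 0 <= damped e y x.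
Proof. by rewrite mulr_ge0 ?sqr_ge0// expR_ge0. Qed.

Let continuous_damped e y : continuous (damped e y).
Proof.
move=> x; apply: cvgM; last exact: continuous_gauss.
by apply: continuous_sqr_cmod_line => u; exact: ephi.
Qed.

Let damped_le e y x : 0 < e -> e <= 2 -> 0 <= y -> damped e y x <=
  K ^+ 2 * expR (2 * A * y) * (expR ((2 * A) ^+ 2 / (2 * e)) * (2 / e)) * cauchy_weight x.
Proof.
move=> e0 e2 y0; have H := cmod_growth gphi (ltW A0) x y0.
have H2 : cmod (phi (x +i* y)) ^+ 2 <= K ^+ 2 * expR (2 * A * y) * expR (2 * A * `|x|).
  have -> : K ^+ 2 * expR (2 * A * y) * expR (2 * A * `|x|) = (K * expR (A * (`|x| + y))) ^+ 2.
    by rewrite exprMn expr2 [in RHS]expr2 -!mulrA -!expRD; congr (_ * (_ * expR _)); ring.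
  have := cmod_ge0 (phi (x +i* y)); nra.
apply: le_trans (ler_wpM2r (expR_ge0 _) H2) _.
rewrite -[leLHS]mulrA -expRD -[leRHS]mulrA; apply: ler_wpM2l; last exact: gauss_le.
by rewrite mulr_ge0 ?sqr_ge0// expR_ge0.
Qed.

Let Rintble_damped e y : 0 < e -> e <= 2 -> 0 <= y -> Rintble (damped e y).
Proof.
move=> e0 e2 y0; apply: Rintble_cont (RintbleZ _ Rintble_cauchy) _.
  exact: continuous_damped.
by move=> x; rewrite ger0_norm//; exact: damped_le.
Qed.

Let I_ge0 e y : 0 <= I e y.
Proof. by apply: Rintegral_ge0 => x _; exact: damped_ge0. Qed.

Let I_le e y : 0 < e -> e <= 2 -> 0 <= y -> I e y <=
  K ^+ 2 * expR (2 * A * y) * (expR ((2 * A) ^+ 2 / (2 * e)) * (2 / e)) * cauchy_mass.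
Proof.
move=> e0 e2 y0; rewrite -[leLHS]ger0_norm//; apply: Rint_norm_le.
  exact: Rintble_damped.
by move=> x; rewrite ger0_norm//; exact: damped_le.
Qed.

(* Moving the contour for phi(z + iy) (phi(z^* + iy))^* e^{-e z^2} up by y. *)
Let I_shift e y s : 0 < e -> e <= 2 -> 0 <= y -> 0 < s ->
  I e y <= expR (e * y ^+ 2) * ((s * I e (2 * y) + s^-1 * I e 0) / 2).
Proof.
move=> e0 e2 y0 s0.
(* On the real line psi psi^# equals |phi(x + i y)|^2; at height y it is phi(x + 2 i y) times the
   conjugate of phi(x). *)
pose psi z := phi (z + (0 +i* y)).
pose g z := psi z * sharp psi z * cgauss e z.
have epsi z : Cderivable psi z.
  apply: (@Cderivable_comp _ (fun z => z + (0 +i* y)) phi); last exact: ephi.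
  by apply: CderivableD; [exact: Cderivable_id|exact: Cderivable_cst].
have dg z : Cderivable g z.
  apply: CderivableM; last exact: Cderivable_cgauss.
  by apply: CderivableM => //; apply: Cderivable_sharp.
have psiE u v : psi (u +i* v) = phi (u +i* (v + y)) by congr phi; apply: complexP; rewrite /= ?addr0.
have spsiE u v : sharp psi (u +i* v) = (phi (u +i* (y - v)))^*.
  by rewrite /sharp psiE addrC.
have gb x v : 0 <= v -> v <= y -> cmod (g (x +i* v)) <=
    K ^+ 2 * expR (2 * A * y) * expR (e * y ^+ 2) *
    (expR ((2 * A) ^+ 2 / (2 * e)) * (2 / e)) / (1 + x ^+ 2).
  rewrite /g !cmodM cmod_cgauss psiE spsiE cmodC => v0 vy.
  have H1 := cmod_growth gphi (ltW A0) x (addr_ge0 v0 y0).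
  have H2 : cmod (phi (x +i* (y - v))) <= K * expR (A * (`|x| + (y - v))).
    by apply: (cmod_growth gphi (ltW A0)); rewrite subr_ge0.
  have H3 := ler_pM (cmod_ge0 _) (cmod_ge0 _) H1 H2.
  apply: le_trans (ler_wpM2r (expR_ge0 _) H3) _.
  have L a b c : K * expR a * (K * expR b) * expR c = K ^+ 2 * expR (a + b + c).
    by rewrite !expRD; ring.
  rewrite L [X in expR X](_ : _ = 2 * A * y + e * v ^+ 2 + (2 * A * `|x| - e * x ^+ 2)); last by ring.
  rewrite (expRD (_ + _)) (expRD (2 * A * y)) mulrA -[leRHS]mulrA; apply: ler_pM; last exact: gauss_le.
  - by do ![exact: sqr_ge0|exact: expR_ge0|apply: mulr_ge0].
  - exact: expR_ge0.
  rewrite -[leRHS]mulrA; apply: ler_wpM2l; first exact: sqr_ge0.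
  apply: ler_wpM2l; first exact: expR_ge0.
  by rewrite ler_expR ler_pM2l// ler_pXn2r ?nnegrE.
have yy : 0 <= y <= y by rewrite y0 lexx.
have [i1] := @strip_shift _ g y _ y0 (fun x v _ _ => dg _) gb y yy.
have -> : Rintegral leb setT (fun x => Re (g (x +i* 0))) = I e y.
  congr Rintegral; apply/funext => x.
  rewrite /g cgauss_real psiE spsiE add0r subr0 /damped sqr_cmod !ReM ImM /=; case: (phi _) => a b /=.
  by ring.
move=> ->; have y20 : 0 <= 2 * y by lra.
have i2 := Rintble_damped e0 e2 y20; have i3 := Rintble_damped e0 e2 (lexx 0).
have -> : s * I e (2 * y) = Rint (fun x => s * damped e (2 * y) x) by rewrite RintZ.
have -> : s^-1 * I e 0 = Rint (fun x => s^-1 * damped e 0 x) by rewrite RintZ.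
have {}i2 : Rintble (fun x => s * damped e (2 * y) x) by exact: RintbleZ.
have {}i3 : Rintble (fun x => s^-1 * damped e 0 x) by exact: RintbleZ.
rewrite -RintD// mulrC -mulrA mulrC -RintZ; last exact: RintbleD.
apply: Rint_le => //; first by apply: RintbleZ; exact: RintbleD.
move=> x; apply: le_trans (ler_norm _) _; apply: le_trans (le_Re_cmod _) _.
rewrite /g !cmodM cmod_cgauss psiE spsiE cmodC subrr expRD /damped.
have -> : y + y = 2 * y by ring.
(* What remains is 2 a b <= s a^2 + b^2 / s. *)
set a := cmod _; set b := cmod _; set E := expR _; set G := expR _.
rewrite [leLHS](_ : _ = 2^-1 * G * (2 * (a * b) * E)); last by field.
rewrite ler_wpM2l ?mulr_ge0 ?expR_ge0// ?invr_ge0//.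
rewrite !mulrA -mulrDl ler_wpM2r ?expR_ge0//.
rewrite -subr_ge0 [X in 0 <= X](_ : _ = s^-1 * (s * a - b) ^+ 2); last by field; rewrite gt_eqF.
by rewrite mulr_ge0 ?sqr_ge0// invr_ge0 ltW.
Qed.

(** The damped integrals satisfy I(y)^2 <= const M I(2 y) with M >= I(0), a discrete log-convexity.
    Repeated doubling carries the crude bound at height 2^n y, which comes from exponential type,
    back to height y as a 2^n-th root; Fatou then removes the damping. *)
Theorem plancherel_polya : exists M, forall y, 0 <= y ->
  (\int[leb]_x (cmod (phi (x +i* y)) ^+ 2)%:E <= (M * expR (6 * A * y))%:E)%E.
Proof.
pose M := Rint (fun x => cmod (phi (x +i* 0)) ^+ 2) + 1.
have M0 : 0 < M by rewrite ltr_wpDl// Rintegral_ge0// => x _; exact: sqr_ge0.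
have I0 e : 0 < e -> e <= 2 -> I e 0 <= M.
  move=> e0 e2; rewrite /M ler_wpDr//; apply: Rint_le => //; first exact: Rintble_damped.
  by move=> x; rewrite /damped -[leRHS]mulr1 ler_wpM2l ?sqr_ge0// gauss_le1// ltW.
have Isqr e y : 0 < e -> e <= 2 -> 0 <= y ->
    I e y ^+ 2 <= expR (e * y ^+ 2) ^+ 2 * M * I e (2 * y).
  move=> e0 e2 y0; have [<-|Iy] := eqVneq 0 (I e y).
    by rewrite expr0n /= !mulr_ge0// ?sqr_ge0// ltW.
  have {}Iy : 0 < I e y by rewrite lt_def eq_sym Iy /=.
  set E := expR _; have E0 : 0 < E by exact: expR_gt0.
  (* With this weight the term containing I(0) is at most half of [I e y], and is absorbed by the
     left-hand side. *)
  have s0 : 0 < M * E / I e y by rewrite divr_gt0// mulr_gt0.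
  have := I_shift e0 e2 y0 s0; rewrite -/E invf_div.
  set p := I e (2 * y); set r := I e y in Iy s0 *; set q := I e 0 => H.
  have qM : r / (M * E) * q <= r / E.
    have -> : r / E = r / (M * E) * M by field; rewrite !gt_eqF.
    by rewrite ler_wpM2l ?I0// divr_ge0 ?mulr_ge0// ltW.
  have {}H : r <= E * ((M * E / r * p + r / E) / 2).
    by apply: le_trans H _; rewrite ler_pM2l// ler_pM2r// lerD2l.
  have {}H : r * r <= E * ((M * E / r * p + r / E) / 2) * r by rewrite ler_pM2r.
  have E1 : E * ((M * E / r * p + r / E) / 2) * r = (E ^+ 2 * M * p + r * r) / 2.
    by field; rewrite !gt_eqF.
  by rewrite E1 in H; rewrite expr2; lra.
(* Normalised so that [Isqr] becomes J(y)^2 <= J(2 y). Any multiple of y in the exponent is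
   compatible with doubling; the value 6 A serves [Jbig]. *)
pose J e y := I e y * expR (e * y ^+ 2 - 6 * A * y) / M.
have Jsqr e y : 0 < e -> e <= 2 -> 0 <= y -> J e y ^+ 2 <= J e (2 * y).
  move=> e0 e2 y0; rewrite /J expr_div_n exprMn.
  have -> : I e (2 * y) * expR (e * (2 * y) ^+ 2 - 6 * A * (2 * y)) / M =
    (expR (e * y ^+ 2) ^+ 2 * M * I e (2 * y)) * expR (e * y ^+ 2 - 6 * A * y) ^+ 2 / M ^+ 2.
    have -> : e * (2 * y) ^+ 2 - 6 * A * (2 * y) =
       (e * y ^+ 2 + e * y ^+ 2) + ((e * y ^+ 2 - 6 * A * y) + (e * y ^+ 2 - 6 * A * y)) by ring.
    by rewrite !expRD; field; rewrite gt_eqF.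
  rewrite ler_pM2r ?invr_gt0 ?exprn_gt0// ler_wpM2r ?sqr_ge0//; exact: Isqr.
have J0 e y : 0 <= J e y by rewrite divr_ge0 ?(ltW M0)// mulr_ge0// expR_ge0.
have Jpow e y n : 0 < e -> e <= 2 -> 0 <= y -> J e y ^+ (2 ^ n) <= J e (2 ^+ n * y).
  move=> e0 e2 y0; elim: n => [|n IH]; first by rewrite expn0 expr1 expr0 mul1r.
  rewrite expnSr exprM (exprS 2 n) -mulrA; apply: le_trans (Jsqr _ _ e0 e2 _).
    by rewrite ler_pXn2r ?nnegrE// exprn_ge0.
  by rewrite mulr_ge0// exprn_ge0.
pose c := K ^+ 2 * (2 / A) * cauchy_mass / M.
have c0 : 0 <= c.
  rewrite divr_ge0 ?(ltW M0)// mulr_ge0 ?cauchy_mass_ge0// mulr_ge0 ?sqr_ge0//.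
  by rewrite divr_ge0// ltW.
(* With e = A / Y, the exponents 2 A Y from the growth of phi, 2 A Y from completing the square and
   A Y from e Y^2 add up to 5 A Y, so that - 6 A Y leaves e^(- A Y). *)
have Jbig Y : A / 2 <= Y -> 4 * c / A ^+ 2 <= Y -> J (A / Y) Y <= 1.
  move=> AY cY; have Y0 : 0 < Y by apply: lt_le_trans AY; rewrite divr_gt0.
  have e0 : 0 < A / Y by rewrite divr_gt0.
  have e2 : A / Y <= 2 by rewrite ler_pdivrMr// -ler_pdivrMl// mulrC.
  have H : J (A / Y) Y <= c * (Y * expR (- (A * Y))).
    rewrite /J; apply: (@le_trans _ _ (K ^+ 2 * expR (2 * A * Y) *
      (expR ((2 * A) ^+ 2 / (2 * (A / Y))) * (2 / (A / Y))) * cauchy_mass *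
      expR (A / Y * Y ^+ 2 - 6 * A * Y) / M)).
      rewrite ler_pM2r ?invr_gt0// ler_pM2r ?expR_gt0//; exact: I_le (ltW _).
    have -> : (2 * A) ^+ 2 / (2 * (A / Y)) = 2 * A * Y by field; rewrite !gt_eqF.
    have -> : A / Y * Y ^+ 2 - 6 * A * Y = - (A * Y) - 2 * A * Y - 2 * A * Y.
      by field; rewrite gt_eqF.
    rewrite !expRD (expRN (2 * A * Y)) le_eqVlt; apply/orP; left; apply/eqP; rewrite /c; field.
    by rewrite !gt_eqF ?expR_gt0.
  apply: le_trans H _; apply: le_trans (ler_wpM2l c0 (mul_expRN_le A0 Y0)) _.
  rewrite mulrA ler_pdivrMr ?mulr_gt0 ?exprn_gt0// mul1r.
  by move: cY; rewrite ler_pdivrMr ?exprn_gt0//; lra.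
have Pge0 y x : (0 <= (cmod (phi (x +i* y)) ^+ 2)%:E)%E by rewrite lee_fin sqr_ge0.
exists M => y; rewrite le_eqVlt => /predU1P[<-|y0].
  rewrite mulr0 expR0 mulr1; apply: (@le_trans _ _ (Rint (fun x => cmod (phi (x +i* 0)) ^+ 2))%:E).
    by rewrite /Rint /Rintegral fineK//; exact: integrable_fin_num.
  by rewrite lee_fin /M lerDl.
(* The damping is tied to the height: at Y = 2^n y it equals A / Y, as in [Jbig], and for fixed y it
   tends to 0. *)
pose e n := A / (2 ^+ n * y).
have en0 n : 0 < e n by rewrite divr_gt0// mulr_gt0// exprn_gt0.
have cvgn : e n @[n --> \oo] --> 0.
  have -> : e = fun n => A / y * 2^-1 ^+ n.
    apply/funext => n; rewrite /e exprVn; field.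
    by rewrite (gt_eqF y0) expf_neq0.
  rewrite -(mulr0 (A / y)); apply: cvgMr; apply: cvg_expr.
  by rewrite ger0_norm ?invr_ge0// invf_lt1//; lra.
have c1 : 0 < 4 * c / A ^+ 2 + 1.
  by rewrite ltr_wpDl// divr_ge0 ?sqr_ge0// mulr_ge0.
have Ien : \forall n \near \oo, I (e n) y <= M * expR (6 * A * y).
  near=> n.
  have e2 : e n <= 2 by near: n; apply: (cvgr_le _ cvgn); lra.
  have eY : A / (2 ^+ n * y) = e n by [].
  have J1 : J (e n) (2 ^+ n * y) <= 1.
    rewrite -eY; apply: Jbig.
      by move: e2; rewrite /e ler_pdivrMr ?mulr_gt0 ?exprn_gt0// => ?; lra.
    have : e n <= A / (4 * c / A ^+ 2 + 1).
       by near: n; apply: (cvgr_le _ cvgn); rewrite divr_gt0.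
    rewrite /e ler_pM2l// lef_pV2 ?posrE ?mulr_gt0 ?exprn_gt0// => ?; lra.
  have J2 := le_trans (Jpow (e n) y n (en0 n) e2 (ltW y0)) J1.
  have {J2} : J (e n) y <= 1.
    by move: J2; rewrite expr_le1// expn_gt0.
  rewrite /J ler_pdivrMr// mul1r => J3.
  have -> : I (e n) y = I (e n) y * expR (e n * y ^+ 2 - 6 * A * y) * expR (6 * A * y) *
      expR (- (e n * y ^+ 2)).
    by rewrite -2!mulrA -!expRD [X in expR X](_ : _ = 0) ?expR0 ?mulr1//; ring.
  rewrite -[leRHS]mulr1; apply: ler_pM.
  - by rewrite !mulr_ge0 ?expR_ge0.
  - exact: expR_ge0.
  - by rewrite ler_pM2r ?expR_gt0.
  - exact: gauss_le1 (ltW _).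
have -> : (\int[leb]_x (cmod (phi (x +i* y)) ^+ 2)%:E =
   \int[leb]_x limn_einf (fun n => (damped (e n) y x)%:E))%E.
  apply: eq_integral => x _; apply/esym; apply: (cvg_limn_einf_sup _).1; apply: cvg_EFin; first by near=> n.
  rewrite -[X in _ --> X]mulr1; apply: cvgMr; exact: cvg_gauss.
have mD n : measurable_fun [set: measurableTypeR R] (fun x => (damped (e n) y x)%:E).
  by apply/measurable_EFinP; apply: continuous_measurable_fun; exact: continuous_damped.
have D0 n (x : measurableTypeR R) : setT x -> (0 <= (damped (e n) y x)%:E)%E.
  by move=> _; rewrite lee_fin.
apply: le_trans (fatou leb measurableT mD D0) _.
rewrite limn_einf_lim; apply: lime_le; first exact: is_cvg_einfs.
near=> n; apply: (@le_trans _ _ (\int[leb]_x (damped (e n) y x)%:E)%E).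
  by apply: ereal_inf_lbound; exists n => //=.
have e2 : e n <= 2 by near: n; apply: (cvgr_le _ cvgn); lra.
have := Rintble_damped (en0 n) e2 (ltW y0) => iD.
rewrite -[leLHS]fineK ?lee_fin; last exact: integrable_fin_num.
by near: n.
Unshelve. all: by end_near.
Qed.

End PlancherelPolya.

(** * Calculus of absolutely continuous functions, and Gronwall inequalities *)

Section AbsolutelyContinuous.
Context {R : realType}.
Local Notation leb := (@lebesgue_measure R).
Implicit Types (a b : R) (F G f g w : R -> R).

(** Uniform continuity over ordered pairs, because increments of primitives are integrals over
    [s, t]. *)
Definition ucont a b F : Prop := forall e, 0 < e -> exists2 d, 0 < d &
  forall s t, a <= s -> s <= t -> t <= b -> t - s < d -> `|F t - F s| <= e.

Lemma ucont_within a b F : ucont a b F -> {within `[a, b], continuous F}.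
Proof.
move=> uF; apply/subspace_continuousP => x /=; rewrite in_itv /= => /andP[ax xb].
apply/cvgrPdist_le => e /uF[d d0 Hd].
rewrite /within /=; apply/nbhs_ballP; exists d => // y; rewrite /ball /= in_itv /= => xy /andP[ay yb].
have [le_xy|/ltW le_yx] := leP x y.
- rewrite distrC; apply: Hd => //; apply: le_lt_trans xy.
  by rewrite distrC ler_norm.
- by apply: Hd => //; apply: le_lt_trans xy; rewrite ler_norm.
Qed.

Lemma ucont_norm a b F : ucont a b F -> ucont a b (fun x => `|F x|).
Proof.
move=> uF e /uF[d d0 Hd]; exists d => // s t as_ st tb ts.
by apply: le_trans (ler_dist_dist _ _) _; exact: Hd.
Qed.

Lemma ucont_bounded a b F : a <= b -> ucont a b F ->
  exists2 M, 0 <= M & forall x, a <= x -> x <= b -> `|F x| <= M.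
Proof.
move=> ab uF; have [c _ Hc] := EVT_max ab (ucont_within (ucont_norm uF)).
by exists `|F c| => // x ax xb; apply: Hc; rewrite in_itv /= ax.
Qed.

Lemma ucont_intble a b F : ucont a b F -> intble a b F.
Proof.
move=> uF; apply: continuous_compact_integrable; first exact: segment_compact.
exact: ucont_within.
Qed.

Lemma intbleM a b f G : a <= b -> intble a b f -> ucont a b G -> intble a b (fun x => f x * G x).
Proof.
move=> ab iF uG; have [M M0 HM] := ucont_bounded ab uG.
have iMf : leb.-integrable `[a, b] (EFin \o (fun x => M * f x)) by exact: intbleZ.
apply: (le_integrable _ _ _ iMf) => //.
  apply/measurable_EFinP; apply: measurable_funM.
    by apply/measurable_EFinP; exact: measurable_int iF.
  by apply: subspace_continuous_measurable_fun => //; exact: ucont_within.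
move=> x; rewrite /= in_itv /= => /andP[ax xb]; rewrite lee_fin !normrM mulrC.
by apply: ler_wpM2r => //; rewrite (ger0_norm M0); exact: HM.
Qed.

Lemma rint_chasles a b F s t : intble a b F -> a <= s -> s <= t -> t <= b ->
  rint a t F = rint a s F + rint s t F.
Proof.
move=> iF as_ st tb; apply: rint_split => //.
exact: intble_sub (lexx _) tb iF.
Qed.

Lemma rint_mono a b w s t : intble a b w -> (forall x, a <= x -> x <= b -> 0 <= w x) ->
  a <= s -> s <= t -> t <= b -> rint s t w <= rint a b w.
Proof.
move=> iw w0 as_ st tb; rewrite (@rint_split _ a t b)//; last exact: le_trans st.
rewrite (@rint_chasles a b w s t)//.
have A : 0 <= rint a s w.
  by apply: rint_ge0 => x ax xs; apply: w0 => //; apply: le_trans xs _; exact: le_trans tb.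
have B : 0 <= rint t b w.
  by apply: rint_ge0 => x tx xb; apply: w0 => //; apply: le_trans tx; exact: le_trans st.
lra.
Qed.

(** Absolute continuity of the Lebesgue integral for f extended by 0, applied to sets that are short
    segments. *)
Lemma rint_ucont a b f : intble a b f -> forall e, 0 < e -> exists2 d, 0 < d &
  forall s t, a <= s -> s <= t -> t <= b -> t - s < d -> rint s t (fun x => `|f x|) <= e.
Proof.
move=> iF e e0; have iT : leb.-integrable setT (EFin \o (f \_ `[a, b])).
  by rewrite -restrict_EFin; apply/(integrable_mkcond _ _).1.
have [d [d0 Hd]] := integral_normr_continuous iT e0.
exists d => // s t as_ st tb ts.
have mu_lt : (leb `[s, t]%classic < d%:E)%E.
  by rewrite lebesgue_measure_itv /= lte_fin; case: ifPn => _; rewrite ?lte_fin.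
have := Hd `[s, t]%classic (measurable_itv _) mu_lt.
move=> /ltW; apply: le_trans; rewrite le_eqVlt; apply/orP; left; apply/eqP.
apply: eq_rint => x sx xt; rewrite patchE mem_set//= in_itv /=.
by rewrite (le_trans as_ sx) (le_trans xt tb).
Qed.

(* A function whose increments are small compared to those of an absolutely
   continuous monotone function is constant. *)
Lemma small_increments a b G w : a <= b -> intble a b w ->
  (forall x, a <= x -> x <= b -> 0 <= w x) ->
  (forall e, 0 < e -> exists2 d, 0 < d & forall s t, a <= s -> s <= t -> t <= b ->
     t - s < d -> `|G t - G s| <= e * rint s t w) ->
  G b = G a.
Proof.
move=> ab iw w0 HG; apply/eqP; rewrite -subr_eq0 -normr_le0.
have W0 : 0 <= rint a b w by apply: rint_ge0.
have H e : 0 < e -> `|G b - G a| <= e * rint a b w.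
  move=> e0; have [d d0 Hd] := HG e e0.
  (* A uniform mesh finer than d; the bounds on its pieces add up to e times the integral of [w]
     over [a, b]. *)
  pose N := (Num.bound ((b - a) / d)).+1; pose h := (b - a) / N%:R.
  have N0 : 0 < N%:R :> R by rewrite ltr0n.
  have h0 : 0 <= h by rewrite divr_ge0 ?subr_ge0// ltW.
  have hd : h < d.
    rewrite /h ltr_pdivrMr// mulrC -ltr_pdivrMr//.
    apply: lt_le_trans (archi_boundP _) _; first by rewrite divr_ge0 ?subr_ge0// ltW.
    by rewrite ler_nat.
  have hN : a + N%:R * h = b by rewrite /h mulrC divfK ?gt_eqF// addrC subrK.
  have P k : (k <= N)%N -> `|G (a + k%:R * h) - G a| <= e * rint a (a + k%:R * h) w.
    elim: k => [|k IH] kN.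
      by rewrite mul0r addr0 subrr normr0 rint_same mulr0.
    have k0 : 0 <= k%:R * h by rewrite mulr_ge0.
    have kb : a + k.+1%:R * h <= b by rewrite -hN lerD2l ler_wpM2r// ler_nat.
    have e1 : a + k.+1%:R * h = a + k%:R * h + h by rewrite -natr1; ring.
    rewrite (@rint_chasles a b w (a + k%:R * h))//; [|lra..].
    have /= := Hd (a + k%:R * h) (a + k.+1%:R * h); rewrite {3}e1 [X in X < d]addrAC subrr add0r.
    move=> /(_ _ _ kb hd) H1; have {}H1 := H1 ltac:(lra) ltac:(lra).
    have H2 := IH (ltnW kN).
    have -> : G (a + k.+1%:R * h) - G a =
      (G (a + k.+1%:R * h) - G (a + k%:R * h)) + (G (a + k%:R * h) - G a) by ring.
    by apply: le_trans (ler_normD _ _) _; lra.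
  by have := P N (leqnn _); rewrite hN.
rewrite leNgt; apply/negP => D0.
have W1 : 0 < rint a b w + 1 by lra.
have := H (`|G b - G a| / (rint a b w + 1)) (divr_gt0 D0 W1).
by rewrite mulrAC ler_pdivlMr// ler_pM2l//; lra.
Qed.

(** The integrated form of F' = f almost everywhere for absolutely continuous F; the product and
    exponential rules are proved for it from increments. *)
Definition prim a b F f : Prop := intble a b f /\
  forall t, a <= t -> t <= b -> F t = F a + rint a t f.

Lemma prim_incr a b F f s t : prim a b F f -> a <= s -> s <= t -> t <= b ->
  F t = F s + rint s t f.
Proof.
move=> [iF HF] as_ st tb; rewrite (HF t)// ?(le_trans as_)// (HF s)// ?(le_trans st)//.
by rewrite (@rint_chasles a b f s t)// addrA.
Qed.

Lemma prim_sub a b F f s t : prim a b F f -> a <= s -> t <= b -> prim s t F f.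
Proof.
move=> pF as_ tb; split; first exact: intble_sub as_ tb pF.1.
by move=> r sr rt; apply: prim_incr pF _ _ _ => //; exact: le_trans tb.
Qed.

Lemma prim_ucont a b F f : prim a b F f -> ucont a b F.
Proof.
move=> pF e e0; have [d d0 Hd] := rint_ucont pF.1 e0; exists d => // s t as_ st tb ts.
rewrite (prim_incr pF as_ st tb) addrAC subrr add0r.
apply: le_trans (le_normr_rint _) _; last exact: Hd.
exact: intble_sub as_ tb pF.1.
Qed.

Lemma prim_cst a b (k : R) : prim a b (fun=> k) (fun=> 0).
Proof.
split; first exact: intble_cst.
by move=> t at_ tb; rewrite rint_cst// mul0r addr0.
Qed.

Lemma primD a b F f G g : prim a b F f -> prim a b G g ->
  prim a b (fun x => F x + G x) (fun x => f x + g x).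
Proof.
move=> [iF HF] [iG HG]; split; first exact: intbleD.
move=> t at_ tb; rewrite (HF t)// (HG t)// rintD; [ring| |].
- exact: intble_sub (lexx _) tb iF.
- exact: intble_sub (lexx _) tb iG.
Qed.

Lemma primZ a b F f (k : R) : prim a b F f -> prim a b (fun x => k * F x) (fun x => k * f x).
Proof.
move=> [iF HF]; split; first exact: intbleZ.
move=> t at_ tb; rewrite (HF t)// rintZ; first ring.
exact: intble_sub (lexx _) tb iF.
Qed.

Lemma primN a b F f : prim a b F f -> prim a b (fun x => - F x) (fun x => - f x).
Proof.
move=> /(primZ (-1)) H.
have -> : (fun x => - F x) = (fun x => -1 * F x) by apply/funext => x; rewrite mulN1r.
by have -> : (fun x => - f x) = (fun x => -1 * f x) by apply/funext => x; rewrite mulN1r.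
Qed.

Lemma primB a b F f G g : prim a b F f -> prim a b G g ->
  prim a b (fun x => F x - G x) (fun x => f x - g x).
Proof. by move=> pF /primN pG; exact: primD. Qed.

Lemma eq_prim a b F f G g : (forall x, a <= x -> x <= b -> F x = G x) -> a <= b ->
  (forall x, a <= x -> x <= b -> f x = g x) -> prim a b F f -> prim a b G g.
Proof.
move=> FG ab fg [iF HF]; split.
  apply: eq_integrable iF => // x; rewrite inE /= in_itv /= => /andP[ax xb].
  by rewrite fg.
move=> t at_ tb; rewrite -FG// -FG// HF//; congr (_ + _); apply: eq_rint => x ax xt.
by apply: fg => //; exact: le_trans tb.
Qed.

(* Once the increments are controlled, [small_increments] turns a candidate
   derivative into a primitive. *)
Lemma prim_of_increments a b F f w : a <= b -> intble a b f -> intble a b w ->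
  (forall x, a <= x -> x <= b -> 0 <= w x) ->
  (forall e, 0 < e -> exists2 d, 0 < d & forall s t, a <= s -> s <= t -> t <= b ->
     t - s < d -> `|F t - F s - rint s t f| <= e * rint s t w) ->
  prim a b F f.
Proof.
move=> ab iF iw w0 H; split => // t at_ tb.
suff : F t - rint a t f = F a - rint a a f.
  by rewrite rint_same subr0 => /eqP; rewrite subr_eq => /eqP.
apply: (@small_increments a t (fun t => F t - rint a t f) w) => //.
- exact: intble_sub (lexx _) tb iw.
- by move=> x ax xt; apply: w0 => //; exact: le_trans tb.
move=> e /H[d d0 Hd]; exists d => // s r as_ sr rt rs.
have rb := le_trans rt tb.
rewrite (@rint_chasles a b f s r)//.
have -> : F r - (rint a s f + rint s r f) - (F s - rint a s f) = F r - F s - rint s r f by ring.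
exact: Hd.
Qed.

(** Since F(t) G(t) - F(s) G(s) = G(t) (F(t) - F(s)) + F(s) (G(t) - G(s)), the defect on [s, t] is
    the integral of (G(t) - G(x)) f + (F(s) - F(x)) g, small by uniform continuity. *)
Lemma primM a b F f G g : a <= b -> prim a b F f -> prim a b G g ->
  prim a b (fun x => F x * G x) (fun x => f x * G x + g x * F x).
Proof.
move=> ab pF pG; have [iF _] := pF; have [iG _] := pG.
have uF := prim_ucont pF; have uG := prim_ucont pG.
have ifG := intbleM ab iF uG; have igF := intbleM ab iG uF.
apply: (@prim_of_increments _ _ _ _ (fun x => `|f x| + `|g x|)) => //.
- exact: intbleD.
- by apply: intbleD; exact: intble_norm.
move=> e e0; have [d1 d10 H1] := uF e e0; have [d2 d20 H2] := uG e e0.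
exists (Num.min d1 d2); first by rewrite lt_min d10.
move=> s t as_ st tb; rewrite lt_min => /andP[ts1 ts2].
have sub h : intble a b h -> intble s t h by exact: intble_sub.
have -> : F t * G t - F s * G s - rint s t (fun x => f x * G x + g x * F x) =
  rint s t (fun x => (G t * f x - f x * G x) + (F s * g x - g x * F x)).
  rewrite [RHS]rintD; first last.
  - by apply: intbleB; [apply/intbleZ/sub|exact: sub].
  - by apply: intbleB; [apply/intbleZ/sub|exact: sub].
  rewrite !rintB ?rintD ?rintZ; try (by [apply/intbleZ/sub|exact: sub]).
  by rewrite (prim_incr pF as_ st tb) (prim_incr pG as_ st tb); ring.
apply: le_trans (le_normr_rint _) _.
  by apply: intbleD; apply: intbleB; try (by [apply/intbleZ/sub|exact: sub]).
rewrite -rintZ; last by apply: intbleD; apply/intble_norm/sub.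
apply: le_rint.
- by apply/intble_norm/intbleD; apply: intbleB; try (by [apply/intbleZ/sub|exact: sub]).
- by apply/intbleZ/intbleD; apply/intble_norm/sub.
move=> x sx xt; rewrite (mulrC (f x)) (mulrC (g x)) -!mulrBl.
apply: le_trans (ler_normD _ _) _; rewrite !normrM mulrDr.
apply: lerD; apply: ler_wpM2r => //.
- by apply: H2 => //; [exact: le_trans sx|lra].
- by rewrite distrC; apply: H1 => //; [exact: le_trans tb|lra].
Qed.

Lemma expR_lip (M x y : R) : `|x| <= M -> `|y| <= M -> `|expR x - expR y| <= expR M * `|x - y|.
Proof.
wlog xy : x y / y <= x.
  move=> H xM yM; have [yx|/ltW xy] := leP y x; first exact: H.
  by rewrite distrC (distrC x); exact: H.
move=> xM _; rewrite !ger0_norm ?subr_ge0 ?ler_expR//.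
have -> : expR x - expR y = expR x * (1 - expR (y - x)).
  by rewrite mulrBr mulr1 -expRD; congr (_ - expR _); ring.
apply: ler_pM; rewrite ?expR_ge0 ?subr_ge0//.
- by rewrite -expR0 ler_expR subr_le0.
- by rewrite ler_expR; apply: le_trans xM; exact: ler_norm.
- by have := expR_ge1Dx (y - x); lra.
Qed.

Lemma ucont_expR a b F : a <= b -> ucont a b F -> ucont a b (fun x => expR (F x)).
Proof.
move=> ab uF; have [M M0 HM] := ucont_bounded ab uF => e e0.
have k0 : 0 < expR M by exact: expR_gt0.
have [d d0 Hd] := uF _ (divr_gt0 e0 k0); exists d => // s t as_ st tb ts.
have := Hd s t as_ st tb ts; rewrite ler_pdivlMr// mulrC; apply: le_trans.
apply: expR_lip; apply: HM => //; [exact: le_trans st|exact: le_trans tb].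
Qed.

(** With q = F(t) - F(s), the increment is e^F(s) (e^q - 1) and q is the integral of f; the errors
    come from e^q - 1 - q and from replacing e^F(x) by e^F(s). *)
Lemma prim_expR a b F f : a <= b -> prim a b F f ->
  prim a b (fun x => expR (F x)) (fun x => f x * expR (F x)).
Proof.
move=> ab pF; have [iF _] := pF; have uF := prim_ucont pF.
have uE := ucont_expR ab uF; have ifE := intbleM ab iF uE.
have [M M0 HM] := ucont_bounded ab uE.
apply: (@prim_of_increments _ _ _ _ (fun x => `|f x|)) => //; first exact: intble_norm.
move=> e e0.
have M1 : 0 < 2 * (M + 1) by lra.
have [d1 d10 H1] := first_order (is_derive_expR (0 : R)) (divr_gt0 e0 M1).
have e2 : 0 < e / 2 by rewrite divr_gt0.
have d12 : 0 < d1 / 2 by rewrite divr_gt0.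
have [d2 d20 H2] := uF _ d12; have [d3 d30 H3] := uE _ e2.
exists (Num.min d2 d3); first by rewrite lt_min d20.
move=> s t as_ st tb; rewrite lt_min => /andP[ts2 ts3].
have sub h : intble a b h -> intble s t h by exact: intble_sub.
pose q := F t - F s; have q1 : `|q| < d1 by apply: le_lt_trans (H2 s t as_ st tb ts2) _; lra.
have qE : q = rint s t f by rewrite /q (prim_incr pF as_ st tb) addrAC subrr add0r.
have {H1} := H1 q q1; rewrite add0r expR0 mul1r => H1.
have W : `|q| <= rint s t (fun x => `|f x|) by rewrite qE; apply: le_normr_rint; exact: sub.
have -> : expR (F t) - expR (F s) - rint s t (fun x => f x * expR (F x)) =
   expR (F s) * (expR q - 1 - q) + rint s t (fun x => expR (F s) * f x - f x * expR (F x)).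
  rewrite rintB ?rintZ; [|by [apply/intbleZ/sub|exact: sub]..].
  have -> : F t = F s + q by rewrite /q addrC subrK.
  by rewrite expRD qE; ring.
apply: le_trans (ler_normD _ _) _.
have A : `|expR (F s) * (expR q - 1 - q)| <= e / 2 * rint s t (fun x => `|f x|).
  rewrite normrM; have HMs := HM s as_ (le_trans st tb).
  apply: le_trans (ler_pM _ _ HMs H1) _ => //.
  rewrite mulrA; apply: ler_pM => //.
    by rewrite mulr_ge0// divr_ge0// ltW.
  rewrite mulrA ler_pdivrMr// [leRHS](_ : _ = e * (M + 1)); last by field.
  by rewrite mulrC ler_pM2l//; lra.
have B : `|rint s t (fun x => expR (F s) * f x - f x * expR (F x))| <=
    e / 2 * rint s t (fun x => `|f x|).
  apply: le_trans (le_normr_rint _) _.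
    by apply: intbleB; [apply/intbleZ/sub|exact: sub].
  rewrite -rintZ; last by apply/intble_norm/sub.
  apply: le_rint.
  - by apply/intble_norm/intbleB; [apply/intbleZ/sub|exact: sub].
  - by apply/intbleZ/intble_norm/sub.
  move=> x sx xt; rewrite (mulrC (f x)) -mulrBl normrM; apply: ler_wpM2r => //.
  by rewrite distrC; apply: H3 => //; [exact: le_trans tb|lra].
lra.
Qed.

Lemma prim_ge0_le a b F f : a <= b -> prim a b F f ->
  (forall x, a <= x -> x <= b -> 0 <= f x) -> F a <= F b.
Proof.
by move=> ab [iF HF] f0; rewrite (HF b)// lerDl; apply: rint_ge0.
Qed.

(** The product of F with e^(- int g) has derivative (f - g F) e^(- int g) >= 0. In the energy
    estimate g changes sign. *)
Lemma gronwall_lower a b F f g : a <= b -> prim a b F f -> intble a b g ->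
  (forall x, a <= x -> x <= b -> g x * F x <= f x) -> F a * expR (rint a b g) <= F b.
Proof.
move=> ab pF ig gF; pose k x := - rint a x g.
have pk : prim a b k (fun x => - g x).
  by apply: primN; split => // t at_ tb; rewrite rint_same add0r.
have := prim_ge0_le ab (primM ab pF (prim_expR ab pk)) _.
rewrite /k rint_same oppr0 expR0 mulr1 expRN ler_pdivlMr ?expR_gt0//; apply.
move=> x ax xb; rewrite mulrAC -mulrDl mulr_ge0 ?expR_ge0//.
by rewrite mulNr subr_ge0 gF.
Qed.

(** The right-hand side S of the integral inequality has S' = w N <= w S; apply [gronwall_lower] to
    - S. *)
Lemma gronwall a b N w (C : R) : a <= b -> ucont a b N -> intble a b w ->
  (forall x, a <= x -> x <= b -> 0 <= w x) ->
  (forall t, a <= t -> t <= b -> N t <= C + rint a t (fun x => w x * N x)) ->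
  forall t, a <= t -> t <= b -> N t <= C * expR (rint a t w).
Proof.
move=> ab uN iw w0 HN t at_ tb.
pose S x := C + rint a x (fun x => w x * N x).
have iwN := intbleM ab iw uN.
have pS : prim a t S (fun x => w x * N x).
  split; first exact: intble_sub (lexx _) tb iwN.
  by move=> x ax xt; rewrite /S rint_same addr0.
have iwt : intble a t w by exact: intble_sub (lexx _) tb iw.
have H : - S a * expR (rint a t w) <= - S t.
  apply: (gronwall_lower at_ (primN pS) iwt) => x ax xt.
  have xb := le_trans xt tb.
  by rewrite mulrN lerN2 ler_wpM2l ?w0// HN.
apply: le_trans (HN t at_ tb) _; rewrite -/(S t).
by move: H; rewrite {1}/S rint_same addr0 mulNr lerN2.
Qed.

End AbsolutelyContinuous.

(** * Complex linear systems and analyticity in the spectral parameter *)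

Section ComplexSystems.
Context {R : realType}.
Local Notation leb := (@lebesgue_measure R).
Implicit Types (U V u v : R -> R[i]) (z h k : R[i]).

(** This l^1 norm is submultiplicative, equivalent to [cmod], and splits into the real and imaginary
    integrals that [cprim] provides. *)
Definition n1 z : R := `|Re z| + `|Im z|.

Lemma n1_ge0 z : 0 <= n1 z. Proof. by rewrite addr_ge0. Qed.

Lemma n1D z h : n1 (z + h) <= n1 z + n1 h.
Proof.
rewrite /n1 ReD ImD; have := ler_normD (Re z) (Re h); have := ler_normD (Im z) (Im h); lra.
Qed.

Lemma n1N z : n1 (- z) = n1 z.
Proof. by rewrite /n1 ReN ImN !normrN. Qed.

Lemma n1B z h : n1 (z - h) <= n1 z + n1 h.
Proof. by rewrite -(n1N h); exact: n1D. Qed.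

Lemma n1M z h : n1 (z * h) <= n1 z * n1 h.
Proof.
rewrite /n1 ReM ImM.
have H1 := ler_normB (Re z * Re h) (Im z * Im h).
have H2 := ler_normD (Re z * Im h) (Im z * Re h).
rewrite !normrM in H1 H2; nra.
Qed.

Lemma n1C (x : R) : n1 x%:C = `|x|.
Proof. by rewrite /n1 /= normr0 addr0. Qed.

Lemma n1_le_cmod z : n1 z <= 2 * cmod z.
Proof. by rewrite /n1; have := le_Re_cmod z; have := le_Im_cmod z; lra. Qed.

Lemma cmod_le_n1 z : cmod z <= n1 z.
Proof. exact: cmod_le_ReIm. Qed.

Definition cprim (a b : R) U V : Prop :=
  prim a b (fun s => Re (U s)) (fun s => Re (V s)) /\
  prim a b (fun s => Im (U s)) (fun s => Im (V s)).

Lemma cprimD a b U U' V V' : cprim a b U V -> cprim a b U' V' ->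
  cprim a b (fun s => U s + U' s) (fun s => V s + V' s).
Proof.
move=> [r i] [r' i']; split.
- by under eq_fun do rewrite ReD; under [X in prim _ _ _ X]eq_fun do rewrite ReD; exact: primD.
- by under eq_fun do rewrite ImD; under [X in prim _ _ _ X]eq_fun do rewrite ImD; exact: primD.
Qed.

Lemma cprimZ a b U V z : cprim a b U V -> cprim a b (fun s => z * U s) (fun s => z * V s).
Proof.
move=> [r i]; split.
- under eq_fun do rewrite ReM; under [X in prim _ _ _ X]eq_fun do rewrite ReM.
  by apply: primB; exact: primZ.
- under eq_fun do rewrite ImM; under [X in prim _ _ _ X]eq_fun do rewrite ImM.
  by apply: primD; exact: primZ.
Qed.

Lemma cprimB a b U U' V V' : cprim a b U V -> cprim a b U' V' ->
  cprim a b (fun s => U s - U' s) (fun s => V s - V' s).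
Proof.
move=> p /(cprimZ (-1)) p'.
under eq_fun do rewrite -mulN1r; under [X in cprim _ _ _ X]eq_fun do rewrite -mulN1r.
exact: cprimD.
Qed.

Lemma eq_cprim a b U V V' : a <= b -> (forall s, a <= s -> s <= b -> V s = V' s) ->
  cprim a b U V -> cprim a b U V'.
Proof.
move=> ab VV [r i]; split; [apply: eq_prim r|apply: eq_prim i] => //.
- by move=> x ax xb; rewrite VV.
- by move=> x ax xb; rewrite VV.
Qed.

Lemma cprim_n1 a b U V t : cprim a b U V -> a <= t -> t <= b ->
  intble a t (fun s => n1 (V s)) /\ n1 (U t) <= n1 (U a) + rint a t (fun s => n1 (V s)).
Proof.
move=> [r i] at_ tb.
have ir := intble_sub (lexx a) tb r.1; have ii := intble_sub (lexx a) tb i.1.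
split; first by apply: intbleD; exact: intble_norm.
rewrite /n1 rintD; [|exact: intble_norm..].
rewrite (r.2 t)// (i.2 t)//.
have := ler_normD (Re (U a)) (rint a t (fun s => Re (V s))).
have := ler_normD (Im (U a)) (rint a t (fun s => Im (V s))).
have := le_normr_rint ir; have := le_normr_rint ii; lra.
Qed.

Lemma cprim_ucont_n1 a b U V : cprim a b U V -> ucont a b (fun s => n1 (U s)).
Proof.
move=> [/prim_ucont/ucont_norm r /prim_ucont/ucont_norm i] e e0.
have e2 : 0 < e / 2 by rewrite divr_gt0.
have [d1 d10 H1] := r _ e2; have [d2 d20 H2] := i _ e2.
exists (Num.min d1 d2); first by rewrite lt_min d10.
move=> s t as_ st tb; rewrite lt_min => /andP[/(H1 s t as_ st tb) ts1 /(H2 s t as_ st tb) ts2].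
rewrite /n1 [X in `|X|](_ : _ = (`|Re (U t)| - `|Re (U s)|) + (`|Im (U t)| - `|Im (U s)|)).
  by apply: le_trans (ler_normD _ _) _; lra.
by ring.
Qed.

Lemma ucontD a b (F G : R -> R) : ucont a b F -> ucont a b G -> ucont a b (fun s => F s + G s).
Proof.
move=> r i e e0; have e2 : 0 < e / 2 by rewrite divr_gt0.
have [d1 d10 H1] := r _ e2; have [d2 d20 H2] := i _ e2.
exists (Num.min d1 d2); first by rewrite lt_min d10.
move=> s t as_ st tb; rewrite lt_min => /andP[/(H1 s t as_ st tb) ts1 /(H2 s t as_ st tb) ts2].
rewrite [X in `|X|](_ : _ = (F t - F s) + (G t - G s)); last by ring.
by apply: le_trans (ler_normD _ _) _; lra.
Qed.

(** The whole forcing p goes into the constant of Gronwall's inequality; p = 0 gives growth bounds,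
    small p gives stability. *)
Lemma system_gronwall a b U V fU fV (w p : R -> R) : a <= b ->
  cprim a b U fU -> cprim a b V fV -> intble a b w -> intble a b p ->
  (forall s, a <= s -> s <= b -> 0 <= w s) -> (forall s, a <= s -> s <= b -> 0 <= p s) ->
  (forall s, a <= s -> s <= b -> n1 (fU s) + n1 (fV s) <= w s * (n1 (U s) + n1 (V s)) + p s) ->
  forall t, a <= t -> t <= b ->
  n1 (U t) + n1 (V t) <= (n1 (U a) + n1 (V a) + rint a b p) * expR (rint a b w).
Proof.
move=> ab pU pV iw ip w0 p0 H t at_ tb.
have uN : ucont a b (fun s => n1 (U s) + n1 (V s)).
  by apply: ucontD; [exact: (cprim_ucont_n1 pU)|exact: (cprim_ucont_n1 pV)].
set C := n1 (U a) + n1 (V a) + rint a b p.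
have C0 : 0 <= C.
  by apply: addr_ge0; [apply: addr_ge0; exact: n1_ge0|exact: rint_ge0].
have G s : a <= s -> s <= b -> n1 (U s) + n1 (V s) <= C + rint a s (fun s => w s * (n1 (U s) + n1 (V s))).
  move=> as_ sb; have [iU HU] := cprim_n1 pU as_ sb; have [iV HV] := cprim_n1 pV as_ sb.
  have iwN : intble a s (fun s => w s * (n1 (U s) + n1 (V s))).
    exact: intble_sub (lexx _) sb (intbleM ab iw uN).
  have ips : intble a s p by exact: intble_sub (lexx _) sb ip.
  have H1 : rint a s (fun s => n1 (fU s) + n1 (fV s)) <=
      rint a s (fun s => w s * (n1 (U s) + n1 (V s)) + p s).
    apply: le_rint; [exact: intbleD|exact: intbleD|].
    by move=> x ax xs; apply: H => //; exact: le_trans sb.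
  rewrite (rintD iU iV) (rintD iwN ips) in H1.
  have H2 := rint_mono ip p0 (lexx a) as_ sb.
  rewrite /C; lra.
apply: le_trans (gronwall ab uN iw w0 G at_ tb) _.
by apply: ler_wpM2l => //; rewrite ler_expR; exact: rint_mono.
Qed.

(** Divided by h k, the hypothesis makes the difference quotient Lipschitz away from h = 0, hence
    Cauchy at 0; the derivative is found as its limit and need not be guessed. *)
Lemma Cderivable_of_quotients (F : R[i] -> R[i]) z (C : R) : 0 <= C ->
  (forall h k, cmod h < 1 -> cmod k < 1 ->
    cmod (k * (F (z + h) - F z) - h * (F (z + k) - F z)) <= C * cmod h * cmod k * cmod (h - k)) ->
  Cderivable F z.
Proof.
move=> C0 H; pose q h := (F (z + h) - F z) / h.
have Hq h k : h != 0 -> k != 0 -> cmod h < 1 -> cmod k < 1 ->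
    cmod (q h - q k) <= C * cmod h + C * cmod k.
  move=> h0 k0 h1 k1; have := H h k h1 k1.
  have -> : k * (F (z + h) - F z) - h * (F (z + k) - F z) = h * k * (q h - q k).
    by rewrite /q; field; rewrite h0 k0.
  have hk : 0 < cmod h * cmod k by rewrite mulr_gt0// cmod_gt0.
  rewrite !cmodM => H1.
  have : cmod (q h - q k) <= C * cmod (h - k).
    by rewrite -(ler_pM2l hk); lra.
  move=> /le_trans; apply; rewrite -mulrDr ler_wpM2l// -(cmodN k).
  exact: le_cmodD.
have lim (P : R[i] -> R) : (forall z w, P z - P w <= cmod (z - w)) ->
    exists l, forall h, h != 0 -> cmod h < 1 -> `|P (q h) - l| <= C * cmod h.
  move=> P_lip.
  (* Each lower estimate P(q k) - C |k| lies below each upper estimate P(q h) + C |h|, so the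
     supremum of the lower ones is the limit of P(q h). *)
  pose S := [set x | exists h, [/\ h != 0, cmod h < 1 & x = P (q h) - C * cmod h]].
  have ubS h : h != 0 -> cmod h < 1 -> ubound S (P (q h) + C * cmod h).
    move=> h0 h1 _ [k [k0 k1 ->]].
    have := le_trans (P_lip _ _) (Hq k h k0 h0 k1 h1); lra.
  have half0 : (2^-1)%:C != 0 :> R[i] by rewrite -cmod_gt0 cmod_real normr_gt0 invr_eq0.
  have half1 : cmod (2^-1)%:C < 1 :> R by rewrite cmod_real ger0_norm ?invr_ge0// invf_lt1//; lra.
  exists (sup S) => h h0 h1.
  have S1 : P (q h) - C * cmod h <= sup S.
    by apply: ub_le_sup; [exists (P (q h) + C * cmod h); exact: ubS|exists h].
  have S2 : sup S <= P (q h) + C * cmod h.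
    by apply: ge_sup; [exists (P (q (2^-1)%:C) - C * cmod (2^-1)%:C), (2^-1)%:C|exact: ubS].
  by rewrite ler_norml; lra.
have [l1 Hl1] : exists l, forall h, h != 0 -> cmod h < 1 -> `|Re (q h) - l| <= C * cmod h.
  by apply: lim => u v; rewrite -ReN -ReD; apply: le_trans (ler_norm _) (le_Re_cmod _).
have [l2 Hl2] : exists l, forall h, h != 0 -> cmod h < 1 -> `|Im (q h) - l| <= C * cmod h.
  by apply: lim => u v; rewrite -ImN -ImD; apply: le_trans (ler_norm _) (le_Im_cmod _).
apply/CderivableP; exists (l1 +i* l2) => e e0.
have C1 : 0 < 2 * C + 1 by lra.
exists (Num.min 1 (e / (2 * C + 1))); first by rewrite lt_min ltr01 divr_gt0.
move=> h; rewrite lt_min => /andP[h1]; rewrite ltr_pdivlMr// => he.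
have [->|h0] := eqVneq h 0; first by rewrite addr0 subrr mulr0 subr0 cmod0 mulr0.
have -> : F (z + h) - F z - (l1 +i* l2) * h = (q h - (l1 +i* l2)) * h.
  by rewrite mulrBl /q divfK.
rewrite cmodM; apply: ler_wpM2r; first exact: cmod_ge0.
apply: le_trans (cmod_le_ReIm _) _; rewrite !(ReD, ReN, ImD, ImN).
have := Hl1 h h0 h1; have := Hl2 h h0 h1; have := cmod_ge0 h => /= ? ? ?; lra.
Qed.

(** Common form of both systems: al = f, be = ga = 1 for Dirac, and al = 0, be = 1 / h, ga = h for
    the Hamiltonian diag(h, 1 / h). *)
Definition csys (t : R) (al be ga : R -> R) z u v : Prop :=
  cprim 0 t u (fun s => (al s)%:C * u s - z * (be s)%:C * v s) /\
  cprim 0 t v (fun s => z * (ga s)%:C * u s - (al s)%:C * v s).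

Lemma csys_bound (W al be ga : R) z (u v : R[i]) :
  `|al| <= W -> `|be| <= W -> `|ga| <= W ->
  n1 (al%:C * u - z * be%:C * v) + n1 (z * ga%:C * u - al%:C * v) <=
  (1 + n1 z) * W * (n1 u + n1 v).
Proof.
move=> aW bW gW; have W0 := le_trans (normr_ge0 _) aW.
have H1 := n1B (al%:C * u) (z * be%:C * v); have H2 := n1B (z * ga%:C * u) (al%:C * v).
have A1 : n1 (al%:C * u) <= W * n1 u.
  by apply: le_trans (n1M _ _) _; rewrite n1C ler_wpM2r// n1_ge0.
have A2 : n1 (al%:C * v) <= W * n1 v.
  by apply: le_trans (n1M _ _) _; rewrite n1C ler_wpM2r// n1_ge0.
have A3 : n1 (z * be%:C * v) <= n1 z * W * n1 v.
  apply: le_trans (n1M _ _) _; rewrite ler_wpM2r ?n1_ge0//.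
  by apply: le_trans (n1M _ _) _; rewrite n1C ler_wpM2l// n1_ge0.
have A4 : n1 (z * ga%:C * u) <= n1 z * W * n1 u.
  apply: le_trans (n1M _ _) _; rewrite ler_wpM2r ?n1_ge0//.
  by apply: le_trans (n1M _ _) _; rewrite n1C ler_wpM2l// n1_ge0.
lra.
Qed.

(** The combination k (X_(z+h) - X_z) - h (X_(z+k) - X_z) solves the system at z with a forcing made
    of h k (X_(z+h) - X_(z+k)), and that difference is O(h - k) by Gronwall. A second use of
    Gronwall yields the hypothesis of [Cderivable_of_quotients]. *)
Lemma csys_Cderivable (t : R) (W al be ga : R -> R) (u v : R[i] -> R -> R[i]) : 0 <= t ->
  intble 0 t W -> (forall s, 0 <= s -> s <= t -> `|al s| <= W s) ->
  (forall s, 0 <= s -> s <= t -> `|be s| <= W s) ->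
  (forall s, 0 <= s -> s <= t -> `|ga s| <= W s) ->
  (forall z, csys t al be ga z (u z) (v z)) ->
  (forall z, u z 0 = u 0 0 /\ v z 0 = v 0 0) ->
  forall z, Cderivable (fun z => u z t) z /\ Cderivable (fun z => v z t) z.
Proof.
move=> t0 iW aW bW gW S init z.
have W0 s : 0 <= s -> s <= t -> 0 <= W s by move=> ? ?; apply: le_trans (aW s _ _).
have iZ (c : R) : intble 0 t (fun s => c * W s) by exact: intbleZ.
have cW0 (c : R) : 0 <= c -> forall s, 0 <= s -> s <= t -> 0 <= c * W s.
  by move=> c0 s s0 st; rewrite mulr_ge0// W0.
pose I := rint 0 t W; have I0 : 0 <= I by exact: rint_ge0.
pose E := expR ((3 + n1 z) * I).
have E1 : 0 <= E by exact: expR_ge0.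
have wz h : cmod h < 1 -> 0 <= 1 + n1 (z + h) <= 3 + n1 z.
  move=> h1; have := n1D z h; have := n1_le_cmod h; have := n1_ge0 (z + h); lra.
have expE h : cmod h < 1 -> expR (rint 0 t (fun s => (1 + n1 (z + h)) * W s)) <= E.
  by move=> /wz/andP[_ h3]; rewrite rintZ// ler_expR ler_wpM2r.
have cm0 : cmod (0 : R[i]) < 1 by rewrite cmod0.
have expE0 : expR (rint 0 t (fun s => (1 + n1 z) * W s)) <= E.
  by have := expE 0 cm0; rewrite addr0.
have z0 : 0 <= 1 + n1 z by have := n1_ge0 z; lra.
pose N0 := n1 (u 0 0) + n1 (v 0 0).
have N00 : 0 <= N0 by rewrite addr_ge0// n1_ge0.
have B1 h : cmod h < 1 -> forall s, 0 <= s -> s <= t -> n1 (u (z + h) s) + n1 (v (z + h) s) <= N0 * E.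
  move=> h1 s s0 st; have [Su Sv] := S (z + h); have [i1 i2] := init (z + h).
  have /andP[w0 _] := wz h h1.
  have := system_gronwall (p := fun=> 0) t0 Su Sv (iZ (1 + n1 (z + h))) (intble_cst _ _ _)
    (cW0 _ w0) (fun _ _ _ => lexx 0) _ s0 st.
  rewrite rint_cst// mul0r addr0 i1 i2 => H; apply: le_trans (H _) _; last first.
    by apply: ler_wpM2l => //; exact: expE.
  by move=> r r0 rt; rewrite addr0; apply: csys_bound; [exact: aW|exact: bW|exact: gW].
have fB (c : R[i]) (r : R) (p q : R[i]) : 0 <= r -> r <= t -> n1 (c * ((be r)%:C * q)) + n1 (c * ((ga r)%:C * p)) <= n1 c * W r * (n1 p + n1 q).
  move=> r0 rt.
  have A3 : n1 (c * ((be r)%:C * q)) <= n1 c * W r * n1 q.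
    apply: le_trans (n1M _ _) _; rewrite -mulrA ler_wpM2l ?n1_ge0//.
    by apply: le_trans (n1M _ _) _; rewrite n1C ler_wpM2r ?n1_ge0// bW.
  have A4 : n1 (c * ((ga r)%:C * p)) <= n1 c * W r * n1 p.
    apply: le_trans (n1M _ _) _; rewrite -mulrA ler_wpM2l ?n1_ge0//.
    by apply: le_trans (n1M _ _) _; rewrite n1C ler_wpM2r ?n1_ge0// gW.
  lra.
(* Used twice: with c = h - k for the difference of two solutions, then with c = h k for the
   second-order combination. *)
have perturbed (g c : R[i]) (U V p q : R -> R[i]) (M : R) : cmod g < 1 -> 0 <= M ->
    U 0 = 0 -> V 0 = 0 ->
    cprim 0 t U (fun s => ((al s)%:C * U s - (z + g) * (be s)%:C * V s) - c * ((be s)%:C * q s)) ->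
    cprim 0 t V (fun s => ((z + g) * (ga s)%:C * U s - (al s)%:C * V s) + c * ((ga s)%:C * p s)) ->
    (forall s, 0 <= s -> s <= t -> n1 (p s) + n1 (q s) <= M) ->
    forall s, 0 <= s -> s <= t -> n1 (U s) + n1 (V s) <= n1 c * M * I * E.
  move=> g1 M0 U0 V0 pU pV pq s s0 st.
  have cM : 0 <= n1 c * M by rewrite mulr_ge0// n1_ge0.
  have /andP[zg0 _] := wz g g1.
  have := system_gronwall t0 pU pV (iZ (1 + n1 (z + g))) (iZ (n1 c * M)) (cW0 _ zg0) (cW0 _ cM) _ s0 st.
  have n10 : n1 (0 : R[i]) = 0 by rewrite /n1 /= normr0 addr0.
  rewrite U0 V0 n10 !add0r (rintZ (n1 c * M) iW) -/I => H.
  apply: le_trans (H _) _; last first.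
    by apply: ler_wpM2l; [rewrite mulr_ge0|exact: expE].
  move=> r r0 rt.
  have H1 := n1B ((al r)%:C * U r - (z + g) * (be r)%:C * V r) (c * ((be r)%:C * q r)).
  have H2 := n1D ((z + g) * (ga r)%:C * U r - (al r)%:C * V r) (c * ((ga r)%:C * p r)).
  have H3 := csys_bound (z + g) (U r) (V r) (aW r r0 rt) (bW r r0 rt) (gW r r0 rt).
  have H4 := fB c r (p r) (q r) r0 rt.
  have H5 : n1 c * W r * (n1 (p r) + n1 (q r)) <= n1 c * M * W r.
    rewrite (mulrAC _ M); apply: ler_wpM2l; last exact: pq.
    by rewrite mulr_ge0 ?n1_ge0// W0.
  lra.
pose C1 := N0 * E * I * E.
have C10 : 0 <= C1 by rewrite /C1 !mulr_ge0.
have B2 h k : cmod h < 1 -> cmod k < 1 -> forall s, 0 <= s -> s <= t ->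
    n1 (u (z + h) s - u (z + k) s) + n1 (v (z + h) s - v (z + k) s) <= n1 (h - k) * C1.
  move=> h1 k1 s s0 st; rewrite /C1 !mulrA -(mulrA (n1 _)).
  apply: (perturbed k (h - k) (fun s => u (z + h) s - u (z + k) s)
    (fun s => v (z + h) s - v (z + k) s) (u (z + h)) (v (z + h))) => //.
  - by rewrite mulr_ge0.
  - by have [-> _] := init (z + h); have [-> _] := init (z + k); rewrite subrr.
  - by have [_ ->] := init (z + h); have [_ ->] := init (z + k); rewrite subrr.
  - by apply: eq_cprim (cprimB (S (z + h)).1 (S (z + k)).1) => // r _ _; ring.
  - by apply: eq_cprim (cprimB (S (z + h)).2 (S (z + k)).2) => // r _ _; ring.
  - exact: B1.
have B3 h k : cmod h < 1 -> cmod k < 1 ->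
    n1 (k * (u (z + h) t - u z t) - h * (u (z + k) t - u z t)) +
    n1 (k * (v (z + h) t - v z t) - h * (v (z + k) t - v z t)) <=
    n1 (h * k) * (n1 (h - k) * C1) * I * E.
  move=> h1 k1.
  apply: (perturbed 0 (h * k)
    (fun s => k * (u (z + h) s - u z s) - h * (u (z + k) s - u z s))
    (fun s => k * (v (z + h) s - v z s) - h * (v (z + k) s - v z s))
    (fun s => u (z + h) s - u (z + k) s) (fun s => v (z + h) s - v (z + k) s)) => //.
  - by rewrite mulr_ge0// n1_ge0.
  - have [-> _] := init (z + h); have [-> _] := init (z + k); have [-> _] := init z.
    by rewrite subrr !mulr0 subrr.
  - have [_ ->] := init (z + h); have [_ ->] := init (z + k); have [_ ->] := init z.
    by rewrite subrr !mulr0 subrr.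
  - apply: eq_cprim (cprimB (cprimZ k (cprimB (S (z + h)).1 (S z).1))
      (cprimZ h (cprimB (S (z + k)).1 (S z).1))) => // r _ _; ring.
  - apply: eq_cprim (cprimB (cprimZ k (cprimB (S (z + h)).2 (S z).2))
      (cprimZ h (cprimB (S (z + k)).2 (S z).2))) => // r _ _; ring.
  - exact: B2.
(* Passing from [n1] to [cmod] costs a factor 2 for each of h, k and h - k. *)
pose C := 8 * (C1 * I * E).
have C0 : 0 <= C by rewrite /C !mulr_ge0.
have B4 h k : cmod h < 1 -> cmod k < 1 ->
    n1 (h * k) * (n1 (h - k) * C1) * I * E <= C * cmod h * cmod k * cmod (h - k).
  move=> h1 k1; have H : n1 (h * k) <= 4 * (cmod h * cmod k).
    apply: le_trans (n1M _ _) _.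
    have := n1_le_cmod h; have := n1_le_cmod k; have := n1_ge0 h; have := n1_ge0 k; nra.
  have H2 := n1_le_cmod (h - k).
  have D0 : 0 <= C1 * I * E by rewrite !mulr_ge0.
  have -> : n1 (h * k) * (n1 (h - k) * C1) * I * E = n1 (h * k) * n1 (h - k) * (C1 * I * E) by ring.
  have -> : C * cmod h * cmod k * cmod (h - k) =
    4 * (cmod h * cmod k) * (2 * cmod (h - k)) * (C1 * I * E) by rewrite /C; ring.
  by apply: ler_wpM2r => //; apply: ler_pM; rewrite ?n1_ge0.
split; apply: (Cderivable_of_quotients C0) => h k h1 k1;
  apply: le_trans (cmod_le_n1 _) _; apply: (le_trans _ (B4 h k h1 k1));
  apply: (le_trans _ (B3 h k h1 k1)); rewrite ?lerDl ?lerDr; exact: n1_ge0.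
Qed.

End ComplexSystems.

(** * Growth of the energy along a system *)

Section Energy.
Context {R : realType}.
Local Notation leb := (@lebesgue_measure R).
Implicit Types (c : R) (u v : R[i]).

(* [Ec 1 u v = u - i v] is the Hermite-Biehler function of the solution (u, v),
   and [Fc 1 u v = u + i v] is E^# for real solutions; the parameter c
   accounts for the dilation (u, v) |-> (c u, v / c). *)
Definition Ec c u v : R[i] := (c * Re u + c^-1 * Im v) +i* (c * Im u - c^-1 * Re v).
Definition Fc c u v : R[i] := (c * Re u - c^-1 * Im v) +i* (c * Im u + c^-1 * Re v).

Lemma Ec1 u v : Ec 1 u v = u - (0 +i* 1) * v.
Proof.
case: u v => [a b] [d e]; apply: complexP; rewrite /= invr1 !mul1r !mul0r; ring.
Qed.

(** As c drops out, the inequality |F| <= |E| passes from one dilation to every other. *)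
Lemma energy_gap c u v : c != 0 ->
  cmod (Ec c u v) ^+ 2 - cmod (Fc c u v) ^+ 2 = 4 * (Re u * Im v - Im u * Re v).
Proof. by move=> c0; rewrite !sqr_cmod /=; field. Qed.

Lemma le_sqr_cmod u v : (cmod u ^+ 2 <= cmod v ^+ 2) = (cmod u <= cmod v).
Proof. by rewrite ler_pXn2r// nnegrE cmod_ge0. Qed.

(** With q = d / c, E_d = (q + 1/q)/2 E_c + (q - 1/q)/2 F_c. As |F_c| <= |E_c|, the modulus of E_d
    is at least min(q, 1/q) |E_c|. *)
Lemma Ec_dilation c d k u v : 0 < c -> 0 < d -> expR (- k) * c <= d -> d <= expR k * c ->
  cmod (Fc c u v) <= cmod (Ec c u v) ->
  cmod (Fc d u v) <= cmod (Ec d u v) /\ expR (- k) * cmod (Ec c u v) <= cmod (Ec d u v).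
Proof.
move=> c0 d0 dl du FE.
have c_neq0 : c != 0 by rewrite gt_eqF.
have d_neq0 : d != 0 by rewrite gt_eqF.
split.
  rewrite -le_sqr_cmod -subr_ge0 energy_gap// -(energy_gap u v c_neq0) subr_ge0.
  by rewrite le_sqr_cmod.
pose q := d / c; have q0 : 0 < q by rewrite divr_gt0.
have q_neq0 : q != 0 by rewrite gt_eqF.
have ql : expR (- k) <= q by rewrite ler_pdivlMr.
have qu : expR (- k) <= q^-1.
  by rewrite expRN lef_pV2 ?posrE ?expR_gt0// ler_pdivrMr.
have -> : Ec d u v = ((q + q^-1) / 2)%:C * Ec c u v + ((q - q^-1) / 2)%:C * Fc c u v.
  by apply: complexP; rewrite !(ReD, ImD, ReM, ImM) /= /q; field; rewrite c_neq0 d_neq0.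
set E := Ec c u v in FE *; set F := Fc c u v in FE *.
set m := (q - q^-1) / 2.
have H : cmod (((q + q^-1) / 2)%:C * E) <= cmod (((q + q^-1) / 2)%:C * E + m%:C * F) + cmod (m%:C * F).
  rewrite -[X in cmod X](addrK (m%:C * F)).
  by apply: le_trans (le_cmodD _ _) _; rewrite cmodN.
rewrite !cmodM !cmod_real in H.
have s0 : 0 < (q + q^-1) / 2 by rewrite divr_gt0// addr_gt0// invr_gt0.
rewrite (gtr0_norm s0) in H.
have H2 : `|m| * cmod F <= `|m| * cmod E by rewrite ler_wpM2l.
have E0 := cmod_ge0 E.
suff : expR (- k) * cmod E <= ((q + q^-1) / 2 - `|m|) * cmod E by lra.
apply: ler_wpM2r => //.
by have [m0|m0] := leP 0 m; [rewrite (ger0_norm m0)|rewrite (ltr0_norm m0)]; rewrite /m; lra.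
Qed.

(** Here e1 + i e2 = E and g1 + i g2 = F. The potential adds the same term 2 f M, with M the real
    scalar product of E and F, to the derivatives of |E|^2 and |F|^2. So |E|^2 - |F|^2 is
    nondecreasing, hence |M| <= |E|^2, and the derivative of |E|^2 is at least (2 y - 2 |f|)
    |E|^2. *)
Lemma energy_real (a b x y : R) (f e1 e2 g1 g2 : R -> R) : a <= b -> 0 <= y ->
  intble a b f ->
  prim a b e1 (fun s => y * e1 s + x * e2 s + f s * g1 s) ->
  prim a b e2 (fun s => y * e2 s - x * e1 s + f s * g2 s) ->
  prim a b g1 (fun s => - y * g1 s - x * g2 s + f s * e1 s) ->
  prim a b g2 (fun s => - y * g2 s + x * g1 s + f s * e2 s) ->
  g1 a ^+ 2 + g2 a ^+ 2 <= e1 a ^+ 2 + e2 a ^+ 2 ->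
  g1 b ^+ 2 + g2 b ^+ 2 <= e1 b ^+ 2 + e2 b ^+ 2 /\
  (e1 a ^+ 2 + e2 a ^+ 2) * expR (2 * (y * (b - a) - rint a b (fun s => `|f s|))) <=
  e1 b ^+ 2 + e2 b ^+ 2.
Proof.
move=> ab y0 iF p1 p2 q1 q2 H0.
pose A s := e1 s ^+ 2 + e2 s ^+ 2; pose B s := g1 s ^+ 2 + g2 s ^+ 2.
pose M s := e1 s * g1 s + e2 s * g2 s.
have pA : prim a b A (fun s => 2 * y * A s + 2 * f s * M s).
  apply: eq_prim (primD (primM ab p1 p1) (primM ab p2 p2)) => // s _ _;
    rewrite /A /M; ring.
have pB : prim a b B (fun s => - (2 * y) * B s + 2 * f s * M s).
  apply: eq_prim (primD (primM ab q1 q1) (primM ab q2 q2)) => // s _ _;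
    rewrite /B /M; ring.
have AB s : a <= s -> s <= b -> B s <= A s.
  move=> as_ sb; have pAB := prim_sub (primB pA pB) (lexx a) sb.
  have := prim_ge0_le as_ pAB; rewrite -subr_ge0 => /(_ _) H.
  have : A a - B a <= A s - B s.
    apply: (prim_ge0_le as_ pAB) => r ar rs; rewrite /A /B.
    have -> : 2 * y * (e1 r ^+ 2 + e2 r ^+ 2) + 2 * f r * M r -
      (- (2 * y) * (g1 r ^+ 2 + g2 r ^+ 2) + 2 * f r * M r) =
      2 * y * (e1 r ^+ 2 + e2 r ^+ 2 + (g1 r ^+ 2 + g2 r ^+ 2)) by ring.
    by rewrite mulr_ge0 ?mulr_ge0// !addr_ge0// sqr_ge0.
  rewrite /A /B in H0 *; lra.
split; first exact: (AB b ab (lexx b)).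
have ig : intble a b (fun s => 2 * y - 2 * `|f s|).
  by apply: intbleB; [exact: intble_cst|apply/intbleZ/intble_norm].
have -> : 2 * (y * (b - a) - rint a b (fun s => `|f s|)) = rint a b (fun s => 2 * y - 2 * `|f s|).
  rewrite rintB; [|exact: intble_cst|by apply/intbleZ/intble_norm].
  by rewrite (rintZ 2 (intble_norm iF)) rint_cst//; ring.
apply: (gronwall_lower ab pA ig) => s as_ sb.
have MA : `|M s| <= A s.
  have := AB s as_ sb; rewrite ler_norml /A /B /M => ?.
  have := sqr_ge0 (e1 s - g1 s); have := sqr_ge0 (e2 s - g2 s).
  have := sqr_ge0 (e1 s + g1 s); have := sqr_ge0 (e2 s + g2 s).
  by move=> ? ? ? ?; apply/andP; split; nra.
have : - (`|f s| * A s) <= f s * M s.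
  rewrite lerNl; apply: le_trans (ler_norm _) _; rewrite normrN normrM.
  exact: ler_wpM2l.
lra.
Qed.

(** In the variables (c u, v / c) the coefficients c^2 and c^-2 become 1. The Dirac system is the
    case c = 1, a block of the step system the case f = 0. *)
Lemma energy_growth (a b c : R) (f : R -> R) z (u v : R -> R[i]) : a <= b -> 0 < c ->
  0 <= Im z -> intble a b f ->
  cprim a b u (fun s => (f s)%:C * u s - z * (c ^+ 2)^-1%:C * v s) ->
  cprim a b v (fun s => z * (c ^+ 2)%:C * u s - (f s)%:C * v s) ->
  cmod (Fc c (u a) (v a)) <= cmod (Ec c (u a) (v a)) ->
  cmod (Fc c (u b) (v b)) <= cmod (Ec c (u b) (v b)) /\
  expR (Im z * (b - a) - rint a b (fun s => `|f s|)) * cmod (Ec c (u a) (v a)) <=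
  cmod (Ec c (u b) (v b)).
Proof.
move=> ab c0 y0 iF [ru iu] [rv iv]; have c_neq0 : c != 0 by rewrite gt_eqF.
move=> H0; rewrite -le_sqr_cmod !sqr_cmod /= in H0.
have := @energy_real a b (Re z) (Im z) f (fun s => c * Re (u s) + c^-1 * Im (v s))
  (fun s => c * Im (u s) - c^-1 * Re (v s)) (fun s => c * Re (u s) - c^-1 * Im (v s))
  (fun s => c * Im (u s) + c^-1 * Re (v s)) ab y0 iF _ _ _ _ H0.
case.
- apply: eq_prim (primD (primZ c ru) (primZ c^-1 iv)) => // s _ _.
  by rewrite !(ReD, ImD, ReN, ImN, ReM, ImM) /=; field.
- apply: eq_prim (primB (primZ c iu) (primZ c^-1 rv)) => // s _ _.
  by rewrite !(ReD, ImD, ReN, ImN, ReM, ImM) /=; field.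
- apply: eq_prim (primB (primZ c ru) (primZ c^-1 iv)) => // s _ _.
  by rewrite !(ReD, ImD, ReN, ImN, ReM, ImM) /=; field.
- apply: eq_prim (primD (primZ c iu) (primZ c^-1 rv)) => // s _ _.
  by rewrite !(ReD, ImD, ReN, ImN, ReM, ImM) /=; field.
move=> H1 H2; split; first by rewrite -le_sqr_cmod !sqr_cmod.
rewrite -(ler_pXn2r (_ : 0 < 2)%N) ?nnegrE ?cmod_ge0 ?mulr_ge0 ?cmod_ge0 ?expR_ge0//.
by rewrite exprMn !sqr_cmod mulrC -expRM_natl.
Qed.

End Energy.

(** * From matrix equations to scalar integral equations *)

Section Solutions.
Context {R : realType}.
Local Notation leb := (@lebesgue_measure R).
Implicit Types (f h : R -> R) (z : R[i]) (X : R -> 'cV[R[i]]_2).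

(** The rows of Omega X' are v' and - u', whence the swapped components and the sign. *)
Lemma solution_cprim (A : R -> 'M[R[i]]_2) X t : is_solution A X -> 0 <= t ->
  cprim 0 t (fun s => X s 1 0) (fun s => (A s *m X s) 0 0) /\
  cprim 0 t (fun s => X s 0 0) (fun s => - ((A s *m X s) 1 0)).
Proof.
move=> sol t0.
have H i s : 0 <= s -> s <= t -> Cintegrable `[0, s] (fun s => (A s *m X s) i 0) /\
    (Omega *m (X s - X 0)) i 0 = Cintegral `[0, s] (fun s => (A s *m X s) i 0).
  by move=> s0 _; exact: sol.
have [iv1 iv2] := (H 0 t t0 (lexx t)).1; have [iu1 iu2] := (H 1 t t0 (lexx t)).1.
have ev s : 0 <= s -> s <= t -> X s 1 0 - X 0 1 0 = Cintegral `[0, s] (fun s => (A s *m X s) 0 0).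
  move=> s0 st; rewrite -(H 0 s s0 st).2 !mxE !big_ord_recl big_ord0 !mxE /=.
  by rewrite mul0r mul1r add0r addr0; congr (X _ _ _ - X _ _ _); exact: val_inj.
have eu s : 0 <= s -> s <= t -> X s 0 0 - X 0 0 0 = - Cintegral `[0, s] (fun s => (A s *m X s) 1 0).
  move=> s0 st; rewrite -(H 1 s s0 st).2 !mxE !big_ord_recl big_ord0 !mxE /=.
  by rewrite mul0r mulN1r !addr0 opprK.
split; split; split => //.
- move=> s s0 st; have := congr1 (@complex.Re R) (ev s s0 st); rewrite ReD ReN /= /rint => <-.
  by rewrite addrC subrK.
- move=> s s0 st; have := congr1 (@complex.Im R) (ev s s0 st); rewrite ImD ImN /= /rint => <-.
  by rewrite addrC subrK.
- rewrite (_ : (fun s => Re (- _)) = (fun s => (-1) * Re ((A s *m X s) 1 0))); first exact: intbleZ.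
  by apply/funext => s; rewrite ReN mulN1r.
- move=> s s0 st; have := congr1 (@complex.Re R) (eu s s0 st); rewrite !ReN ReD ReN => /eqP.
  rewrite subr_eq addrC => /eqP ->; congr (_ + _).
  rewrite (_ : (fun s => Re (- _)) = (fun s => (-1) * Re ((A s *m X s) 1 0))).
    by rewrite rintZ ?mulN1r//; exact: intble_sub iu1.
  by apply/funext => r; rewrite ReN mulN1r.
- rewrite (_ : (fun s => Im (- _)) = (fun s => (-1) * Im ((A s *m X s) 1 0))); first exact: intbleZ.
  by apply/funext => s; rewrite ImN mulN1r.
- move=> s s0 st; have := congr1 (@complex.Im R) (eu s s0 st); rewrite !ImN ImD ImN => /eqP.
  rewrite subr_eq addrC => /eqP ->; congr (_ + _).
  rewrite (_ : (fun s => Im (- _)) = (fun s => (-1) * Im ((A s *m X s) 1 0))).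
    by rewrite rintZ ?mulN1r//; exact: intble_sub iu2.
  by apply/funext => r; rewrite ImN mulN1r.
Qed.

Lemma mx2_mul (K : pzRingType) (a b c d : K) (x : 'cV[K]_2) :
  (mx2 a b c d *m x) 0 0 = a * x 0 0 + b * x 1 0 /\
  (mx2 a b c d *m x) 1 0 = c * x 0 0 + d * x 1 0.
Proof.
by split; rewrite !mxE !big_ord_recl big_ord0 !mxE /= addr0; congr (_ + _ * x _ _); exact: val_inj.
Qed.

Lemma neumann_dirac f z X : is_neumann_solution (dirac_system f z) X ->
  [/\ X 0 0 0 = 1, X 0 1 0 = 0 & forall t, 0 <= t ->
   csys t f (fun=> 1) (fun=> 1) z (fun s => X s 0 0) (fun s => X s 1 0)].
Proof.
move=> [sol X0]; rewrite X0 !mxE /=; split => // t t0.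
have [pv pu] := solution_cprim sol t0.
have E s : dirac_system f z s = mx2 z (- (f s)%:C) (- (f s)%:C) z.
  apply/matrixP => i j; rewrite !mxE.
  by case: i => [[|[|//]] ?]; case: j => [[|[|//]] ?] /=; rewrite ?subr0 ?sub0r ?oppr0 ?addr0 ?mulr1n ?mulr0n ?sub0r ?subr0.
split.
- apply: eq_cprim pu => // s _ _; rewrite E (mx2_mul _ _ _ _ _).2; ring.
- apply: eq_cprim pv => // s _ _; rewrite E (mx2_mul _ _ _ _ _).1; ring.
Qed.

Lemma neumann_canonical h z X :
  is_neumann_solution (canonical_system (diag_hamiltonian h) z) X ->
  [/\ X 0 0 0 = 1, X 0 1 0 = 0 & forall t, 0 <= t ->
   csys t (fun=> 0) (fun s => (h s)^-1) h z (fun s => X s 0 0) (fun s => X s 1 0)].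
Proof.
move=> [sol X0]; rewrite X0 !mxE /=; split => // t t0.
have [pv pu] := solution_cprim sol t0.
have E s : canonical_system (diag_hamiltonian h) z s = mx2 (z * (h s)%:C) 0 0 (z * (h s)^-1%:C).
  apply/matrixP => i j; rewrite !mxE.
  by case: i => [[|[|//]] ?]; case: j => [[|[|//]] ?] /=; rewrite ?mulr0.
split.
- apply: eq_cprim pu => // s _ _; rewrite E (mx2_mul _ _ _ _ _).2; ring.
- apply: eq_cprim pv => // s _ _; rewrite E (mx2_mul _ _ _ _ _).1; ring.
Qed.

Lemma hermite_biehlerE (X : R[i] -> R -> 'cV[R[i]]_2) t z :
  hermite_biehler X t z = Ec 1 (X z t 0 0) (X z t 1 0).
Proof. by rewrite Ec1. Qed.

End Solutions.

(** * Lower bounds for E_t, uniform in the step *)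

Section StepHamiltonian.
Context {R : realType}.
Local Notation leb := (@lebesgue_measure R).
Variable f : R -> R.
Hypothesis hf : forall a, 0 < a -> intble 0 a f.

Definition mass (a b : R) : R := rint a b (fun s => `|f s|).
(** Logarithm of the first entry of M_0: [expR (logc t)] is the dilation whose square is h11(t). *)
Definition logc (t : R) : R := rint 0 t f.

Lemma intble_f a b : 0 <= a -> a <= b -> intble a b f.
Proof.
move=> a0 ab; have b1 : 0 < b + 1 by lra.
by apply: intble_sub (hf b1); lra.
Qed.

Lemma intble_absf a b : 0 <= a -> a <= b -> intble a b (fun s => `|f s|).
Proof. by move=> a0 ab; exact: intble_norm (intble_f a0 ab). Qed.

Lemma mass_ge0 a b : 0 <= mass a b.
Proof. exact: rint_ge0. Qed.

Lemma mass_split a m b : 0 <= a -> a <= m -> m <= b -> mass a b = mass a m + mass m b.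
Proof. by move=> a0 am mb; apply: rint_split => //; apply: intble_absf => //; exact: le_trans mb. Qed.

Lemma mass_mono a b c d : 0 <= a -> a <= c -> c <= d -> d <= b -> mass c d <= mass a b.
Proof.
move=> a0 ac cd db; have ad := le_trans ac cd; have ab := le_trans ad db.
exact: (rint_mono (intble_absf a0 ab)).
Qed.

Lemma prim_logc t : 0 <= t -> prim 0 t logc f.
Proof.
by move=> t0; split; [exact: intble_f|move=> s s0 st; rewrite /logc rint_same add0r].
Qed.

Lemma dist_logc s t : 0 <= s -> s <= t -> `|logc t - logc s| <= mass s t.
Proof.
move=> s0 st; rewrite (prim_incr (prim_logc (le_trans s0 st)) s0 st (lexx t)).
rewrite addrAC subrr add0r; apply: le_normr_rint; exact: intble_f.
Qed.

Lemma dirac_h11E t : dirac_h11 f t = expR (logc t) ^+ 2.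
Proof. by rewrite /dirac_h11 expRM_natl. Qed.

Lemma ucont_h11 t : 0 <= t -> ucont 0 t (dirac_h11 f).
Proof.
move=> t0; apply: ucont_expR => //.
exact: prim_ucont (primZ 2 (prim_logc t0)).
Qed.

Definition block (T : R) (n : nat) : R := T^-1 * rint (n%:R * T) (n.+1%:R * T) (dirac_h11 f).

Lemma block_le (T : R) n : 0 < T -> 0 <= n%:R * T <= n.+1%:R * T.
Proof.
move=> /ltW T0; rewrite mulr_ge0//=; apply: ler_wpM2r => //; by rewrite ler_nat.
Qed.

Lemma step_averageE (T : R) n s : 0 < T -> n%:R * T <= s -> s < n.+1%:R * T ->
  step_average T (dirac_h11 f) s = block T n.
Proof.
move=> T0 ns sn; rewrite /step_average /block /rint.
have -> // : Num.truncn (s / T) = n.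
by apply/truncn_def/andP; rewrite ler_pdivlMr// ltr_pdivrMr.
Qed.

(** On a block log h11 = 2 [logc] varies by at most twice the integral of |f|, so each value of h11
    there is within these factors of h11(s), and so is the average. *)
Lemma block_ratio (T : R) n s : 0 < T -> n%:R * T <= s -> s <= n.+1%:R * T ->
  expR (- mass (n%:R * T) (n.+1%:R * T)) ^+ 2 * dirac_h11 f s <= block T n <=
  expR (mass (n%:R * T) (n.+1%:R * T)) ^+ 2 * dirac_h11 f s.
Proof.
move=> T0 ns sn; set b := mass _ _.
have /andP[a0 ab] := block_le n T0; set a := n%:R * T in a0 ab ns b *.
set c := n.+1%:R * T in ab sn b *.
have ca : c - a = T by rewrite /c /a -natr1; ring.
have c0 := le_trans a0 ab.
have ih : intble a c (dirac_h11 f).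
  exact: intble_sub a0 (lexx c) (ucont_intble (ucont_h11 c0)).
have D r : a <= r -> r <= c -> `|logc r - logc s| <= b.
  move=> ar rc; have [rs|/ltW sr] := leP r s.
    rewrite distrC; apply: le_trans (dist_logc (le_trans a0 ar) rs) _.
    by apply: mass_mono.
  apply: le_trans (dist_logc (le_trans a0 ns) sr) _.
  by apply: mass_mono.
have P r : a <= r -> r <= c ->
   expR (- b) ^+ 2 * dirac_h11 f s <= dirac_h11 f r <= expR b ^+ 2 * dirac_h11 f s.
  move=> ar rc; have := D r ar rc; rewrite ler_norml => /andP[D1 D2].
  rewrite !dirac_h11E -!exprMn -!expRD.
  rewrite !ler_pXn2r ?nnegrE ?expR_ge0// !ler_expR; apply/andP; split; lra.
have K (k : R) : T^-1 * rint a c (fun=> k) = k.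
  by rewrite rint_cst// ca mulrC mulfK// gt_eqF.
rewrite /block -/a -/c; apply/andP; split.
- rewrite -[leLHS]K ler_pM2l ?invr_gt0//; apply: le_rint => //; first exact: intble_cst.
  by move=> r ar rc; have /andP[] := P r ar rc.
- rewrite -[leRHS]K ler_pM2l ?invr_gt0//; apply: le_rint => //; first exact: intble_cst.
  by move=> r ar rc; have /andP[] := P r ar rc.
Qed.

Lemma h11_gt0 t : 0 < dirac_h11 f t.
Proof. exact: expR_gt0. Qed.

Lemma block_gt0 (T : R) n : 0 < T -> 0 < block T n.
Proof.
move=> T0; have /andP[_ le] := block_le n T0.
have /andP[H _] := block_ratio T0 (lexx (n%:R * T)) le.
by apply: lt_le_trans H; rewrite mulr_gt0 ?h11_gt0// exprn_gt0// expR_gt0.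
Qed.

(** The step average has the value of its block only on a half-open segment; the right end is a null
    set. *)
Lemma rint_eq_co (a b : R) (F G : R -> R) : intble a b F -> intble a b G ->
  (forall x, a <= x -> x < b -> F x = G x) -> rint a b F = rint a b G.
Proof.
move=> iF iG FG; rewrite /rint -!Rintegral_itv_bndo_bndc.
- by apply: eq_Rintegral => x; rewrite inE /= in_itv /= => /andP[ax xb]; exact: FG.
- apply: (integrableS _ _ _ iG) => //; apply: subset_itv; rewrite bnd_simp//.
- apply: (integrableS _ _ _ iF) => //; apply: subset_itv; rewrite bnd_simp//.
Qed.

Lemma prim_eq_co (a b : R) (F g1 g2 : R -> R) : prim a b F g1 -> intble a b g2 ->
  (forall x, a <= x -> x < b -> g1 x = g2 x) -> prim a b F g2.
Proof.
move=> [i1 HF] i2 E; split => // t at_ tb; rewrite HF//; congr (_ + _).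
apply: rint_eq_co => [||x ax xt].
- exact: intble_sub (lexx _) tb i1.
- exact: intble_sub (lexx _) tb i2.
- by apply: E => //; exact: lt_le_trans tb.
Qed.

Lemma cprim_eq_co (a b : R) (c : R[i]) (U V G W : R -> R[i]) : cprim a b U V -> cprim a b G W ->
  (forall x, a <= x -> x < b -> V x = c * G x) -> cprim a b U (fun s => c * G s).
Proof.
move=> [r i] [Gr Gi] E; split.
- apply: prim_eq_co r _ _; last by move=> x ax xb; rewrite E.
  under [X in intble _ _ X]eq_fun do rewrite ReM.
  by apply: intbleB; apply/intbleZ/ucont_intble; [exact: prim_ucont Gr|exact: prim_ucont Gi].
- apply: prim_eq_co i _ _; last by move=> x ax xb; rewrite E.
  under [X in intble _ _ X]eq_fun do rewrite ImM.
  by apply: intbleD; apply/intbleZ/ucont_intble; [exact: prim_ucont Gi|exact: prim_ucont Gr].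
Qed.

(** The energy is measured with the dilation e^logc at both ends but grows with sqrt(block) in
    between: two changes of dilation, each costing e^(- mass). *)
Lemma block_growth (T : R) n z (u v : R -> R[i]) (b t : R) : 0 < T -> 0 <= Im z ->
  n%:R * T <= t -> t <= n.+1%:R * T -> t <= b ->
  csys b (fun=> 0) (fun s => (step_average T (dirac_h11 f) s)^-1)
    (step_average T (dirac_h11 f)) z u v ->
  let a := n%:R * T in
  cmod (Fc (expR (logc a)) (u a) (v a)) <= cmod (Ec (expR (logc a)) (u a) (v a)) ->
  cmod (Fc (expR (logc t)) (u t) (v t)) <= cmod (Ec (expR (logc t)) (u t) (v t)) /\
  expR (Im z * (t - a) - 2 * mass a (n.+1%:R * T)) * cmod (Ec (expR (logc a)) (u a) (v a)) <=
    cmod (Ec (expR (logc t)) (u t) (v t)).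
Proof.
move=> T0 y0 nt tn tb [Su Sv] a H0.
have /andP[a0 an] := block_le n T0.
set m := mass a (n.+1%:R * T).
have B0 := block_gt0 n T0.
pose c := Num.sqrt (block T n); have c0 : 0 < c by rewrite sqrtr_gt0.
have c2 : c ^+ 2 = block T n by rewrite sqr_sqrtr// ltW.
have ratio s : a <= s -> s <= n.+1%:R * T ->
   expR (- m) * expR (logc s) <= c /\ c <= expR m * expR (logc s).
  move=> as_ sn; have := block_ratio T0 as_ sn; rewrite dirac_h11E -c2 -!exprMn -/a -/m.
  by rewrite !ler_pXn2r ?nnegrE ?mulr_ge0 ?expR_ge0 ?(ltW c0)// => /andP[].
have [r1 r2] := ratio a (lexx a) an; have [r3 r4] := ratio t nt tn.
have [F1 E1] := Ec_dilation (expR_gt0 _) c0 r1 r2 H0.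
have sub U V : cprim 0 b U V -> cprim a t U V.
  by move=> [r i]; split; [exact: prim_sub r a0 tb|exact: prim_sub i a0 tb].
have E s : a <= s -> s < t -> step_average T (dirac_h11 f) s = c ^+ 2.
  by move=> as_ st; rewrite c2; apply: step_averageE => //; exact: lt_le_trans tn.
have [F2 E2] : cmod (Fc c (u t) (v t)) <= cmod (Ec c (u t) (v t)) /\
    expR (Im z * (t - a) - rint a t (fun s => `|0 : R|)) * cmod (Ec c (u a) (v a)) <=
    cmod (Ec c (u t) (v t)).
  apply: (energy_growth nt c0 y0 (intble_cst _ _ 0) _ _ F1).
  - apply: (eq_cprim nt _ (cprim_eq_co (c := - (z * (c ^+ 2)^-1%:C)) (sub _ _ Su) (sub _ _ Sv) _)).
      by move=> s _ _; ring.
    by move=> s as_ st; rewrite (E s as_ st); ring.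
  - apply: (eq_cprim nt _ (cprim_eq_co (c := z * (c ^+ 2)%:C) (sub _ _ Sv) (sub _ _ Su) _)).
      by move=> s _ _; ring.
    by move=> s as_ st; rewrite (E s as_ st); ring.
have r3' : expR (- m) * c <= expR (logc t).
  by rewrite expRN mulrC ler_pdivrMr ?expR_gt0// mulrC.
have r4' : expR (logc t) <= expR m * c.
  by move: r3; rewrite expRN mulrC ler_pdivrMr ?expR_gt0// mulrC.
have [F3 E3] := Ec_dilation c0 (expR_gt0 _) r3' r4' F2.
split => //; apply: le_trans E3.
rewrite normr0 rint_cst// mul0r subr0 in E2.
have -> : Im z * (t - a) - 2 * m = - m + (Im z * (t - a) + - m) by ring.
rewrite expRD -mulrA ler_wpM2l ?expR_ge0//; apply: le_trans E2.
by rewrite expRD -mulrA ler_wpM2l ?expR_ge0.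
Qed.

(** The costs of the blocks telescope to at most 2 int |f| over [0, t + 1], as the last block passes
    t by at most T <= 1. The final change from e^logc(t) to the dilation 1 costs one more such
    integral, hence the 3. *)
Theorem step_lower_bound (T t : R) z (X : R -> 'cV[R[i]]_2) : 0 < T -> T <= 1 -> 0 <= t -> 0 <= Im z ->
  is_neumann_solution (canonical_system (step_hamiltonian f T) z) X ->
  expR (Im z * t - 3 * mass 0 (t + 1)) <= cmod (Ec 1 (X t 0 0) (X t 1 0)).
Proof.
move=> T0 T1 t0 y0 /neumann_canonical[u0 v0 S].
set u := (fun s => X s 0 0) in S; set v := (fun s => X s 1 0) in S.
pose e s := cmod (Ec (expR (logc s)) (u s) (v s)).
have P n : cmod (Fc (expR (logc (n%:R * T))) (u (n%:R * T)) (v (n%:R * T))) <= e (n%:R * T) /\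
    expR (Im z * (n%:R * T) - 2 * mass 0 (n%:R * T)) <= e (n%:R * T).
  elim: n => [|n [IH1 IH2]].
    rewrite mul0r /e /logc /u /v u0 v0 rint_same expR0 /mass rint_same !mulr0 subrr expR0.
    have -> : Ec 1 1 0 = 1 :> R[i] by apply: complexP; rewrite /= ?mulr0 ?mulr1 ?addr0 ?subr0.
    have -> : Fc 1 1 0 = 1 :> R[i] by apply: complexP; rewrite /= ?mulr0 ?mulr1 ?addr0 ?subr0.
    by rewrite cmod1.
  have /andP[a0 an] := block_le n T0.
  have b0 := le_trans a0 an.
  have [H1 H2] := block_growth T0 y0 an (lexx _) (lexx _) (S _ b0) IH1.
  split => //; apply: le_trans H2.
  rewrite (mass_split (lexx 0) a0 an).
  set m1 := mass (n%:R * T) _; set m0 := mass 0 _ in IH2 *.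
  have -> : Im z * (n.+1%:R * T) - 2 * (m0 + m1) =
     (Im z * (n.+1%:R * T - n%:R * T) - 2 * m1) + (Im z * (n%:R * T) - 2 * m0) by ring.
  by rewrite expRD ler_wpM2l ?expR_ge0.
pose n := Num.truncn (t / T).
have /andP[nt tn] : n%:R * T <= t < n.+1%:R * T.
  by rewrite -ler_pdivlMr// -ltr_pdivrMr//; apply: truncn_itv; rewrite divr_ge0// ltW.
have [IH1 IH2] := P n; have /andP[a0 an] := block_le n T0.
have [H1 H2] := block_growth T0 y0 nt (ltW tn) (lexx _) (S _ t0) IH1.
have nt1 : n.+1%:R * T <= t + 1 by rewrite -natr1; lra.
set M := mass 0 (t + 1).
have k1 : `|logc t| <= M.
  rewrite -[logc t]subr0 -[X in _ - X](_ : logc 0 = 0); last by rewrite /logc rint_same.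
  by apply: le_trans (dist_logc (lexx 0) t0) _; apply: mass_mono => //; lra.
move: k1; rewrite ler_norml => /andP[k1 k2].
have d1 : expR (- M) * expR (logc t) <= 1 by rewrite -expRD -expR0 ler_expR; lra.
have d2 : 1 <= expR M * expR (logc t) by rewrite -expRD -[leLHS]expR0 ler_expR; lra.
have [_ H3] := Ec_dilation (expR_gt0 _) ltr01 d1 d2 H1.
apply: le_trans H3.
have -> : Im z * t - 3 * M = - M + (Im z * t - 2 * M) by ring.
rewrite expRD ler_wpM2l ?expR_ge0//; apply: le_trans H2.
apply: (@le_trans _ _ (expR (Im z * (t - n%:R * T) - 2 * mass (n%:R * T) (n.+1%:R * T)) *
  expR (Im z * (n%:R * T) - 2 * mass 0 (n%:R * T)))); last by rewrite ler_wpM2l ?expR_ge0.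
rewrite -expRD ler_expR.
have E : mass 0 (n.+1%:R * T) <= M.
  by apply: mass_mono => //; exact: le_trans an.
rewrite (mass_split (lexx 0) a0 an) in E; lra.
Qed.

(** The inequality for [Fc] is recorded because [Ec_dilation] takes it as input when the Dirac
    solution is dilated. *)
Theorem dirac_lower_bound (t : R) z (X : R -> 'cV[R[i]]_2) : 0 <= t -> 0 <= Im z ->
  is_neumann_solution (dirac_system f z) X ->
  cmod (Fc 1 (X t 0 0) (X t 1 0)) <= cmod (Ec 1 (X t 0 0) (X t 1 0)) /\
  expR (Im z * t - mass 0 t) <= cmod (Ec 1 (X t 0 0) (X t 1 0)).
Proof.
move=> t0 y0 /neumann_dirac[u0 v0 S]; have [Su Sv] := S t t0.
have [] := energy_growth t0 ltr01 y0 (intble_f (lexx 0) t0) (z := z) (u := fun s => X s 0 0) (v := fun s => X s 1 0) _ _ _.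
- by apply: eq_cprim Su => // s _ _; rewrite expr1n invr1.
- by apply: eq_cprim Sv => // s _ _; rewrite expr1n.
- rewrite u0 v0.
  have -> : Ec 1 1 0 = 1 :> R[i] by apply: complexP; rewrite /= ?mulr0 ?mulr1 ?addr0 ?subr0.
  have -> : Fc 1 1 0 = 1 :> R[i] by apply: complexP; rewrite /= ?mulr0 ?mulr1 ?addr0 ?subr0.
  by [].
have -> : Ec 1 (X 0 0 0) (X 0 1 0) = 1 :> R[i].
  by rewrite u0 v0; apply: complexP; rewrite /= ?mulr0 ?mulr1 ?addr0 ?subr0.
by rewrite cmod1 mulr1 subr0.
Qed.

End StepHamiltonian.

(** * Norms in L^2 as real integrals *)

Section L2.
Context {R : realType}.
Local Notation leb := (@lebesgue_measure R).

Lemma L2normE (mu : borel_measure R) (g : R -> R[i]) :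
  L2norm mu g = ((\int[mu]_x (cmod (g x) ^+ 2)%:E) `^ 2^-1)%E.
Proof.
rewrite /L2norm unlock /=; congr (_ `^ _)%E; apply: eq_integral => x _.
by rewrite ger0_norm ?cmod_ge0// powR_mulrn ?cmod_ge0.
Qed.

Lemma int_sqr_ge0 (mu : borel_measure R) (g : R -> R[i]) :
  (0 <= \int[mu]_x (cmod (g x) ^+ 2)%:E)%E.
Proof. by apply: integral_ge0 => x _; rewrite lee_fin sqr_ge0. Qed.

Lemma L2norm_sqrt (g : R -> R[i]) : Rintble (fun x => cmod (g x) ^+ 2) ->
  L2norm leb g = (Num.sqrt (Rint (fun x => cmod (g x) ^+ 2)))%:E.
Proof.
move=> ig; rewrite L2normE -[X in (X `^ _)%E]fineK; last exact: integrable_fin_num.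
by rewrite poweR_EFin powR12_sqrt// Rintegral_ge0// => x _; exact: sqr_ge0.
Qed.

Lemma L2norm_le (g : R -> R[i]) (M : R) : 0 <= M ->
  (\int[leb]_x (cmod (g x) ^+ 2)%:E <= (M ^+ 2)%:E)%E -> (L2norm leb g <= M%:E)%E.
Proof.
move=> M0 H; rewrite L2normE.
have -> : M%:E = ((M ^+ 2)%:E `^ 2^-1)%E.
  by rewrite poweR_EFin powR12_sqrt ?sqr_ge0// sqrtr_sqr ger0_norm.
apply: gt0_ler_poweR => //; rewrite ?in_itv /= ?leey ?andbT ?int_sqr_ge0//.
by rewrite lee_fin sqr_ge0.
Qed.

Lemma in_L2_Rintble (g : R -> R[i]) : in_L2 leb g -> Rintble (fun x => cmod (g x) ^+ 2).
Proof.
move=> [mr mi fin]; apply/integrableP; split.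
  apply/measurable_EFinP; under eq_fun do rewrite sqr_cmod.
  by apply: measurable_funD; apply: measurable_funX.
under eq_integral do rewrite /= ger0_norm ?sqr_ge0//.
by move: fin; rewrite L2normE => /lty_poweRy; apply; rewrite invr_eq0.
Qed.

End L2.

(** * Growth and boundary values of phi^# *)

Section DeBrangesMembership.
Context {R : realType}.
Local Notation leb := (@lebesgue_measure R).
Variables (phi : R[i] -> R[i]) (K A : R).
Hypotheses (ephi : entire phi) (A0 : 0 < A)
  (gphi : forall z, cmod (phi z) <= K * expR (A * cmod z))
  (iphi : Rintble (fun x => cmod (phi (x +i* 0)) ^+ 2)).

Lemma entire_sharp : entire (sharp phi).
Proof. by move=> z; exact: Cderivable_sharp. Qed.

Lemma sharp_growth z : cmod (sharp phi z) <= K * expR (A * cmod z).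
Proof. by rewrite /sharp cmodC; apply: le_trans (gphi _) _; rewrite cmodC. Qed.

Lemma sharp_real x : sharp phi (x +i* 0) = (phi (x +i* 0))^*.
Proof. by rewrite /sharp /= oppr0. Qed.

End DeBrangesMembership.

(** * Membership in B(E) and invariance of the norm under dilation *)

Section Membership.
Context {R : realType}.
Local Notation leb := (@lebesgue_measure R).

Lemma continuous_cmod_line (g : R[i] -> R[i]) y : (forall x, Cderivable g (x +i* y)) ->
  continuous (fun x => cmod (g (x +i* y))).
Proof.
move=> dg x; under eq_fun do rewrite -[cmod _](ger0_norm (cmod_ge0 _)) -sqrtr_sqr.
apply: (@continuous_comp _ _ _ (fun x => cmod (g (x +i* y)) ^+ 2) Num.sqrt).
  exact: continuous_sqr_cmod_line.
exact: sqrt_continuous.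
Qed.

Lemma ReZ (r : R) (w : R[i]) : Re (r%:C * w) = r * Re w.
Proof. by rewrite ReM /= mul0r subr0. Qed.

Lemma Re_inv (w : R[i]) : Re w^-1 = Re w / cmod w ^+ 2.
Proof. by case: w => a b; rewrite sqr_cmod. Qed.

(** At height y, Plancherel-Polya allows the integral of |phi|^2 the growth e^(6 A y), against the
    factor e^(- 2 t y) from 1/|E|^2: this is the origin of 3 A <= t. *)
Lemma hardy2_quotient (phi E : R[i] -> R[i]) (K A k t : R) :
  entire phi -> 0 < A -> (forall z, cmod (phi z) <= K * expR (A * cmod z)) ->
  Rintble (fun x => cmod (phi (x +i* 0)) ^+ 2) ->
  entire E -> 0 < k -> (forall z, 0 <= Im z -> k * expR (t * Im z) <= cmod (E z)) -> 3 * A <= t ->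
  hardy2 (fun z => phi z / E z).
Proof.
move=> ephi A0 gphi iphi eE k0 bE At.
have E0 z : 0 <= Im z -> E z != 0.
  by move=> y0; rewrite -cmod_gt0; apply: lt_le_trans (bE z y0); rewrite mulr_gt0// expR_gt0.
have dG z : 0 <= Im z -> Cderivable (fun z => phi z / E z) z.
  by move=> y0; apply: CderivableM => //; apply: CderivableV => //; exact: E0.
split; first by move=> z y0; apply: dG; exact: ltW.
have [M HM] := plancherel_polya ephi A0 gphi iphi.
have M0 : 0 <= M.
  have := HM 0 (lexx 0); rewrite mulr0 expR0 mulr1 -lee_fin; apply: le_trans.
  by apply: integral_ge0 => x _; rewrite lee_fin sqr_ge0.
exists (Num.sqrt M / k) => y y0; apply: L2norm_le.
  by rewrite divr_ge0// ?sqrtr_ge0// ltW.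
apply: (@le_trans _ _ (\int[leb]_x ((k^-1 * expR (- (t * y))) ^+ 2 * cmod (phi (x +i* y)) ^+ 2)%:E)%E).
  apply: ge0_le_integral => //.
  - by move=> x _; rewrite lee_fin sqr_ge0.
  - apply/measurable_EFinP; apply: continuous_measurable_fun.
    by apply: (@continuous_sqr_cmod_line _ (fun z => phi z / E z)) => x; apply: dG; exact: ltW.
  - apply/measurable_EFinP; apply: measurable_funM => //; apply: continuous_measurable_fun.
    by apply: continuous_sqr_cmod_line => x; exact: ephi.
  move=> x _; rewrite lee_fin -exprMn ler_pXn2r ?nnegrE ?cmod_ge0//; last first.
    by rewrite !mulr_ge0 ?expR_ge0 ?cmod_ge0// invr_ge0 ltW.
  rewrite cmodM cmodV mulrC; apply: ler_wpM2r; first exact: cmod_ge0.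
  rewrite expRN -invfM lef_pV2 ?posrE ?mulr_gt0 ?expR_gt0 ?cmod_gt0//.
    exact: (bE (x +i* y) (ltW y0)).
  by apply: E0; exact: ltW.
under eq_integral do rewrite EFinM.
rewrite ge0_integralZl//; first last.
- by rewrite lee_fin sqr_ge0.
- by move=> x _; rewrite lee_fin sqr_ge0.
- apply/measurable_EFinP; apply: continuous_measurable_fun.
  by apply: continuous_sqr_cmod_line => x; exact: ephi.
apply: le_trans (lee_wpmul2l _ (HM y (ltW y0))) _; first by rewrite lee_fin sqr_ge0.
rewrite -EFinM lee_fin expr_div_n sqr_sqrtr// exprMn exprVn.
rewrite [leLHS](_ : _ = M / k ^+ 2 * (expR (- (t * y)) ^+ 2 * expR (6 * A * y))); last by ring.
rewrite -[leRHS]mulr1 ler_wpM2l ?divr_ge0 ?sqr_ge0//.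
rewrite expr2 -!expRD -[leRHS]expR0 ler_expR.
have H : 0 <= (t - 3 * A) * y by rewrite mulr_ge0 ?(ltW y0)// subr_ge0.
lra.
Qed.

Lemma deBranges_quotient (phi E : R[i] -> R[i]) (K A k t : R) :
  entire phi -> 0 < A -> (forall z, cmod (phi z) <= K * expR (A * cmod z)) ->
  Rintble (fun x => cmod (phi (x +i* 0)) ^+ 2) ->
  entire E -> 0 < k -> (forall z, 0 <= Im z -> k * expR (t * Im z) <= cmod (E z)) -> 3 * A <= t ->
  deBranges E phi.
Proof.
move=> ephi A0 gphi iphi eE k0 bE At; split => //.
  exact: hardy2_quotient gphi iphi eE k0 bE At.
apply: (hardy2_quotient (entire_sharp ephi) A0 (sharp_growth gphi) _ eE k0 bE At).
by under eq_fun do rewrite sharp_real cmodC.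
Qed.

(* [1/|E|^2 - 1/|G|^2 = (c - 1/c) Re (1 / (E G))] on the real line for
   [E = u - i v], [G = c u - i v / c], and [phi phi^# / (E G)] is in H^1. *)
Lemma norm_dilation (phi : R[i] -> R[i]) (u v : R[i] -> R[i]) (K A k c t : R) :
  entire phi -> 0 < A -> (forall z, cmod (phi z) <= K * expR (A * cmod z)) ->
  Rintble (fun x => cmod (phi (x +i* 0)) ^+ 2) ->
  entire u -> entire v -> 0 < c -> 0 < k ->
  (forall x, Im (u (x +i* 0)) = 0 /\ Im (v (x +i* 0)) = 0) ->
  (forall z, 0 <= Im z -> k * expR (t * Im z) <= cmod (Ec 1 (u z) (v z))) ->
  (forall z, 0 <= Im z -> k * expR (t * Im z) <= cmod (Ec c (u z) (v z))) -> 3 * A <= t ->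
  Rint (fun x => cmod (phi (x +i* 0) / Ec 1 (u (x +i* 0)) (v (x +i* 0))) ^+ 2) =
  Rint (fun x => cmod (phi (x +i* 0) / Ec c (u (x +i* 0)) (v (x +i* 0))) ^+ 2).
Proof.
move=> ephi A0 gphi iphi eu ev c0 k0 real b1 bc At.
pose E z := Ec 1 (u z) (v z); pose G z := Ec c (u z) (v z).
have EcE d z : Ec d (u z) (v z) = d%:C * u z - (0 +i* 1) * (d^-1%:C * v z).
  by apply: complexP; rewrite !(ReD, ImD, ReN, ImN, ReM, ImM) /=; ring.
have dE d : entire (fun z => Ec d (u z) (v z)).
  move=> z; rewrite (_ : (fun z => _) = fun z => d%:C * u z - (0 +i* 1) * (d^-1%:C * v z)).
    apply: CderivableB; first by apply: CderivableM => //; exact: Cderivable_cst.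
    apply: CderivableM; first exact: Cderivable_cst.
    by apply: CderivableM => //; exact: Cderivable_cst.
  by apply/funext.
have E0 z : 0 <= Im z -> E z != 0.
  by move=> y0; rewrite -cmod_gt0; apply: lt_le_trans (b1 z y0); rewrite mulr_gt0// expR_gt0.
have G0 z : 0 <= Im z -> G z != 0.
  by move=> y0; rewrite -cmod_gt0; apply: lt_le_trans (bc z y0); rewrite mulr_gt0// expR_gt0.
pose g z := phi z * sharp phi z * ((E z)^-1 * (G z)^-1).
have dg z : 0 <= Im z -> Cderivable g z.
  move=> y0; apply: CderivableM; apply: CderivableM => //.
  - exact: entire_sharp.
  - by apply: CderivableV; [exact: E0|exact: dE].
  - by apply: CderivableV; [exact: G0|exact: dE].
have inv_le (F : R[i]) y : k * expR (t * y) <= cmod F -> cmod F^-1 <= k^-1 * expR (- (t * y)).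
  move=> H; rewrite cmodV expRN -invfM lef_pV2 ?posrE ?mulr_gt0 ?expR_gt0//.
  by apply: lt_le_trans H; rewrite mulr_gt0// expR_gt0.
have gb x y : 0 <= y -> cmod (g (x +i* y)) <=
    (K ^+ 2 * k^-1 ^+ 2) * expR (2 * A * `|x| - (2 * t - 2 * A) * y).
  move=> y0; rewrite /g !cmodM.
  have H1 := cmod_growth gphi (ltW A0) x y0.
  have H2 := cmod_growth (sharp_growth gphi) (ltW A0) x y0.
  have H3 := inv_le _ _ (b1 (x +i* y) y0); have H4 := inv_le _ _ (bc (x +i* y) y0).
  have H12 := ler_pM (cmod_ge0 _) (cmod_ge0 _) H1 H2.
  have H34 := ler_pM (cmod_ge0 _) (cmod_ge0 _) H3 H4.
  apply: le_trans (ler_pM _ _ H12 H34) _; rewrite ?mulr_ge0 ?cmod_ge0//= le_eqVlt.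
  apply/orP; left; apply/eqP.
  have L p q : K * expR p * (K * expR p) * (k^-1 * expR q * (k^-1 * expR q)) =
    (K ^+ 2 * k^-1 ^+ 2) * expR (p + p + (q + q)) by rewrite !expRD; ring.
  by rewrite L; congr (_ * expR _); ring.
have ib (F : R[i] -> R[i]) : entire F -> (forall z, 0 <= Im z -> k * expR (t * Im z) <= cmod (F z)) ->
   Rintble (fun x => cmod (phi (x +i* 0) / F (x +i* 0)) ^+ 2).
  move=> eF bF; have F0 z : 0 <= Im z -> F z != 0.
    by move=> y0; rewrite -cmod_gt0; apply: lt_le_trans (bF z y0); rewrite mulr_gt0// expR_gt0.
  apply: (Rintble_cont _ (RintbleZ (k^-1 ^+ 2) iphi)).
    apply: (@continuous_sqr_cmod_line _ (fun z => phi z / F z)) => x.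
    by apply: CderivableM => //; apply: CderivableV => //; exact: F0.
  move=> x; rewrite ger0_norm ?sqr_ge0// cmodM exprMn mulrC ler_wpM2r ?sqr_ge0//.
  rewrite ler_pXn2r ?nnegrE ?cmod_ge0 ?invr_ge0 ?(ltW k0)//.
  by have := inv_le _ _ (bF (x +i* 0) (lexx 0)); rewrite mulr0 oppr0 expR0 mulr1.
have iE := ib _ (dE 1) b1; have iG := ib _ (dE c) bc.
have ig : Rintble (fun x => cmod (g (x +i* 0))).
  apply: (Rintble_cont _ (RintbleZ (k^-1 ^+ 2) iphi)).
    by apply: (continuous_cmod_line (g := g)) => x; exact: dg.
  move=> x; rewrite ger0_norm ?cmod_ge0// /g !cmodM sharp_real cmodC mulrC -expr2.
  apply: ler_wpM2r; first exact: sqr_ge0.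
  rewrite expr2; apply: ler_pM; rewrite ?cmod_ge0//.
    by have := inv_le _ _ (b1 (x +i* 0) (lexx 0)); rewrite mulr0 oppr0 expR0 mulr1.
  by have := inv_le _ _ (bc (x +i* 0) (lexx 0)); rewrite mulr0 oppr0 expR0 mulr1.
(* With rate 2 A in x and decay rate 2 t - 2 A in y, the condition of [Rint_half_plane] is again 3 A
   <= t. *)
have At2 : 2 * (2 * A) <= 2 * t - 2 * A by lra.
have A2 : 0 < 2 * A by lra.
have R0 := Rint_half_plane A2 At2 (fun x y y0 => dg (x +i* y) y0) gb ig.
(* For real u and v, |G|^2 - |E|^2 = (c^2 - 1) u^2 + (c^-2 - 1) v^2 = (c - 1/c) (c u^2 - v^2 / c),
   and the last bracket is Re (E G). *)
have id x : cmod (phi (x +i* 0) / E (x +i* 0)) ^+ 2 =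
   cmod (phi (x +i* 0) / G (x +i* 0)) ^+ 2 + (c - c^-1) * Re (g (x +i* 0)).
  have [u0 v0] := real x; rewrite /g sharp_real.
  have nz (w : R[i]) : w != 0 -> Re w ^+ 2 + Im w ^+ 2 != 0 by rewrite -sqr_cmod sqrf_eq0 cmod_eq0.
  have := nz _ (E0 (x +i* 0) (lexx 0)); have := nz _ (G0 (x +i* 0) (lexx 0)).
  have -> : phi (x +i* 0) * (phi (x +i* 0))^* = (cmod (phi (x +i* 0)) ^+ 2)%:C.
    apply: complexP; rewrite ?(ReM, ImM) sqr_cmod; case: (phi _) => a b /=; ring.
  rewrite -invfM ReZ Re_inv cmodM exprMn.
  rewrite !cmodM !cmodV !exprMn !exprVn !(sqr_cmod (E _), sqr_cmod (G _)) ReM /E /G /= u0 v0.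
  rewrite !(mulr0, addr0, sub0r, mul1r, invr1, sqrrN, mulNr, mulrN, opprK).
  move: (cmod _ ^+ 2) (Re (u (x +i* 0))) (Re (v (x +i* 0))) => r p q G1 E1.
  have G2 : (c * p * c) ^+ 2 + q ^+ 2 != 0.
    have -> : (c * p * c) ^+ 2 + q ^+ 2 = c ^+ 2 * ((c * p) ^+ 2 + (c^-1 * q) ^+ 2).
      by field; rewrite gt_eqF.
    by rewrite mulf_neq0// sqrf_eq0 gt_eqF.
  by field; rewrite (gt_eqF c0) G2.
rewrite (_ : (fun x => cmod (phi (x +i* 0) / Ec 1 _ _) ^+ 2) =
  fun x => cmod (phi (x +i* 0) / G (x +i* 0)) ^+ 2 + (c - c^-1) * Re (g (x +i* 0))); last first.
  by apply/funext => x; exact: id.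
have iRe : Rintble (fun x => Re (g (x +i* 0))).
  apply: (Rintble_cont _ ig); last by move=> x; exact: le_Re_cmod.
  by apply: (continuous_Re_line (g := g)) => x; exact: dg.
by rewrite RintD ?RintZ ?R0 ?mulr0 ?addr0//; exact: RintbleZ.
Qed.

End Membership.

(** * Convergence of the step solutions *)

Section Limit.
Context {R : realType}.
Local Notation leb := (@lebesgue_measure R).
Variable f : R -> R.
Hypothesis hf : forall a, 0 < a -> intble 0 a f.
Local Notation h := (dirac_h11 f).
Local Notation hT T := (step_average T h).

Lemma dirac_entire (X : R[i] -> R -> 'cV[R[i]]_2) t : 0 <= t ->
  (forall z, is_neumann_solution (dirac_system f z) (X z)) ->
  entire (fun z => X z t 0 0) /\ entire (fun z => X z t 1 0).
Proof.
move=> t0 S.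
have iW : intble 0 t (fun s => `|f s| + 1).
  by apply: intbleD; [exact: intble_absf|exact: intble_cst].
have one s : 0 <= s -> s <= t -> `|1 : R| <= `|f s| + 1.
  by move=> _ _; rewrite normr1 lerDr.
have abs s : 0 <= s -> s <= t -> `|f s| <= `|f s| + 1 by move=> _ _; rewrite lerDl.
have S1 z : csys t f (fun=> 1) (fun=> 1) z (fun s => X z s 0 0) (fun s => X z s 1 0).
  by have [_ _ /(_ t t0)] := neumann_dirac (S z).
have init z : X z 0 0 0 = X 0 0 0 0 /\ X z 0 1 0 = X 0 0 1 0.
  by have [-> -> _] := neumann_dirac (S z); have [-> -> _] := neumann_dirac (S 0).
have H := csys_Cderivable (u := fun z s => X z s 0 0) (v := fun z s => X z s 1 0)
  t0 iW abs one one S1 init.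
by split=> z; have [H1 H2] := H z.
Qed.

Lemma abs_logc_le s t : 0 <= s -> s <= t -> `|logc f s| <= mass f 0 t.
Proof.
move=> s0 st; have l0 : logc f 0 = 0 by rewrite /logc rint_same.
have := dist_logc hf (lexx 0) s0; rewrite l0 subr0 => /le_trans; apply.
by apply: mass_mono.
Qed.

Lemma h11_bounds s t : 0 <= s -> s <= t ->
  expR (- (2 * mass f 0 t)) <= h s <= expR (2 * mass f 0 t).
Proof.
move=> s0 st; have := abs_logc_le s0 st; rewrite ler_norml => /andP[l1 l2].
by rewrite dirac_h11E expr2 -expRD !ler_expR; apply/andP; split; lra.
Qed.

Lemma block_index (T s : R) : 0 < T -> 0 <= s ->
  exists n, n%:R * T <= s /\ s < n.+1%:R * T.
Proof.
move=> T0 s0; exists (Num.truncn (s / T)).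
have /andP[H1 H2] := truncn_itv (divr_ge0 s0 (ltW T0)).
by rewrite -ler_pdivlMr// -ltr_pdivrMr.
Qed.

(** By [block_ratio], h^T / h lies between e^(- 2 m) and e^(2 m), while h and 1 / h are at most e^(2
    mass). A crude m gives bounds uniform in T, a small m gives convergence. *)
Lemma step_close (T s t m : R) : 0 < T -> 0 <= s -> s <= t -> 0 <= m ->
  (forall n, n%:R * T <= s -> s < n.+1%:R * T -> mass f (n%:R * T) (n.+1%:R * T) <= m) ->
  [/\ `|hT T s - h s| <= expR (2 * mass f 0 t) * (expR (2 * m) - 1),
      `|(hT T s)^-1 - (h s)^-1| <= expR (2 * mass f 0 t) * (expR (2 * m) - 1),
      0 < hT T s, hT T s <= expR (2 * m + 2 * mass f 0 t) &
      (hT T s)^-1 <= expR (2 * m + 2 * mass f 0 t)].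
Proof.
move=> T0 s0 st m0 Hm; have [n [ns sn]] := block_index T0 s0.
have {}Hm := Hm n ns sn.
rewrite (step_averageE f T0 ns sn).
have /andP[b1 b2] := block_ratio hf T0 ns (ltW sn).
have hs0 := h11_gt0 f s.
have /andP[h1 h2] := h11_bounds s0 st.
have b0 := block_gt0 hf n T0.
set M := mass f 0 t in h1 h2 *; set b := block f T n in b0 b1 b2 *.
have em : expR (mass f (n%:R * T) (n.+1%:R * T)) ^+ 2 <= expR (2 * m).
  by rewrite expr2 -expRD ler_expR; lra.
have em' : expR (- (2 * m)) <= expR (- mass f (n%:R * T) (n.+1%:R * T)) ^+ 2.
  by rewrite expr2 -expRD ler_expR; lra.
have {}b2 : b <= expR (2 * m) * h s by apply: le_trans b2 _; rewrite ler_pM2r.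
have {}b1 : expR (- (2 * m)) * h s <= b by apply: le_trans b1; rewrite ler_pM2r.
have hV0 : 0 < (h s)^-1 by rewrite invr_gt0.
have c1 : b^-1 <= expR (2 * m) * (h s)^-1.
  have -> : expR (2 * m) * (h s)^-1 = (expR (- (2 * m)) * h s)^-1 by rewrite invfM expRN invrK.
  by rewrite lef_pV2 ?posrE// mulr_gt0 ?expR_gt0.
have c2 : expR (- (2 * m)) * (h s)^-1 <= b^-1.
  have -> : expR (- (2 * m)) * (h s)^-1 = (expR (2 * m) * h s)^-1 by rewrite invfM expRN.
  by rewrite lef_pV2 ?posrE// mulr_gt0 ?expR_gt0.
have hVM : (h s)^-1 <= expR (2 * M).
  by rewrite -[2 * M]opprK expRN lef_pV2 ?posrE ?expR_gt0.
have e1 : 1 <= expR (2 * m) by rewrite -[leLHS]expR0 ler_expR; lra.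
have e2 : 1 - expR (- (2 * m)) <= expR (2 * m) - 1.
  have := expR_ge1Dx (2 * m); have := expR_ge1Dx (- (2 * m)); lra.
have e3 : 0 <= expR (2 * m) - 1 by lra.
have close (q p : R) : 0 < p -> p <= expR (2 * M) -> q <= expR (2 * m) * p ->
   expR (- (2 * m)) * p <= q -> `|q - p| <= expR (2 * M) * (expR (2 * m) - 1).
  move=> p0 pM qu ql; apply: (@le_trans _ _ (p * (expR (2 * m) - 1))); last by rewrite ler_wpM2r.
  by rewrite ler_norml; apply/andP; split; nra.
split => //; [exact: close|exact: close| |].
- by apply: le_trans b2 _; rewrite expRD ler_wpM2l ?expR_ge0.
- by apply: le_trans c1 _; rewrite expRD ler_wpM2l ?expR_ge0.
Qed.

Lemma block_mass_le (T s t : R) n : 0 < T -> T <= 1 -> s <= t ->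
  n%:R * T <= s -> s < n.+1%:R * T -> mass f (n%:R * T) (n.+1%:R * T) <= mass f 0 (t + 1).
Proof.
move=> T0 T1 st ns sn; have /andP[a0 an] := block_le n T0.
apply: mass_mono => //.
by rewrite -natr1; lra.
Qed.

Lemma step_entire (X : R[i] -> R -> 'cV[R[i]]_2) T t : 0 < T -> T <= 1 -> 0 <= t ->
  (forall z, is_neumann_solution (canonical_system (step_hamiltonian f T) z) (X z)) ->
  entire (fun z => X z t 0 0) /\ entire (fun z => X z t 1 0).
Proof.
move=> T0 T1 t0 S; pose M := mass f 0 (t + 1).
pose W := expR (2 * M + 2 * mass f 0 t).
have W0 : 0 <= W by exact: expR_ge0.
have B s : 0 <= s -> s <= t -> `|(hT T s)^-1| <= W /\ `|hT T s| <= W.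
  move=> s0 st; have [_ _ p0 p1 p2] := step_close T0 s0 st (mass_ge0 f 0 (t + 1))
    (fun n => @block_mass_le T s t n T0 T1 st).
  by rewrite !ger0_norm ?invr_ge0 ?(ltW p0).
have zero s : 0 <= s -> s <= t -> `|0 : R| <= W by rewrite normr0.
have S1 z : csys t (fun=> 0) (fun s => (hT T s)^-1) (hT T) z (fun s => X z s 0 0) (fun s => X z s 1 0).
  by have [_ _ /(_ t t0)] := neumann_canonical (S z).
have init z : X z 0 0 0 = X 0 0 0 0 /\ X z 0 1 0 = X 0 0 1 0.
  by have [-> -> _] := neumann_canonical (S z); have [-> -> _] := neumann_canonical (S 0).
have H := csys_Cderivable (u := fun z s => X z s 0 0) (v := fun z s => X z s 1 0)
  t0 (intble_cst 0 t W) zero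
  (fun s s0 st => (B s s0 st).1) (fun s s0 st => (B s s0 st).2) S1 init.
by split=> z; have [H1 H2] := H z.
Qed.

(* X = M_0 Y turns the Dirac system into the canonical system with Hamiltonian
   M_0^T M_0. *)
Lemma dirac_to_canonical z X t : 0 <= t -> is_neumann_solution (dirac_system f z) X ->
  csys t (fun=> 0) (fun s => (h s)^-1) h z
    (fun s => (expR (- logc f s))%:C * X s 0 0) (fun s => (expR (logc f s))%:C * X s 1 0).
Proof.
move=> t0 /neumann_dirac[_ _ /(_ t t0)[[ur ui] [vr vi]]].
have pl := prim_logc hf t0; have pE := prim_expR t0 pl; have pN := prim_expR t0 (primN pl).
have hE s : h s = expR (logc f s) * expR (logc f s) by rewrite dirac_h11E expr2.
have hVE s : (h s)^-1 = expR (- logc f s) * expR (- logc f s) by rewrite hE invfM expRN.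
have EN s : expR (- logc f s) = (expR (logc f s))^-1 by rewrite expRN.
have E0 s : expR (logc f s) != 0 by rewrite gt_eqF ?expR_gt0.
split; split.
- apply: eq_prim (primM t0 pN ur) => // s _ _; first by rewrite ReZ.
  by rewrite !(ReD, ReN, ReM, ImM) /= hVE EN; field.
- apply: eq_prim (primM t0 pN ui) => // s _ _; first by rewrite ImM /= mul0r addr0.
  by rewrite !(ImD, ImN, ReM, ImM) /= hVE EN; field.
- apply: eq_prim (primM t0 pE vr) => // s _ _; first by rewrite ReZ.
  by rewrite !(ReD, ReN, ReM, ImM) /= hE EN; field.
- apply: eq_prim (primM t0 pE vi) => // s _ _; first by rewrite ImM /= mul0r addr0.
  by rewrite !(ImD, ImN, ReM, ImM) /= hE EN; field.
Qed.

(** For real z the imaginary parts solve the same linear system with zero initial values, so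
    Gronwall makes them vanish. *)
Lemma dirac_real x X t : 0 <= t -> is_neumann_solution (dirac_system f (x +i* 0)) X ->
  Im (X t 0 0) = 0 /\ Im (X t 1 0) = 0.
Proof.
move=> t0 /neumann_dirac[u0 v0 /(_ t t0)[[_ ui] [_ vi]]].
have p0 : prim 0 t (fun=> 0 : R) (fun=> 0 : R) by exact: prim_cst.
have pu : cprim 0 t (fun s => (Im (X s 0 0))%:C) (fun s => (f s * Im (X s 0 0) - x * Im (X s 1 0))%:C).
  split => //=; apply: eq_prim ui => // s _ _.
  by rewrite !(ImD, ImN, ReM, ImM) /=; ring.
have pv : cprim 0 t (fun s => (Im (X s 1 0))%:C) (fun s => (x * Im (X s 0 0) - f s * Im (X s 1 0))%:C).
  split => //=; apply: eq_prim vi => // s _ _.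
  by rewrite !(ImD, ImN, ReM, ImM) /=; ring.
have iw : intble 0 t (fun s => `|f s| + `|x|).
  by apply: intbleD; [exact: intble_absf|exact: intble_cst].
have := system_gronwall t0 pu pv iw (intble_cst 0 t 0) _ _ _ t0 (lexx t).
rewrite u0 v0 /= !n1C normr0 rint_cst// mul0r !addr0 mul0r => H.
have : `|Im (X t 0 0)| + `|Im (X t 1 0)| <= 0.
  apply: H => // s _ _.
  rewrite !n1C addr0.
  have := ler_normB (f s * Im (X s 0 0)) (x * Im (X s 1 0)).
  have := ler_normB (x * Im (X s 0 0)) (f s * Im (X s 1 0)).
  by rewrite !normrM; lra.
have := normr_ge0 (Im (X t 0 0)); have := normr_ge0 (Im (X t 1 0)) => ? ? ?.
by split; apply/eqP; rewrite -normr_le0; lra.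
Qed.

(** The difference of the solutions obeys the step system with a forcing made of h^T - h and 1 / h^T
    - 1 / h times the fixed solution; it is uniformly small because short blocks carry little of the
    integral of |f|. *)
Lemma step_cvg z X t e : 0 <= t -> is_neumann_solution (dirac_system f z) X -> 0 < e ->
  exists2 d, 0 < d & forall T XT, 0 < T -> T < d ->
    is_neumann_solution (canonical_system (step_hamiltonian f T) z) XT ->
    n1 (XT t 0 0 - (expR (- logc f t))%:C * X t 0 0) +
    n1 (XT t 1 0 - (expR (logc f t))%:C * X t 1 0) <= e.
Proof.
move=> t0 S e0.
pose u s := (expR (- logc f s))%:C * X s 0 0; pose v s := (expR (logc f s))%:C * X s 1 0.
have Suv : csys t (fun=> 0) (fun s => (h s)^-1) h z u v by exact: dirac_to_canonical.
have l0 : logc f 0 = 0 by rewrite /logc rint_same.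
have [x0 y0 _] := neumann_dirac S.
have u00 : u 0 = 1 by rewrite /u l0 oppr0 expR0 x0 mulr1.
have v00 : v 0 = 0 by rewrite /v y0 mulr0.
rewrite -/(u t) -/(v t); move: u v Suv u00 v00 => u v [Su Sv] u00 v00.
have [B B0 HB] := ucont_bounded t0 (ucontD (cprim_ucont_n1 Su) (cprim_ucont_n1 Sv)).
have t1 : 0 <= t + 1 by lra.
pose M := mass f 0 (t + 1).
pose W := n1 z * expR (2 * M + 2 * mass f 0 t).
have W0 : 0 <= W by rewrite mulr_ge0 ?n1_ge0// expR_ge0.
(* Chosen so that the Gronwall bound n1(z) eta B t e^(W t) stays below e. *)
pose eta := e / ((n1 z * B * t + 1) * expR (W * t)).
have k0 : 0 < n1 z * B * t + 1 by rewrite ltr_wpDl// !mulr_ge0// n1_ge0.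
have eta0 : 0 < eta by rewrite divr_gt0// mulr_gt0// expR_gt0.
(* The solution of e^(2 mass) (e^(2 m) - 1) = eta, the left-hand side being the closeness in
   [step_close]. *)
pose m := ln (1 + eta / expR (2 * mass f 0 t)) / 2.
have q1 : 1 < 1 + eta / expR (2 * mass f 0 t) by rewrite ltrDl divr_gt0// expR_gt0.
have m0 : 0 < m by rewrite divr_gt0// ln_gt0.
have em : expR (2 * mass f 0 t) * (expR (2 * m) - 1) = eta.
  have -> : 2 * m = ln (1 + eta / expR (2 * mass f 0 t)) by rewrite /m; field.
  rewrite lnK ?posrE//; last by apply: lt_trans q1.
  by rewrite addrAC subrr add0r mulrC divfK// gt_eqF// expR_gt0.
have [d d0 Hd] := rint_ucont (intble_f hf (lexx 0) t1) m0.
exists (Num.min d 1); first by rewrite lt_min d0 ltr01.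
move=> T XT T0; rewrite lt_min => /andP[Td T1] /neumann_canonical[uT0 vT0 /(_ t t0)[STu STv]].
have close s : 0 <= s -> s <= t -> [/\ `|hT T s - h s| <= eta, `|(hT T s)^-1 - (h s)^-1| <= eta,
    `|hT T s| <= expR (2 * M + 2 * mass f 0 t) & `|(hT T s)^-1| <= expR (2 * M + 2 * mass f 0 t)].
  move=> s0 st.
  (* First the crude mass, for bounds independent of T; then the small [m], for closeness to h. *)
  have [_ _ p0 p1 p2] := step_close T0 s0 st (mass_ge0 f 0 (t + 1))
    (fun n => @block_mass_le T s t n T0 (ltW T1) st).
  have Hm n : n%:R * T <= s -> s < n.+1%:R * T -> mass f (n%:R * T) (n.+1%:R * T) <= m.
    move=> ns sn; have /andP[a0 an] := block_le n T0.
    by apply: Hd => //; rewrite -natr1; lra.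
  have [c1 c2 _ _ _] := step_close T0 s0 st (ltW m0) Hm.
  by rewrite em in c1 c2; split => //; rewrite ger0_norm ?invr_ge0 ?(ltW p0).
have pU := cprimB STu Su; have pV := cprimB STv Sv.
have iW : intble 0 t (fun=> W) by exact: intble_cst.
have iP : intble 0 t (fun=> n1 z * eta * B) by exact: intble_cst.
have P0 : 0 <= n1 z * eta * B by rewrite mulr_ge0// mulr_ge0 ?n1_ge0// ltW.
have forced s : 0 <= s -> s <= t ->
    n1 (0%:C * XT s 0 0 - z * (hT T s)^-1%:C * XT s 1 0 - (0%:C * u s - z * (h s)^-1%:C * v s)) +
    n1 (z * (hT T s)%:C * XT s 0 0 - 0%:C * XT s 1 0 - (z * (h s)%:C * u s - 0%:C * v s)) <=
    W * (n1 (XT s 0 0 - u s) + n1 (XT s 1 0 - v s)) + n1 z * eta * B.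
  move=> s0 st; have [c1 c2 c3 c4] := close s s0 st.
  have HBs := HB s s0 st; rewrite ger0_norm in HBs; last by rewrite addr_ge0 ?n1_ge0.
  set uT := XT s 0 0; set vT := XT s 1 0.
  have E1 : 0%:C * uT - z * (hT T s)^-1%:C * vT - (0%:C * u s - z * (h s)^-1%:C * v s) =
    - (z * ((hT T s)^-1%:C * (vT - v s)) + z * (((hT T s)^-1 - (h s)^-1)%:C * v s)).
    by rewrite (rmorphB (real_complex R)) /=; ring.
  have E2 : z * (hT T s)%:C * uT - 0%:C * vT - (z * (h s)%:C * u s - 0%:C * v s) =
    z * ((hT T s)%:C * (uT - u s)) + z * ((hT T s - h s)%:C * u s).
    by rewrite (rmorphB (real_complex R)) /=; ring.
  rewrite E1 E2 n1N.
  have n1z := n1_ge0 z.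
  have A (r c : R) (w : R[i]) : `|r| <= c -> n1 (z * (r%:C * w)) <= n1 z * (c * n1 w).
    move=> rc; apply: le_trans (n1M _ _) _; apply: ler_wpM2l => //.
    by apply: le_trans (n1M _ _) _; rewrite n1C ler_wpM2r// n1_ge0.
  have B1 := n1D (z * ((hT T s)^-1%:C * (vT - v s))) (z * (((hT T s)^-1 - (h s)^-1)%:C * v s)).
  have B2 := n1D (z * ((hT T s)%:C * (uT - u s))) (z * ((hT T s - h s)%:C * u s)).
  have B3 := A _ _ (vT - v s) c4; have B4 := A _ _ (v s) c2.
  have B5 := A _ _ (uT - u s) c3; have B6 := A _ _ (u s) c1.
  have B7 : n1 z * (eta * (n1 (u s) + n1 (v s))) <= n1 z * (eta * B).
    by apply: ler_wpM2l => //; apply: ler_wpM2l => //; exact: ltW.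
rewrite /W; lra.
have u0 : n1 (XT 0 0 0 - u 0) = 0 by rewrite uT0 u00 subrr n1C normr0.
have v0 : n1 (XT 0 1 0 - v 0) = 0 by rewrite vT0 v00 subrr n1C normr0.
have H : n1 (XT t 0 0 - u t) + n1 (XT t 1 0 - v t) <=
    (n1 (XT 0 0 0 - u 0) + n1 (XT 0 1 0 - v 0) + rint 0 t (fun=> n1 z * eta * B)) *
    expR (rint 0 t (fun=> W)).
  exact: (system_gronwall t0 pU pV iW iP (fun _ _ _ => W0) (fun _ _ _ => P0) forced t0 (lexx t)).
rewrite u0 v0 (rint_cst _ t0) (rint_cst _ t0) !subr0 !add0r in H; apply: le_trans H _.
rewrite (_ : n1 z * eta * B * t * expR (W * t) = eta * (n1 z * B * t * expR (W * t))); last by ring.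
rewrite /eta mulrAC ler_pdivrMr ?mulr_gt0 ?expR_gt0// ler_pM2l// ler_pM2r ?expR_gt0//.
by rewrite lerDl.
Qed.

End Limit.

Lemma hermite_biehler_entire (R : realType) (X : R[i] -> R -> 'cV[R[i]]_2) t :
  entire (fun z => X z t 0 0) -> entire (fun z => X z t 1 0) -> entire (hermite_biehler X t).
Proof.
move=> eu ev z; apply: CderivableB; first exact: eu.
by apply: CderivableM; [exact: Cderivable_cst|exact: ev].
Qed.

Lemma le_cmod_quotient (R : realType) (w E : R[i]) (k : R) : 0 < k -> k <= cmod E ->
  cmod (w / E) ^+ 2 <= k^-1 ^+ 2 * cmod w ^+ 2.
Proof.
move=> k0 kE; rewrite -exprMn ler_pXn2r ?nnegrE ?cmod_ge0//; last first.
  by rewrite mulr_ge0 ?cmod_ge0// invr_ge0 ltW.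
rewrite cmodM cmodV mulrC ler_wpM2r ?cmod_ge0// lef_pV2 ?posrE//.
exact: lt_le_trans kE.
Qed.

(** * Norms of phi as integrals against 1/|E|^2 *)

Section Embedding.
Context {R : realType}.
Local Notation leb := (@lebesgue_measure R).
Variables (phi : R[i] -> R[i]) (K A : R).
Hypotheses (ephi : entire phi) (A0 : 0 < A)
  (gphi : forall z, cmod (phi z) <= K * expR (A * cmod z))
  (iphi : Rintble (fun x => cmod (phi (x +i* 0)) ^+ 2)).

Lemma Rintble_quotient (E : R[i] -> R[i]) (k : R) : entire E -> 0 < k ->
  (forall x, k <= cmod (E (x +i* 0))) ->
  Rintble (fun x => cmod (phi (x +i* 0) / E (x +i* 0)) ^+ 2).
Proof.
move=> eE k0 bE; apply: (Rintble_cont _ (RintbleZ (k^-1 ^+ 2) iphi)).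
  apply: (@continuous_sqr_cmod_line _ (fun z => phi z / E z)) => x.
  apply: CderivableM => //; apply: CderivableV => //.
  by rewrite -cmod_gt0; apply: lt_le_trans (bE x).
by move=> x; rewrite ger0_norm ?sqr_ge0//; apply: le_cmod_quotient.
Qed.

Lemma L2norm_embedded (E : R[i] -> R[i]) (mu : borel_measure R) (k t : R) :
  isometrically_embedded E mu -> entire E -> 0 < k ->
  (forall z, 0 <= Im z -> k * expR (t * Im z) <= cmod (E z)) -> 3 * A <= t ->
  L2norm mu (restr_real phi) =
  (Num.sqrt (Rint (fun x => cmod (phi (x +i* 0) / E (x +i* 0)) ^+ 2)))%:E.
Proof.
move=> emb eE k0 bE At.
have [_ ->] := emb phi (deBranges_quotient ephi A0 gphi iphi eE k0 bE At).
rewrite /deBranges_norm L2norm_sqrt//; apply: Rintble_quotient eE k0 _ => x.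
by have := bE (x +i* 0) (lexx 0); rewrite mulr0 expR0 mulr1.
Qed.

End Embedding.

Theorem theorem5p1 (R : realType) (f : R -> R)
    (hf : forall a : R, 0 < a ->
      (@lebesgue_measure R).-integrable `[0, a] (EFin \o f))
    (mu : borel_measure R) (hmu : is_spectral_measure (dirac_system f) mu)
    (muT : R -> borel_measure R)
    (hmuT : forall T : R, 0 < T ->
      is_spectral_measure (canonical_system (step_hamiltonian f T)) (muT T))
    (a : R) (ha : 0 < a) (phi : R[i] -> R[i]) (hphi : paley_wiener a phi) :
  L2norm (muT T) (restr_real phi) @[T --> 0^'+] --> L2norm mu (restr_real phi).
Proof.
have [ephi tphi /in_L2_Rintble iphi] := hphi.
(* Exponential type a bounds phi only by e^((a + e) |z|) with e > 0; e = 1 is taken. *)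
have [K gphi] := tphi 1 ltr01.
set A := a + 1 in gphi; have A0 : 0 < A by rewrite addr_gt0.
pose t := 3 * A; have t0 : 0 <= t by rewrite mulr_ge0// ltW.
have [X solX embX] := hmu.
have tpos : 0 < t by rewrite mulr_gt0.
have [eu ev] := dirac_entire hf t0 solX.
pose m := mass f 0 (t + 1).
have mt : mass f 0 t <= m by apply: mass_mono => //; rewrite lerDl.
(* One constant for all the functions involved: the Dirac system loses m, its dilation by c below 2
   m, and the step systems 3 m. *)
pose k := expR (- (3 * m)); have k0 : 0 < k by exact: expR_gt0.
have m0 : 0 <= m by exact: mass_ge0.
have lowD z : 0 <= Im z ->
    cmod (Fc 1 (X z t 0 0) (X z t 1 0)) <= cmod (Ec 1 (X z t 0 0) (X z t 1 0)) /\
    expR (- m) * expR (t * Im z) <= cmod (Ec 1 (X z t 0 0) (X z t 1 0)).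
  move=> y0; have [H1 H2] := dirac_lower_bound hf t0 y0 (solX z); split => //.
  by apply: le_trans H2; rewrite -expRD ler_expR; lra.
have kD z : 0 <= Im z -> k * expR (t * Im z) <= cmod (hermite_biehler X t z).
  move=> y0; rewrite hermite_biehlerE; apply: le_trans (lowD z y0).2.
  by rewrite ler_wpM2r ?expR_ge0// ler_expR; lra.
have -> := L2norm_embedded ephi A0 gphi iphi (embX t tpos) (hermite_biehler_entire eu ev) k0 kD (lexx _).
(* The step solutions converge to M_0^-1 X = (c u, v / c) with this c, so the limit of their
   Hermite-Biehler functions is [Ec c] of the Dirac solution, not [Ec 1]. *)
pose c := expR (- logc f t); have c0 : 0 < c by exact: expR_gt0.
have kc z : 0 <= Im z -> k * expR (t * Im z) <= cmod (Ec c (X z t 0 0) (X z t 1 0)).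
  move=> y0; have [H1 H2] := lowD z y0.
  have := abs_logc_le hf t0 (lexx t); rewrite ler_norml => /andP[l1 l2].
  have d1 : expR (- m) * 1 <= c by rewrite mulr1 ler_expR; lra.
  have d2 : c <= expR m * 1 by rewrite mulr1 ler_expR; lra.
  have [_ H3] := Ec_dilation ltr01 c0 d1 d2 H1.
  apply: le_trans H3; apply: (@le_trans _ _ (expR (- m) * (expR (- m) * expR (t * Im z)))).
    by rewrite -!expRD ler_expR; lra.
  by rewrite ler_wpM2l ?expR_ge0.
have real x : Im (X (x +i* 0) t 0 0) = 0 /\ Im (X (x +i* 0) t 1 0) = 0.
  exact: (dirac_real hf t0 (solX (x +i* 0))).
have k1 z : 0 <= Im z -> k * expR (t * Im z) <= cmod (Ec 1 (X z t 0 0) (X z t 1 0)).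
  by move=> y0; rewrite -hermite_biehlerE; exact: kD.
pose G x := cmod (phi (x +i* 0) / Ec c (X (x +i* 0) t 0 0) (X (x +i* 0) t 1 0)) ^+ 2.
have -> : Rint (fun x => cmod (phi (x +i* 0) / hermite_biehler X t (x +i* 0)) ^+ 2) = Rint G.
  under [X in Rint X]eq_fun do rewrite hermite_biehlerE.
  exact: (norm_dilation (u := fun z => X z t 0 0) (v := fun z => X z t 1 0)
    ephi A0 gphi iphi eu ev c0 k0 real k1 kc (lexx _)).
have step T (XT : R[i] -> R -> 'cV[R[i]]_2) : 0 < T -> T <= 1 ->
    (forall z, is_neumann_solution (canonical_system (step_hamiltonian f T) z) (XT z)) ->
    entire (hermite_biehler XT t) /\
    forall z, 0 <= Im z -> k * expR (t * Im z) <= cmod (hermite_biehler XT t z).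
  move=> T0 T1 sol; split.
    by have [? ?] := step_entire hf T0 T1 t0 sol; exact: hermite_biehler_entire.
  move=> z y0; rewrite hermite_biehlerE; apply: le_trans (step_lower_bound hf T0 T1 t0 y0 (sol z)).
  by rewrite -expRD ler_expR; rewrite -/m; lra.
apply: cvg_EFin.
  near=> T; have T0 : 0 < T by [].
  have T1 : T <= 1 by near: T; apply: nbhs_right_le.
  have [XT sol emb] := hmuT T T0; have [eT kT] := step T XT T0 T1 sol.
  by rewrite (L2norm_embedded ephi A0 gphi iphi (emb t tpos) eT k0 kT (lexx _)).
(* Dominated convergence is sequential; the shift by N brings all steps below 1, where the lower
   bound with [k] holds. *)
apply/cvg_at_rightP => T [T0 Tcvg].
have [N _ HN] : \forall n \near \oo, T n < 1 by apply: (cvgr_lt _ Tcvg); exact: ltr01.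
have {}HN n : T (n + N)%N <= 1 by apply/ltW/HN; rewrite /= leq_addl.
rewrite -(cvg_shiftn N) /=.
(* A spectral measure comes with solutions only existentially, so one family is fixed for each n. *)
have /choice[XT HXT] : forall n, exists XT : R[i] -> R -> 'cV[R[i]]_2,
    (forall z, is_neumann_solution (canonical_system (step_hamiltonian f (T (n + N)%N)) z) (XT z)) /\
    (forall t, 0 < t -> isometrically_embedded (hermite_biehler XT t) (muT (T (n + N)%N))).
  by move=> n; have [XT sol emb] := hmuT _ (T0 (n + N)%N); exists XT.
pose F n x := cmod (phi (x +i* 0) / hermite_biehler (XT n) t (x +i* 0)) ^+ 2.
have FE n : fine (L2norm (muT (T (n + N)%N)) (restr_real phi)) = Num.sqrt (Rint (F n)).
  have [sol emb] := HXT n; have [eT kT] := step _ _ (T0 (n + N)%N) (HN n) sol.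
  by rewrite (L2norm_embedded ephi A0 gphi iphi (emb t tpos) eT k0 kT (lexx _)).
under eq_fun do rewrite FE.
apply: continuous_cvg; first exact: sqrt_continuous.
have kx n x : k <= cmod (hermite_biehler (XT n) t (x +i* 0)).
  have [sol _] := HXT n; have [_ kT] := step _ _ (T0 (n + N)%N) (HN n) sol.
  by have := kT (x +i* 0) (lexx 0); rewrite mulr0 expR0 mulr1.
have kcx x : k <= cmod (Ec c (X (x +i* 0) t 0 0) (X (x +i* 0) t 1 0)).
  by have := kc (x +i* 0) (lexx 0); rewrite mulr0 expR0 mulr1.
have [] // := @Rdominated_convergence _ _ _ (@lebesgue_measure R) setT F G
  (fun x => k^-1 ^+ 2 * cmod (phi (x +i* 0)) ^+ 2) measurableT.
- move=> n; apply: continuous_measurable_fun.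
  apply: (@continuous_sqr_cmod_line _ (fun z => phi z / hermite_biehler (XT n) t z)) => x.
  have [sol _] := HXT n; have [eT kT] := step _ _ (T0 (n + N)%N) (HN n) sol.
  apply: CderivableM => //; apply: CderivableV => //.
  by rewrite -cmod_gt0; apply: lt_le_trans (kx n x).
- move=> x _; rewrite /G; under eq_fun do rewrite /F cmodM cmodV exprMn exprVn.
  rewrite cmodM cmodV exprMn exprVn; apply: cvgMr; apply: cvgV.
    by rewrite sqrf_eq0 cmod_eq0 -cmod_gt0; apply: lt_le_trans (kcx x).
  under eq_fun do rewrite expr2.
  suff H : cmod (hermite_biehler (XT n) t (x +i* 0)) @[n --> \oo] -->
      cmod (Ec c (X (x +i* 0) t 0 0) (X (x +i* 0) t 1 0)).
    by rewrite expr2; exact: cvgM.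
  apply/cvgrPdist_le => e e0.
  have [d d0 Hd] := step_cvg hf t0 (solX (x +i* 0)) e0.
  have [N' _ HN'] : \forall n \near \oo, T n < d by apply: (cvgr_lt _ Tcvg).
  near=> n.
  have Td : T (n + N)%N < d.
    apply: HN' => /=; apply: leq_trans (leq_addr _ _); near: n; exact: nbhs_infty_ge.
  have [sol _] := HXT n.
  have := Hd _ _ (T0 (n + N)%N) Td (sol (x +i* 0)).
  set u := XT n _ t 0 0; set v := XT n _ t 1 0.
  set p := X _ t 0 0; set q := X _ t 1 0 => He.
  apply: (@le_trans _ _ (cmod (hermite_biehler (XT n) t (x +i* 0) - Ec c p q))).
    have D (w w' : R[i]) : cmod w - cmod w' <= cmod (w - w').
      by rewrite lerBlDr -[X in cmod X <= _](subrK w'); exact: le_cmodD.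
    by rewrite ler_norml; have := D (hermite_biehler (XT n) t (x +i* 0)) (Ec c p q);
      have := D (Ec c p q) (hermite_biehler (XT n) t (x +i* 0));
      rewrite (cmodBC (Ec c p q)) => ? ?; apply/andP; split; lra.
  rewrite hermite_biehlerE -/u -/v.
  have -> : Ec 1 u v - Ec c p q = (u - c%:C * p) - (0 +i* 1) * (v - (expR (logc f t))%:C * q).
    have cV : c^-1 = expR (logc f t) by rewrite /c expRN invrK.
    by apply: complexP; rewrite !(ReD, ReN, ImD, ImN, ReM, ImM) /= cV invr1; ring.
  apply: le_trans (le_cmodD _ _) _; rewrite cmodN cmodM.
  have -> : cmod (0 +i* 1 : R[i]) = 1 by rewrite /= expr0n /= add0r expr1n sqrtr1.
  rewrite mul1r; apply: le_trans He; apply: lerD; exact: cmod_le_n1.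
- exact: RintbleZ.
- by move=> n x _; rewrite ger0_norm ?sqr_ge0//; exact: le_cmod_quotient.
Unshelve. all: by end_near.
Qed.
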